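(* Let $m\ge2$ and let $(p:\mathcal P\to N,\omega)$ be a lightlike Cartan geometry on an $(m+1)$-dimensional manifold $N$. Then $N$ is endowed with the following structures: (1) A lightlike metric $h^\omega$ and a vector field $Z^\omega$ spanning its radical distribution. (2) A tensor field $\mathbf T^\omega\in\Gamma(\Lambda^2T^*N\otimes TN)$ which, for each $\tau\in S(N,h^\omega,Z^\omega)$, determines the Galilean connection $\widetilde\nabla^\tau$ on $(N,\tau,h^\omega)$ through the conditions $$\widetilde\nabla^\tau_{Z^\omega}Z^\omega=0,\qquad \mathrm{rot}\,Z^\omega=0,\qquad \widetilde{\mathrm{Tor}}^\tau=P^\tau\circ\mathbf T^\omega+d\tau\otimes Z^\omega$$ (that is, $\widetilde\nabla^\tau$ is the unique Galilean connection satisfying them). (3) A map $D^\omega$ that assigns to each $\tau\in S(N,h^\omega,Z^\omega)$ a vector bundle morphism $D^\tau:TN\to\mathrm{An}(\tau)$, such that for any $\tau,\bar\tau\in S(N,h^\omega,Z^\omega)$ and $W\in\mathfrak X(N)$, $$D^{\bar\tau}(W)=P^{\bar\tau}\Big(D^\tau(W)+\tfrac12h^\omega(L_{\tau,\bar\tau},L_{\tau,\bar\tau})W\Big)-\tau(W)L_{\tau,\bar\tau}-\widetilde\nabla^{\bar\tau}_WL_{\tau,\bar\tau}.$$ Here $h^\omega,Z^\omega,\mathbf T^\omega,\widetilde\nabla^\tau,D^\omega$ are the objects canonically constructed from $\omega$ as in the context.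
   Context: Conventions. Manifolds are smooth, Hausdorff, connected, second countable. $\mathbb L^{m+2}$ is $\mathbb R^{m+2}$ with its Lorentzian inner product $\langle\,,\rangle$ of signature $(m+1,1)$ and a fixed basis $(\ell,e_1,\dots,e_m,n)$ with $\ell$ in the future lightlike cone, $\langle \ell,n\rangle=1$, $\langle e_i,e_j\rangle=\delta_{ij}$ and all other products of basis vectors zero. $G=O^+(m+1,1)$ is the group of linear isometries of $\mathbb L^{m+2}$ preserving the future lightlike cone, $H\subset G$ is the isotropy subgroup of $\ell$, with Lie algebras $\mathfrak h\subset\mathfrak g$. In the fixed basis $\mathfrak g$ consists of the matrices $\begin{pmatrix} a&\zeta&0\\ X&A&-\zeta^t\\0&-X^t&-a\end{pmatrix}$ with $a\in\mathbb R$, $X\in\mathbb R^m$, $\zeta\in(\mathbb R^m)^*$, $A\in\mathfrak o(m)$, and $\mathfrak h$ is given by $a=0,X=0$; so $\mathfrak g/\mathfrak h\cong\mathbb R\times\mathbb R^m$ via $(a,X)$. Lightlike Cartan geometry. A lightlike Cartan geometry on $N$ is a principal bundle $p:\mathcal P\to N$ with structure group $H$ and $\omega\in\Omega^1(\mathcal P,\mathfrak g)$ such that each $\omega(u):T_u\mathcal P\to\mathfrak g$ is a linear isomorphism, $(r^h)^*\omega=\mathrm{Ad}(h^{-1})\circ\omega$ for $h\in H$, and $\omega(\zeta_X)=X$ for the fundamental vector field $\zeta_X$ of each $X\in\mathfrak h$. For $u\in\mathcal P$, $x=p(u)$, let $\phi_u:T_xN\to\mathfrak g/\mathfrak h$ be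 the isomorphism with $\phi_u(T_up\cdot\zeta)=\omega(u)(\zeta)+\mathfrak h$. With $q((a,X),(b,Y))=X^tY$ on $\mathbb R\times\mathbb R^m$, put $h^\omega(v,w)=q(\phi_u v,\phi_u w)$ and $Z^\omega_x=\phi_u^{-1}(1,0)$ (independent of $u$). A lightlike metric is a symmetric positive semidefinite $(0,2)$-tensor $h$ whose radical $\{v:h(v,\cdot)=0\}$ is one-dimensional at each point. $S(N,h^\omega,Z^\omega)=\{\tau\in\Omega^1(N,\mathbb R):\tau(Z^\omega)=1\}$, $\mathrm{An}(\tau)=\ker\tau\subset TN$, $P^\tau(v)=v-\tau(v)Z^\omega$. For $\tau,\bar\tau\in S(N,h^\omega,Z^\omega)$, $L_{\tau,\bar\tau}=\sum_{i=1}^m\tau(E_i)E_i$ for any local $h^\omega$-orthonormal frame $(E_i)$ of $\mathrm{An}(\bar\tau)$. Tractor bundle. $\mathcal T=\mathcal P\times_H\mathbb L^{m+2}$ with metric $\mathbf h([u,v_1],[u,v_2])=\langle v_1,v_2\rangle$ and the $\mathbf h$-metric connection $\nabla^{\mathcal T}$ induced by the unique principal connection on $\mathcal P\times_HG$ restricting to $\omega$ on $\mathcal P$; locally $\nabla^{\mathcal T}_W[s,f]=[s,W(f)+\omega(Ts\cdot W)f]$ for a local section $s$ of $\mathcal P$ and an $\mathbb L^{m+2}$-valued function $f$. Put $\xi_x=[u,\ell]$ ($p(u)=x$) and $\Phi(W)=\nabla^{\mathcal T}_W\xi$, a bundle monomorphism $TN\to\mathcal T$ with image $\xi^\perp$,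 isometric from $h^\omega$ to $\mathbf h$, with $\Phi(Z^\omega)=\xi$. The curvature is $R^{\mathcal T}(V,W)T=\nabla^{\mathcal T}_V\nabla^{\mathcal T}_WT-\nabla^{\mathcal T}_W\nabla^{\mathcal T}_VT-\nabla^{\mathcal T}_{[V,W]}T$, and $\mathbf T^\omega$ is defined by $R^{\mathcal T}(V,W)\xi=\Phi(\mathbf T^\omega(V,W))$. For $\tau\in S(N,h^\omega,Z^\omega)$ let $\eta^\tau$ be the unique lightlike section of $\mathcal T$ with $\mathbf h(\xi,\eta^\tau)=1$, $\mathbf h(\Phi(\mathrm{An}(\tau)),\eta^\tau)=0$; every section is uniquely $\alpha\xi+\Phi(X)+\beta\eta^\tau$ with $X\in\Gamma(\mathrm{An}(\tau))$. For $X\in\Gamma(\mathrm{An}(\tau))$, $\nabla^\tau_WX$ and $D^\tau(W)$ are the $\mathrm{An}(\tau)$-components of $\nabla^{\mathcal T}_W\Phi(X)$ and $\nabla^{\mathcal T}_W\eta^\tau$; $D^\omega:\tau\mapsto D^\tau$. Put $$\widetilde\nabla^\tau_VW=V(\tau(W))Z^\omega+\tau(W)P^\tau(V)+\nabla^\tau_V(P^\tau(W)).$$ Galilean connections. A Galilean connection on $(N,\tau,h^\omega)$ is a linear connection $\nabla$ on $N$ with $\nabla\tau=0$ and $V(h^\omega(X,Y))=h^\omega(\nabla_VX,Y)+h^\omega(X,\nabla_VY)$ for $V\in\mathfrak X(N)$, $X,Y\in\Gamma(\mathrm{An}(\tau))$. Its torsion is $\mathrm{Tor}(V,W)=\nabla_VW-\nabla_WV-[V,W]$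 (denoted $\widetilde{\mathrm{Tor}}^\tau$ for $\widetilde\nabla^\tau$), and $(\mathrm{rot}\,Z^\omega)(X,Y)=h^\omega(\nabla_XZ^\omega,Y)-h^\omega(X,\nabla_YZ^\omega)$ for $X,Y\in\Gamma(\mathrm{An}(\tau))$. *)

(* Defs.v *)
From HB Require Import structures.
From mathcomp Require Import all_boot all_order all_algebra.
From mathcomp Require Import all_classical all_reals all_analysis.

Set Implicit Arguments.
Unset Strict Implicit.
Unset Printing Implicit Defensive.

Import Order.TTheory GRing.Theory Num.Theory.
Import numFieldNormedType.Exports.

Local Open Scope classical_set_scope.
Local Open Scope ring_scope.

(* A function is C^oo on an open set when all its iterated directional
   derivatives exist there and are continuous. *)
Section SmoothCalculus.
Context {R : realType} {V W : normedModType R}.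

Fixpoint iter_derive (f : V -> W) (vs : seq V) : V -> W :=
  if vs is v :: vs' then fun y => derive (iter_derive f vs') y v else f.

Definition smooth_on (O : set V) (f : V -> W) : Prop :=
  forall (vs : seq V) (y : V), O y ->
    {for y, continuous (iter_derive f vs)} /\
    (forall v, derivable (iter_derive f vs) y v).

Definition smooth_at (f : V -> W) (y : V) : Prop :=
  exists O : set V, [/\ open O, O y & smooth_on O f].

End SmoothCalculus.

(* Smooth n-manifolds (not assumed connected: total spaces of principal bundles
   need not be).  The atlas is indexed by the points, chart x being a chart
   around x.  Every smooth structure has such an atlas.  Through the derivative
   of chart x at x, the tangent space T_x M is identified with 'rV[R]_n, so a
   vector field is a function M -> 'rV[R]_n, and tensors are families indexed by
   the points of multilinear maps on 'rV[R]_n. *)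
Record manifold (R : realType) (n : nat) := Manifold {
  mcarrier :> topologicalType;
  mhausdorff : hausdorff_space mcarrier;
  msecond_countable : @second_countable mcarrier;
  cdom : mcarrier -> set mcarrier;
  chart : mcarrier -> mcarrier -> 'rV[R]_n;
  cinv : mcarrier -> 'rV[R]_n -> mcarrier;
  cdom_open : forall x, open (cdom x);
  cdom_center : forall x, cdom x x;
  cimage_open : forall x, open (chart x @` cdom x);
  chartK : forall x y, cdom x y -> cinv x (chart x y) = y;
  chart_continuous : forall x y, cdom x y -> {for y, continuous (chart x)};
  cinv_continuous : forall x y, cdom x y ->
    {for chart x y, continuous (cinv x)};
  chart_compatible : forall x x',
    smooth_on (chart x @` (cdom x `&` cdom x')) (chart x' \o cinv x)
}.

Section ManifoldCalculus.
Context {R : realType} {n : nat} (M : manifold R n).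

Definition msmooth_on (V : normedModType R) (U : set M) (f : M -> V) : Prop :=
  forall x, U x -> smooth_at (f \o cinv x) (chart x x).

Definition smooth_map_on (k : nat) (P : manifold R k) (U : set M) (f : M -> P)
    : Prop :=
  forall x, U x -> {for x, continuous f} /\
    smooth_at (chart (f x) \o f \o cinv x) (chart x x).

(* Derivative at x of a vector-valued function along v in T_x M. *)
Definition mder (V : normedModType R) (f : M -> V) (x : M) (v : 'rV[R]_n) : V :=
  derive (f \o cinv x) (chart x x) v.

(* Tangent map T_x f : T_x M -> T_(f x) P. *)
Definition tmap (k : nat) (P : manifold R k) (f : M -> P) (x : M)
    (v : 'rV[R]_n) : 'rV[R]_k :=
  mder (chart (f x) \o f) x v.

Definition vfield := M -> 'rV[R]_n.

Definition smooth_vfield_on (U : set M) (X : vfield) : Prop :=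
  forall x, msmooth_on (U `&` cdom x) (fun y => mder (chart x) y (X y)).

Definition smooth_vfield (X : vfield) : Prop := smooth_vfield_on setT X.

Definition lie_bracket (X Y : vfield) : vfield := fun x =>
  mder (fun y => mder (chart x) y (Y y)) x (X x)
  - mder (fun y => mder (chart x) y (X y)) x (Y x).

Definition one_form (tau : M -> 'rV[R]_n -> R) : Prop :=
  (forall x, scalar (tau x)) /\
  (forall (U : set M) (X : vfield), open U -> smooth_vfield_on U X ->
     msmooth_on U (fun x => tau x (X x) : R)).

Definition dform (tau : M -> 'rV[R]_n -> R) (V W : vfield) (x : M) : R :=
  mder (fun y => tau y (W y) : R) x (V x)
  - mder (fun y => tau y (V y) : R) x (W x)
  - tau x (lie_bracket V W x).

Definition symmetric_tensor02 (h : M -> 'rV[R]_n -> 'rV[R]_n -> R) : Prop :=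
  [/\ forall x v, scalar (h x v),
      forall x v w, h x v w = h x w v &
      forall (U : set M) (X Y : vfield), open U ->
        smooth_vfield_on U X -> smooth_vfield_on U Y ->
        msmooth_on U (fun x => h x (X x) (Y x) : R)].

Definition radical (h : M -> 'rV[R]_n -> 'rV[R]_n -> R) (x : M) :
    set 'rV[R]_n := [set v | forall w, h x v w = 0].

Definition line (z : 'rV[R]_n) : set 'rV[R]_n :=
  [set v | exists c : R, v = c *: z].

Definition lightlike_metric (h : M -> 'rV[R]_n -> 'rV[R]_n -> R) : Prop :=
  [/\ symmetric_tensor02 h,
      forall x v, 0 <= h x v v &
      forall x, exists2 z, z != 0 & radical h x = line z].

Definition tangent_valued_two_form
    (T : M -> 'rV[R]_n -> 'rV[R]_n -> 'rV[R]_n) : Prop :=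
  [/\ forall x v, linear (T x v),
      forall x v w, T x v w = - T x w v &
      forall (U : set M) (X Y : vfield), open U ->
        smooth_vfield_on U X -> smooth_vfield_on U Y ->
        smooth_vfield_on U (fun x => T x (X x) (Y x))].

Definition bundle_morphism (D : M -> 'rV[R]_n -> 'rV[R]_n) : Prop :=
  (forall x, linear (D x)) /\
  (forall (U : set M) (X : vfield), open U -> smooth_vfield_on U X ->
     smooth_vfield_on U (fun x => D x (X x))).

(* Gamma(An(tau)), An(tau) = ker tau. *)
Definition An_section (tau : M -> 'rV[R]_n -> R) (X : vfield) : Prop :=
  smooth_vfield X /\ forall x, tau x (X x) = 0.

Record linear_connection (nab : vfield -> vfield -> vfield) : Prop := {
  conn_smooth : forall V W, smooth_vfield V -> smooth_vfield W ->
    smooth_vfield (nab V W);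
  conn_addl : forall V V' W,
    smooth_vfield V -> smooth_vfield V' -> smooth_vfield W ->
    forall x, nab (fun y => V y + V' y) W x = nab V W x + nab V' W x;
  conn_scalel : forall (f : M -> R) V W,
    msmooth_on setT f -> smooth_vfield V -> smooth_vfield W ->
    forall x, nab (fun y => f y *: V y) W x = f x *: nab V W x;
  conn_addr : forall V W W',
    smooth_vfield V -> smooth_vfield W -> smooth_vfield W' ->
    forall x, nab V (fun y => W y + W' y) x = nab V W x + nab V W' x;
  conn_leibniz : forall (f : M -> R) V W,
    msmooth_on setT f -> smooth_vfield V -> smooth_vfield W ->
    forall x, nab V (fun y => f y *: W y) x =
      mder f x (V x) *: W x + f x *: nab V W x
}.

Definition galilean_connection (tau : M -> 'rV[R]_n -> R)
    (h : M -> 'rV[R]_n -> 'rV[R]_n -> R) (nab : vfield -> vfield -> vfield)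
    : Prop :=
  [/\ linear_connection nab,
      forall V W, smooth_vfield V -> smooth_vfield W ->
        forall x, mder (fun y => tau y (W y) : R) x (V x)
                  - tau x (nab V W x) = 0 &
      forall V X Y, smooth_vfield V -> An_section tau X -> An_section tau Y ->
        forall x, mder (fun y => h y (X y) (Y y) : R) x (V x) =
          h x (nab V X x) (Y x) + h x (X x) (nab V Y x)].

Definition torsion (nab : vfield -> vfield -> vfield) (V W : vfield) : vfield :=
  fun x => nab V W x - nab W V x - lie_bracket V W x.

Definition rot (h : M -> 'rV[R]_n -> 'rV[R]_n -> R)
    (nab : vfield -> vfield -> vfield) (Z X Y : vfield) (x : M) : R :=
  h x (nab X Z x) (Y x) - h x (X x) (nab Y Z x).

End ManifoldCalculus.

(* Vectors of L^(m+2) are columns of coordinates in the basis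
   (l, e_1, ..., e_m, n). *)
Section Lorentz.
Context {R : realType} (m : nat).

Definition lorentz_gram : 'M[R]_(1 + m + 1) :=
  block_mx (block_mx 0 0 0 1%:M) (col_mx 1%:M 0) (row_mx 1%:M 0) 0.

Definition lorentz (v w : 'cV[R]_(1 + m + 1)) : R :=
  (v^T *m lorentz_gram *m w) 0 0.

Definition ell : 'cV[R]_(1 + m + 1) := col_mx (col_mx 1%:M 0) 0.
Definition enn : 'cV[R]_(1 + m + 1) := col_mx (col_mx 0 0) 1%:M.

(* ell - enn is timelike and <ell, ell - enn> = -1, so that the time orientation
   for which ell is future directed is the one of ell - enn. *)
Definition future_cone : set 'cV[R]_(1 + m + 1) :=
  [set v | lorentz v v = 0 /\ lorentz v (ell - enn) < 0].

Definition groupG : set 'M[R]_(1 + m + 1) :=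
  [set g | (forall v w, lorentz (g *m v) (g *m w) = lorentz v w) /\
           (forall v, future_cone (g *m v) <-> future_cone v)].

Definition groupH : set 'M[R]_(1 + m + 1) :=
  [set g | groupG g /\ g *m ell = ell].

Definition gmx (a : R) (X : 'cV[R]_m) (A : 'M[R]_m) (zeta : 'rV[R]_m) :
    'M[R]_(1 + m + 1) :=
  block_mx (block_mx a%:M zeta X A) (col_mx 0 (- zeta^T))
           (row_mx 0 (- X^T)) (- a%:M).

Definition lieg : set 'M[R]_(1 + m + 1) :=
  [set B | exists a X A zeta, A^T = - A /\ B = gmx a X A zeta].

Definition lieh : set 'M[R]_(1 + m + 1) :=
  [set B | exists A zeta, A^T = - A /\ B = gmx 0 0 A zeta].

(* The projection g -> g/h, with g/h identified with R x R^m. *)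
Definition gmodh (B : 'M[R]_(1 + m + 1)) : R * 'cV[R]_m :=
  (ulsubmx (ulsubmx B) 0 0, dlsubmx (ulsubmx B)).

Definition qform (u v : R * 'cV[R]_m) : R := (u.2^T *m v.2) 0 0.

End Lorentz.

(* Principal bundles over N whose structure group H is an embedded Lie group of
   matrices of size d; the action is only meaningful on H. *)
Section PrincipalBundle.
Context {R : realType} {n d : nat} (N : manifold R n) (H : set 'M[R]_d).

(* The restriction of act to P x H is smooth, P x H being viewed as a
   submanifold of P x 'M[R]_d: near each point it extends, in charts, to a
   smooth function of an open subset of 'rV[R]_k x 'M[R]_d. *)
Definition smooth_action (k : nat) (P : manifold R k) (act : P -> 'M[R]_d -> P)
    : Prop :=
  forall (u : P) (g : 'M[R]_d), H g ->
    exists (O : set ('rV[R]_k * 'M[R]_d)) (F : 'rV[R]_k * 'M[R]_d -> 'rV[R]_k),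
      [/\ open O, O (chart u u, g), smooth_on O F &
        forall y g', O (y, g') -> H g' ->
          [/\ (chart u @` cdom u) y,
              cdom (act u g) (act (cinv u y) g') &
              chart (act u g) (act (cinv u y) g') = F (y, g')]].

(* The equivariant diffeomorphism U x H -> proj^-1 U is (y, g) |-> s(y) g; its
   inverse is u |-> (proj u, kappa u). *)
Definition local_trivialization (k : nat) (P : manifold R k) (proj : P -> N)
    (act : P -> 'M[R]_d -> P) (U : set N) (s : N -> P) (kappa : P -> 'M[R]_d)
    : Prop :=
  [/\ open U,
      smooth_map_on U s /\ msmooth_on (proj @^-1` U) kappa,
      forall y, U y -> proj (s y) = y,
      forall u, U (proj u) -> H (kappa u) /\ act (s (proj u)) (kappa u) = u &
      forall y g, U y -> H g -> kappa (act (s y) g) = g].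

Record principal_bundle := PrincipalBundle {
  tot_dim : nat;
  tot : manifold R tot_dim;
  proj : tot -> N;
  act : tot -> 'M[R]_d -> tot;
  proj_smooth : smooth_map_on setT proj;
  act_smooth : smooth_action act;
  act1 : forall u, act u 1%:M = u;
  actM : forall u g g', H g -> H g' -> act (act u g) g' = act u (g *m g');
  proj_act : forall u g, H g -> proj (act u g) = proj u;
  proj_surj : forall x, exists u, proj u = x;
  locally_trivial : forall x, exists U s kappa,
    U x /\ local_trivialization proj act U s kappa
}.

(* v = zeta_X(u), the image of X in T_1 H under the differential at 1 of the
   orbit map g |-> u g; a curve c in H represents X. *)
Definition fundamental_vector (B : principal_bundle) (X : 'M[R]_d)
    (u : tot B) (v : 'rV[R]_(tot_dim B)) : Prop :=
  exists c : R -> 'M[R]_d,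
    [/\ smooth_on setT c, forall t, H (c t), c 0 = 1%:M, derive1 c 0 = X &
        v = derive1 (fun t => chart u (act u (c t))) 0].

End PrincipalBundle.

Record lightlike_cartan_geometry (R : realType) (m : nat)
    (N : manifold R m.+1) := LightlikeCartanGeometry {
  bundle :> principal_bundle N (@groupH R m);
  omega : tot bundle -> 'rV[R]_(tot_dim bundle) -> 'M[R]_(1 + m + 1);
  omega_linear : forall u, linear (omega u);
  omega_inj : forall u, injective (omega u);
  omega_image : forall u, range (omega u) = @lieg R m;
  omega_smooth : forall (U : set (tot bundle)) (X : vfield (tot bundle)),
    open U -> smooth_vfield_on U X -> msmooth_on U (fun u => omega u (X u));
  omega_equivariant : forall u v g, groupH g ->
    omega (act u g) (tmap (fun u' : tot bundle => act u' g) u v) =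
      invmx g *m omega u v *m g;
  omega_fundamental : forall X u v, lieh X -> fundamental_vector X u v ->
    omega u v = X
}.

(* Objects constructed from a lightlike Cartan geometry.  When the construction
   describes an object as the one with some property, it is rendered by xget,
   which picks an element of a set and whose first argument is a default value,
   irrelevant when the set is nonempty. *)
Section Constructions.
Context {R : realType} {m : nat} {N : manifold R m.+1}.
Variable C : lightlike_cartan_geometry N.

Local Notation P := (tot C).
Local Notation TN := 'rV[R]_(m.+1).
Local Notation L := 'cV[R]_(1 + m + 1).

(* A vector of T_u P over w in T_(proj u) N, unique up to vertical vectors. *)
Definition lift (u : P) (w : TN) : 'rV[R]_(tot_dim C) :=
  xget 0 [set v | tmap (@proj _ _ _ _ _ C) u v = w].

Definition phi (u : P) (w : TN) : R * 'cV[R]_m := gmodh (omega u (lift u w)).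

Definition h_omega (x : N) (v w : TN) : R :=
  xget 0 [set r | forall u : P, proj u = x -> qform (phi u v) (phi u w) = r].

Definition Z_omega (x : N) : TN :=
  xget 0 [set z | forall u : P, proj u = x -> phi u z = (1, 0)].

Definition in_S (tau : N -> TN -> R) : Prop :=
  one_form tau /\ forall x, tau x (Z_omega x) = 1.

Definition P_tau (tau : N -> TN -> R) (x : N) (v : TN) : TN :=
  v - tau x v *: Z_omega x.

(* L_(tau, taub), evaluated with orthonormal bases E of An(taub) at x. *)
Definition L_tau (tau taub : N -> TN -> R) (x : N) : TN :=
  xget 0 [set v | forall E : 'I_m -> TN,
    (forall i, taub x (E i) = 0) ->
    (forall i j, h_omega x (E i) (E j) = (i == j)%:R) ->
    v = \sum_(i < m) tau x (E i) *: E i].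

(* A section sigma of the tractor bundle P x_H L^(m+2) is represented by the
   function F : P -> L^(m+2) such that sigma (proj u) = [u, F u]. *)
Definition tractor_section (F : P -> L) : Prop :=
  msmooth_on setT F /\
  forall u g, groupH g -> F (act u g) = invmx g *m F u.

(* The tractor connection at proj u along w: for a local section s of P with
   s (proj u) = u and Ts w = v, the vector v projects onto w, and
   W(f) + omega(Ts W) f with f = F o s is the value below.  The result does not
   depend on the choice of the lift. *)
Definition nablaT (u : P) (w : TN) (F : P -> L) : L :=
  mder F u (lift u w) + omega u (lift u w) *m F u.

Definition xi : P -> L := fun=> ell m.

Definition Phi (u : P) (w : TN) : L := nablaT u w xi.

Definition curvT (V W : vfield N) (F : P -> L) : P -> L := fun u =>
  nablaT u (V (proj u)) (fun u' => nablaT u' (W (proj u')) F)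
  - nablaT u (W (proj u)) (fun u' => nablaT u' (V (proj u')) F)
  - nablaT u (lie_bracket V W (proj u)) F.

Definition T_omega (x : N) (v w : TN) : TN :=
  xget 0 [set t | forall V W : vfield N,
    smooth_vfield V -> smooth_vfield W -> V x = v -> W x = w ->
    forall u : P, proj u = x -> curvT V W xi u = Phi u t].

Definition eta (tau : N -> TN -> R) : P -> L :=
  xget (fun=> 0) [set F | [/\ tractor_section F,
    forall u, F u != 0 /\ lorentz (F u) (F u) = 0,
    forall u, lorentz (xi u) (F u) = 1 &
    forall u w, tau (proj u) w = 0 -> lorentz (Phi u w) (F u) = 0]].

(* The An(tau)-component at x of the section represented by F. *)
Definition An_part (tau : N -> TN -> R) (F : P -> L) (x : N) : TN :=
  xget 0 [set v | tau x v = 0 /\ exists a b : R,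
    forall u, proj u = x -> F u = a *: xi u + Phi u v + b *: eta tau u].

Definition nabla_tau (tau : N -> TN -> R) (W X : vfield N) : vfield N :=
  An_part tau (fun u => nablaT u (W (proj u)) (fun u' => Phi u' (X (proj u')))).

Definition D_omega (tau : N -> TN -> R) (x : N) (w : TN) : TN :=
  An_part tau (fun u => nablaT u w (eta tau)) x.

Definition tnabla (tau : N -> TN -> R) (V W : vfield N) : vfield N := fun x =>
  mder (fun y => tau y (W y) : R) x (V x) *: Z_omega x
  + tau x (W x) *: P_tau tau x (V x)
  + nabla_tau tau V (fun y => P_tau tau y (W y)) x.

Definition torsion_conditions (tau : N -> TN -> R)
    (nab : vfield N -> vfield N -> vfield N) : Prop :=
  [/\ forall x, nab Z_omega Z_omega x = 0,
      forall X Y, An_section tau X -> An_section tau Y ->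
        forall x, rot h_omega nab Z_omega X Y x = 0 &
      forall V W, smooth_vfield V -> smooth_vfield W ->
        forall x, torsion nab V W x =
          P_tau tau x (T_omega x (V x) (W x)) + dform tau V W x *: Z_omega x].

End Constructions.

(* Main.v *)
(* Along a local section s of P, the tractor connection is
   W(f) + omega(Ts W) f, and vertical derivatives of an equivariant function are
   prescribed by the Maurer-Cartan form of H; so nabla^T does not depend on the
   lift used to define it and is metric.  Let an(t) = t - <t,eta> xi - <xi,t> eta
   be the projection of tractors onto Phi(An(tau)).  Metricity gives
     nabla_W eta = Phi(D W) - tau(W) eta,
     Phi(tnabla_V W) = V(tau(W)) xi + an(nabla_V Phi(W)),
   and the latter makes tnabla Galilean and, after antisymmetrization, gives
   Phi(Tor(V, W)) = dtau(V, W) xi + an(R(V, W) xi).  The difference S of two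
   Galilean connections with the same torsion is symmetric; the condition on
   rot kills S(Z, .) and Koszul's argument kills S on An(tau).  Finally
     etab = eta - Phi(L) + h(L, L)/2 xi,
   and the change of D is the An(taub)-part of the derivative of this identity. *)

Require Import Defs.
From HB Require Import structures.
From mathcomp Require Import all_boot all_order all_algebra.
From mathcomp Require Import all_classical all_reals all_analysis.
From mathcomp Require Import ring lra.

Set Implicit Arguments.
Unset Strict Implicit.
Unset Printing Implicit Defensive.

Import Order.TTheory GRing.Theory Num.Theory.
Import numFieldNormedType.Exports.

Local Open Scope classical_set_scope.
Local Open Scope ring_scope.

(** The definitions express smoothness by iterated directional derivatives, so the chain rule and
    the symmetry of second derivatives are established here from a mean value inequality; finite
    dimension serves to pass from directional to total derivatives. The objects built from [omega]
    are picked by [xget]: each specification must be shown to have exactly one solution, except that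
    of [lift], whose choice must be shown irrelevant. After that [Phi u], being injective, replaces
    charts: an identity between tangent vectors at [pr u] is proved in L^(m+2), and a vector field
    is smooth as soon as its image under [Phi] along a local section is. Two global conditions shape
    the rest. Fundamental vectors come from curves in H defined for all times, and [T_omega] is
    tested on fields defined on the whole of N, whence the bump functions. Uniqueness of the
    Galilean connection stays at the level of global fields: the difference S(V, W) of two
    candidates is itself a section of An(tau), so it can be its own test field and no vector has to
    be extended. *)

(** * Linear identities in a module, by reflection *)

Section LinearReflection.
Context {R : comNzRingType} {V : lmodType R}.

Inductive lexpr :=
  | LVar of nat | LZero | LAdd of lexpr & lexpr | LOpp of lexpr
  | LScale of R & lexpr.

Fixpoint leval (env : seq V) (e : lexpr) : V :=
  match e with
  | LVar i => nth 0 env i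
  | LZero => 0
  | LAdd e1 e2 => leval env e1 + leval env e2
  | LOpp e1 => - leval env e1
  | LScale a e1 => a *: leval env e1
  end.

(** The test is [Nat.eqb] so that [cbn] evaluates it on the numerals produced by the tactic, leaving
    pure ring expressions. *)
Fixpoint lcoef (e : lexpr) (i : nat) : R :=
  match e with
  | LVar j => if Nat.eqb i j then 1 else 0
  | LZero => 0
  | LAdd e1 e2 => lcoef e1 i + lcoef e2 i
  | LOpp e1 => - lcoef e1 i
  | LScale a e1 => a * lcoef e1 i
  end.

(** A conjunction guided by the environment: it unfolds into one ring identity per atom. *)
Fixpoint lcoefs_eq (e1 e2 : lexpr) (i : nat) (env : seq V) : Prop :=
  if env is _ :: env' then lcoef e1 i = lcoef e2 i /\ lcoefs_eq e1 e2 i.+1 env'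
  else True.

Lemma levalE env e : leval env e = \sum_(i < size env) lcoef e i *: env`_i.
Proof.
elim: e => [j||e1 IH1 e2 IH2|e1 IH1|a e1 IH1] /=.
- have [jn|nj] := ltnP j (size env).
    rewrite (bigD1 (Ordinal jn))//= PeanoNat.Nat.eqb_refl scale1r big1 ?addr0// => i ij.
    case E: (Nat.eqb i j); last by rewrite scale0r.
    by case/eqP: ij; apply/val_inj/PeanoNat.Nat.eqb_eq.
  (* An index beyond the environment evaluates to the default [0] of [nth] and matches no term of
     the sum. *)
  rewrite nth_default// big1// => i _; case E: (Nat.eqb i j).
    move/PeanoNat.Nat.eqb_eq: E => E; have := ltn_ord i.
    by rewrite E ltnNge nj.
  by rewrite scale0r.
- by rewrite big1// => i _; rewrite scale0r.
- by rewrite IH1 IH2 -big_split; apply: eq_bigr => i _; rewrite scalerDl.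
- by rewrite IH1 -sumrN; apply: eq_bigr => i _; rewrite scaleNr.
- by rewrite IH1 scaler_sumr; apply: eq_bigr => i _; rewrite scalerA.
Qed.

Lemma leval_eq env e1 e2 : lcoefs_eq e1 e2 0 env -> leval env e1 = leval env e2.
Proof.
move=> H; rewrite !levalE; apply: eq_bigr => i _; congr (_ *: _).
have : forall k, lcoefs_eq e1 e2 k env -> forall j, (j < size env)%N ->
    lcoef e1 (k + j)%N = lcoef e2 (k + j)%N.
  elim: (env) => //= _ s IH k [H1 H2] [_|j js]; first by rewrite addn0.
  by rewrite addnS -addSn; exact: IH.
by move=> /(_ 0%N H i (ltn_ord i)).
Qed.

End LinearReflection.

Ltac lr_index x env :=
  lazymatch env with
  | x :: _ => constr:(0%N)
  | _ :: ?env' => let i := lr_index x env' in constr:(S i)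
  end.
Ltac lr_mem x env :=
  lazymatch env with
  | nil => constr:(false)
  | x :: _ => constr:(true)
  | _ :: ?env' => lr_mem x env'
  end.
Ltac lr_atoms t env :=
  lazymatch t with
  | (?a + ?b)%R => let env1 := lr_atoms a env in lr_atoms b env1
  | (- ?a)%R => lr_atoms a env
  | (_ *: ?a)%R => lr_atoms a env
  | 0%R => env
  | _ => lazymatch lr_mem t env with
         | true => env
         | false => constr:(t :: env)
         end
  end.
Ltac lr_reify R t env :=
  lazymatch t with
  | (?a + ?b)%R => let x := lr_reify R a env in let y := lr_reify R b env in
      constr:(@LAdd R x y)
  | (- ?a)%R => let x := lr_reify R a env in constr:(@LOpp R x)
  | (?c *: ?a)%R => let x := lr_reify R a env in constr:(@LScale R c x)
  | 0%R => constr:(@LZero R)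
  | _ => let i := lr_index t env in constr:(@LVar R i)
  end.
(* Identities between linear combinations in an R-module, by comparing the
   coefficients with [ring]; atoms are compared syntactically. *)
Ltac lmod_ring_over R :=
  lazymatch goal with
  | |- ?a = ?b :> ?T =>
    let env0 := lr_atoms a (@nil T) in
    let env := lr_atoms b env0 in
    let ea := lr_reify R a env in
    let eb := lr_reify R b env in
    refine (@leval_eq R _ env ea eb _);
    cbn [lcoefs_eq lcoef Nat.eqb]; do ?[split; first by ring]; exact I
  end.

(** * Smooth functions on normed spaces *)

(** The little-o remainder in explicit form: the arguments below add several such estimates. *)
Lemma derivable_near {R : realType} {V W : normedModType R} (f : V -> W)
    (a v : V) (e : R) :
  derivable f a v -> 0 < e ->
  \forall h \near (0 : R),
    `|f (h *: v + a) - f a - h *: 'D_v f a| <= e * `|h|.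
Proof.
move=> /derivable_nbhs/eqaddoP H e0; have {H} := H e e0.
by apply: filterS => h /=; rewrite opprD addrA.
Qed.

Section MeanValueInequality.
Context {R : realType}.

(* The supremum of the [t] such that the bound with slope [K + e] holds on
   [0, t] cannot be smaller than 1. *)
Lemma mean_value_ineq {W : normedModType R} (f : R -> W) (K : R) :
  (forall t, 0 <= t <= 1 -> derivable f t 1) ->
  (forall t, 0 <= t <= 1 -> `|'D_1 f t| <= K) ->
  `|f 1 - f 0| <= K.
Proof.
move=> df fK; apply/ler_addgt0Pr => e e0.
have K0 : 0 <= K by apply: le_trans (fK 0 _); rewrite ?normr_ge0// lexx ler01.
have Ke0 : 0 <= K + e by rewrite addr_ge0// ltW.
pose A := [set t | 0 <= t <= 1 /\
  forall s, 0 <= s <= t -> `|f s - f 0| <= (K + e) * s].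
have A0 : A 0.
  split; first by rewrite lexx ler01.
  by move=> s; rewrite -eq_le => /eqP <-; rewrite subrr normr0 mulr0.
have Aub : ubound A 1 by move=> t [/andP[_]].
have hsA : has_sup A by split; [exists 0|exists 1].
set c := sup A.
have c0 : 0 <= c by apply: ub_le_sup A0; exists 1.
have c1 : c <= 1 by apply: sup_le_ub => //; exists 0.
have c01 : 0 <= c <= 1 by rewrite c0.
have step d : 0 < d -> \forall h \near (0 : R),
    `|f (h + c) - f c| <= (K + d) * `|h|.
  move=> d0; have := derivable_near (df c c01) d0; apply: filterS => h.
  have -> : h *: (1 : R) = h by rewrite /GRing.scale /= mulr1.
  rewrite mulrDl -lerBlDl; apply: le_trans.
  have := ler_normB (f (h + c) - f c) (h *: 'D_1 f c).
  have : `|h *: 'D_1 f c| <= K * `|h|.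
    by rewrite normrZ mulrC ler_wpM2r// fK.
  have := lerB_dist (f (h + c) - f c) (h *: 'D_1 f c).
  lra.
have step' : exists2 d : R, 0 < d & forall h : R, `|h| < d ->
    `|f (h + c) - f c| <= (K + e) * `|h|.
  have /nbhs_ballP[d d0 dP] := step e e0; exists d => // h hd; apply: dP.
  by rewrite /ball/= sub0r normrN.
have [d d0 dP] := step'.
have ltcA (s : R) : 0 <= s -> s < c -> `|f s - f 0| <= (K + e) * s.
  move=> s0 sc; have [|t [_ At] st] := @sup_gt _ A s _ sc; first by exists 0.
  by apply: At; rewrite s0 ltW.
have fc : `|f c - f 0| <= (K + e) * c.
  have [->|cN0] := eqVneq c 0; first by rewrite subrr normr0 mulr0.
  have c_gt0 : 0 < c by rewrite lt_neqAle eq_sym cN0.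
  (* A step back from [c], short enough for the local estimate at [c] and leading to a point of [0,
     c) where the bound is known; the two bounds add up at [c]. *)
  pose t := Num.min (d / 2) c.
  have t0 : 0 < t by rewrite lt_min c_gt0 divr_gt0.
  have td : t < d by rewrite gt_min; apply/orP; left; lra.
  have tc : t <= c by rewrite ge_min lexx orbT.
  have := dP (- t); rewrite normrN gtr0_norm// => /(_ td); rewrite [X in X <= _ -> _]distrC.
  have := ltcA (- t + c); have -> : (- t + c < c) = true by apply/idP; lra.
  have -> : (0 <= - t + c) = true by apply/idP; lra.
  move=> /(_ erefl erefl) H1 H2.
  have -> : (K + e) * c = (K + e) * t + (K + e) * (- t + c) by ring.
  have := lerD H2 H1; apply: le_trans; exact: ler_distD.
have [c_lt1|] := ltP c 1; last first.
  move=> c1'; have c1E : c = 1 by apply/eqP; rewrite eq_le c1 c1'.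
  by move: fc; rewrite c1E mulr1.
(* A step forward that stays in [0, 1]: the bound then holds up to [t + c], beyond the supremum. *)
pose t := Num.min (d / 2) (1 - c).
have t0 : 0 < t by rewrite lt_min subr_gt0 c_lt1 divr_gt0.
have td : t < d by rewrite gt_min; apply/orP; left; lra.
have tc : t <= 1 - c by rewrite ge_min lexx orbT.
suff : A (t + c) by move=> /(ub_le_sup (ex_intro _ 1 Aub)); rewrite -/c; lra.
split; first by apply/andP; split; lra.
move=> s /andP[s0 st]; have [/ltcA->//|cs] := ltP s c.
have := dP (s - c); rewrite ger0_norm ?subr_ge0// subrK.
have -> : (s - c < d) = true by apply/idP; lra.
move=> /(_ erefl) H.
have -> : (K + e) * s = (K + e) * (s - c) + (K + e) * c by ring.
exact: le_trans (ler_distD (f c) _ _) (lerD H fc).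
Qed.

(** The mean value inequality for [t |-> f (t *: h + a) - t *: w]. Subtracting a fixed [w] compares
    the increment of [f] with a candidate derivative taken at another point, which is how
    differentiability and Schwarz's theorem use it. *)
Lemma mean_value_segment {V W : normedModType R} (f : V -> W) (a h : V)
    (w : W) (K : R) :
  (forall t : R, 0 <= t <= 1 -> derivable f (t *: h + a) h /\
     `|'D_h f (t *: h + a) - w| <= K) ->
  `|f (h + a) - f a - w| <= K.
Proof.
move=> H; pose g := (fun t : R => f (t *: h + a)) - (fun t : R => t *: w).
have shiftE (t : R) : derivable f (t *: h + a) h ->
    is_derive t (1 : R) (fun t : R => f (t *: h + a)) ('D_h f (t *: h + a)).
  have E : (fun s : R => s^-1 *: (((fun t => f (t *: h + a)) \o shift t)
                (s *: (1 : R)) - f (t *: h + a))) =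
       (fun s : R => s^-1 *: ((f \o shift (t *: h + a)) (s *: h)
                - f (t *: h + a))).
    by apply/funext => s /=; rewrite [s%:A]mulr1 scalerDl addrA.
  by move=> df; split; rewrite /derivable /derive E.
have dg (t : R) : 0 <= t <= 1 ->
    is_derive t (1 : R) g ('D_h f (t *: h + a) - w).
  move=> /H[dft _]; apply: is_deriveB; first exact: shiftE.
  have di : differentiable (id : R -> R) t by exact: ex_diff.
  have d1 : differentiable (fun t : R => t *: w) t.
    exact: (differentiableZl w di).
  apply: DeriveDef; first exact: diff_derivable.
  by rewrite deriveE// (diffZl w di) diff_val scale1r.
have := @mean_value_ineq W g K _ _; rewrite /g /= !fctE !scale1r !scale0r add0r.
rewrite subr0 addrAC; apply => t t01; have := dg t t01.
  by move=> ?; apply: ex_derive.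
by move=> ?; rewrite derive_val; have [] := H t t01.
Qed.
End MeanValueInequality.

Lemma near_shiftP {R : realType} {V : normedModType R} (a : V)
    (P : V -> Prop) :
  (\forall y \near a, P y) <->
  exists2 d : R, 0 < d & forall h, `|h| < d -> P (h + a).
Proof.
rewrite nbhs_normP; split=> -[d d0 dP]; exists d => //= h.
  by move=> hd; apply: dP; rewrite /= opprD [a + _]addrC subrK normrN.
by rewrite /= distrC => /dP; rewrite subrK.
Qed.

Section DirectionalDerivatives.
Context {R : realType} {V W : normedModType R}.
Implicit Types (f : V -> W) (a v w : V).

Lemma is_derive_near f a v (l : W) :
  (forall e : R, 0 < e -> \forall h \near (0 : R),
     `|f (h *: v + a) - f a - h *: l| <= e * `|h|) ->
  is_derive a v f l.
Proof.
move=> H.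
suff cl : (h^-1 *: ((f \o shift a) (h *: v) - f a)) @[h --> 0^'] --> l.
  by split; [apply/cvg_ex; exists l|apply/cvg_lim].
apply/cvgrPdist_le => e e0; have [d d0 dP] := nbhs_norm0P.1 (H e e0).
near=> h.
have h0 : h != 0 by near: h; exact: nbhs_dnbhs_neq.
rewrite distrC -[X in _ - X]scale1r -(mulVf h0) -scalerA -scalerBr normrZ normfV.
rewrite ler_pdivrMl ?normr_gt0// mulrC; apply: dP.
by near: h; exact: dnbhs0_lt.
Unshelve. all: by end_near. Qed.

Lemma is_deriveZv f a v (k : R) :
  derivable f a v -> is_derive a (k *: v) f (k *: 'D_v f a).
Proof.
move=> df; have [->|k0] := eqVneq k 0.
  by rewrite !scale0r; exact: is_derive0.
apply: is_derive_near => e e0.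
have k_gt0 : 0 < `|k| by rewrite normr_gt0.
have [d d0 dP] := nbhs_norm0P.1 (derivable_near df (divr_gt0 e0 k_gt0)).
apply/nbhs_norm0P; exists (d / `|k|); first by rewrite /= divr_gt0.
move=> h; rewrite /= ltr_pdivlMr// -normrM => /dP /=.
by rewrite normrM mulrCA divfK ?gt_eqF// [`|h| * e]mulrC !scalerA.
Qed.

(** The increment from [a] to [a + h (v + w)] is split at [a + h v]. The first leg is the derivative
    along [v] at [a]; on the second, the mean value inequality and the continuity of ['D_w f] at [a]
    replace the derivative along [w] by its value at [a]. *)
Lemma is_deriveDv f (O : set V) a v w : open O -> O a ->
  derivable f a v -> {for a, continuous ('D_w f)} ->
  (forall y, O y -> derivable f y w) ->
  is_derive a (v + w) f ('D_v f a + 'D_w f a).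
Proof.
move=> Oo Oa dv cw dw; apply: is_derive_near => e e0.
have e20 : 0 < e / 2 by rewrite divr_gt0.
have [d1 d10 d1P] := nbhs_norm0P.1 (derivable_near dv e20).
have [d2 d20 d2P] : exists2 d : R, 0 < d & forall h : V, `|h| < d ->
    O (h + a) /\ `|'D_w f (h + a) - 'D_w f a| <= e / 2.
  apply/(near_shiftP a (fun y => O y /\ `|'D_w f y - 'D_w f a| <= e / 2)).
  near=> y.
  split; first by near: y; exact: open_nbhs_nbhs.
  rewrite distrC; near: y; move/cvgrPdist_le : cw => /(_ _ e20); exact.
(* The divisor keeps the whole second leg in the ball of radius [d2]; the summand 1 makes it
   positive when [v] and [w] vanish. *)
pose d := Num.min d1 (d2 / (1 + `|v| + `|w|)).
have vw0 : 0 < 1 + `|v| + `|w| by rewrite -addrA ltr_pwDl// addr_ge0.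
apply/nbhs_norm0P; exists d; first by rewrite /= lt_min d10 divr_gt0.
move=> h /=; rewrite lt_min ltr_pdivlMr// => /andP[hd1 hd2].
have -> : f (h *: (v + w) + a) - f a - h *: ('D_v f a + 'D_w f a) =
    (f (h *: (v + w) + a) - f (h *: v + a) - h *: 'D_w f a) +
    (f (h *: v + a) - f a - h *: 'D_v f a).
  rewrite [h *: ('D_v f a + _)]scalerDr opprD [in RHS]addrACA subrKA.
  by congr (_ + _); rewrite addrC.
rewrite (splitr e) mulrDl; apply: (le_trans (ler_normD _ _)); apply: lerD; last first.
  exact: d1P.
have -> : h *: (v + w) + a = h *: w + (h *: v + a).
  by rewrite scalerDr addrA [h *: w + _]addrC.
apply: mean_value_segment => t /andP[t0 t1].
have hd : `|t *: (h *: w) + h *: v| < d2.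
    apply: le_lt_trans hd2; rewrite (le_trans (ler_normD _ _))// !normrZ.
  rewrite (ger0_norm t0).
  have := normr_ge0 h; have := normr_ge0 v; have := normr_ge0 w.
  move: (`|h|) (`|v|) (`|w|) => x y z z0 y0 x0.
  have : 0 <= x * z by rewrite mulr_ge0.
  nra.
have [Oh De] := d2P _ hd; have dh := is_deriveZv h (dw _ Oh).
rewrite addrA; split; first exact: ex_derive.
by rewrite derive_val -scalerBr normrZ mulrC ler_wpM2r.
Unshelve. all: by end_near. Qed.
End DirectionalDerivatives.

(** Coordinates bounded by the norm are continuous at once, and the expansion reduces a statement on
    all directions to finitely many. A class, so that the charts and their products with matrix
    spaces are covered by instance search. *)
Class finite_dim {R : realType} (V : normedModType R) : Prop := FiniteDim :
  exists (I : finType) (e : I -> V) (c : I -> V -> R),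
    [/\ forall i, scalar (c i), forall i v, `|c i v| <= `|v| &
        forall v, v = \sum_i c i v *: e i].

#[export] Instance finite_dim_real {R : realType} :
  finite_dim (R : normedModType R).
Proof.
exists 'I_1, (fun=> 1), (fun=> id); split=> // v.
by rewrite big_ord1 /GRing.scale /= mulr1.
Qed.

Lemma ler_mx_entry {R : realType} m n (A : 'M[R]_(m, n)) i j : `|A i j| <= `|A|.
Proof.
rewrite [leRHS]/Num.norm /= mx_normrE.
exact: (le_bigmax _ (fun ij : 'I_m * 'I_n => `|A ij.1 ij.2|) (i, j)).
Qed.

#[export] Instance finite_dim_mx {R : realType} m n :
  finite_dim ('M[R]_(m, n) : normedModType R).
Proof.
exists ('I_m * 'I_n)%type, (fun k => delta_mx k.1 k.2),
  (fun k (A : 'M[R]_(m, n)) => A k.1 k.2); split=> [k a A B|k A|A].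
- by rewrite !mxE.
- exact: ler_mx_entry.
- by rewrite {1}[A]matrix_sum_delta pair_big.
Qed.

#[export] Instance finite_dim_prod {R : realType} (V W : normedModType R) :
  finite_dim V -> finite_dim W ->
  finite_dim ((V * W)%type : normedModType R).
Proof.
move=> [I [e [c [cl cb ce]]]] [J [e' [c' [cl' cb' ce']]]].
exists (I + J)%type,
  (fun k => match k with inl i => (e i, 0) | inr j => (0, e' j) end),
  (fun k v => match k with inl i => c i v.1 | inr j => c' j v.2 end).
split=> [[i|j] a u v|[i|j] v|[v w]]; first exact: cl.
- exact: cl'.
- by apply: le_trans (cb _ _) _; rewrite [leRHS]/Num.norm /= le_max lexx.
- by apply: le_trans (cb' _ _) _; rewrite [leRHS]/Num.norm /= le_max lexx orbT.
- rewrite big_sumType /=.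
  have E1 (s : seq I) : \sum_(i <- s) c i v *: (e i, 0 : W) =
      (\sum_(i <- s) c i v *: e i, 0).
    elim: s => [|i s IH]; rewrite ?big_nil// !big_cons IH.
    by rewrite -[LHS]/(c i v *: e i + _, c i v *: 0 + 0) scaler0 addr0.
  have E2 (s : seq J) : \sum_(i <- s) c' i w *: (0 : V, e' i) =
      (0, \sum_(i <- s) c' i w *: e' i).
    elim: s => [|i s IH]; rewrite ?big_nil// !big_cons IH.
    by rewrite -[LHS]/(c' i w *: 0 + 0, c' i w *: e' i + _) scaler0 addr0.
  rewrite E1 E2 -ce -ce'.
  by rewrite -[RHS]/(v + 0, 0 + w) addr0 add0r.
Qed.

(** A version of [smooth_on] of finite order, recursive in the order: the rules for products,
    inverses and composites express ['D_v] of the result by functions of the same kind, and are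
    proved by induction on [k]. *)
Fixpoint Ck {R : realType} {V W : normedModType R} (k : nat) (O : set V)
    (f : V -> W) : Prop :=
  (forall y, O y -> {for y, continuous f}) /\
  if k is k'.+1 then
    forall v, (forall y, O y -> derivable f y v) /\ Ck k' O ('D_v f)
  else True.

Section Ck.
Context {R : realType} {V W : normedModType R}.
Implicit Types (f g : V -> W) (O : set V).

Lemma Ck_continuous k O f : Ck k O f -> forall y, O y -> {for y, continuous f}.
Proof. by case: k => [|k] []. Qed.

Lemma Ck_derivable k O f v : Ck k.+1 O f -> forall y, O y -> derivable f y v.
Proof. by move=> [_ /(_ v)[]]. Qed.

Lemma Ck_derive k O f v : Ck k.+1 O f -> Ck k O ('D_v f).
Proof. by move=> [_ /(_ v)[]]. Qed.

Lemma CkW k O f : Ck k.+1 O f -> Ck k O f.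
Proof.
elim: k f => [|k IH] f Hf; first by split=> //; case: Hf.
split; first exact: Ck_continuous Hf.
by move=> v; split; [exact: Ck_derivable Hf|exact/IH/Ck_derive/Hf].
Qed.

Lemma Ck_sub k O O' f : O' `<=` O -> Ck k O f -> Ck k O' f.
Proof.
move=> OO'; elim: k f => [|k IH] f [cf df]; split=> //.
- by move=> y /OO'; exact: cf.
- by move=> y /OO'; exact: cf.
- by move=> v; split; [move=> y /OO'; exact: (df v).1|exact/IH/(df v).2].
Qed.

(** [iter_derive] adds the newest derivative at the outside, whereas [Ck] differentiates at the
    inside first; appending a direction at the end of the list reconciles the two. *)
Lemma smooth_onP O f : smooth_on O f <-> forall k, Ck k O f.
Proof.
split=> [H k|H vs y Oy].
  elim: k f H => [|k IH] f H.
    by split=> // y Oy; have [] := H [::] y Oy.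
  split; first by move=> y Oy; have [] := H [::] y Oy.
  move=> v; split; first by move=> y Oy; have [_] := H [::] y Oy; exact.
  apply: IH => vs y Oy.
  have E : iter_derive ('D_v f) vs = iter_derive f (rcons vs v).
    by elim: vs => //= w vs ->.
  by rewrite E; exact: H.
have {}H : forall k, Ck k O (iter_derive f vs).
  by elim: vs {y Oy} => //= v vs IH k; exact: Ck_derive (IH k.+1).
split; first exact: Ck_continuous (H 0%N) y Oy.
by move=> v; exact: Ck_derivable (H 1%N) y Oy.
Qed.

Lemma eq_Ck k O f g : open O -> (forall y, O y -> f y = g y) ->
  Ck k O f -> Ck k O g.
Proof.
move=> Oo; elim: k f g => [|k IH] f g fg Hf.
  split=> // y Oy; have [cf _] := Hf; rewrite /prop_for /continuous_at -fg//.
  apply: cvg_trans (cf y Oy); apply: near_eq_cvg; near=> z; apply/fg.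
  by near: z; exact: open_nbhs_nbhs.
have nfg y : O y -> \forall z \near y, f z = g z.
  by move=> Oy; near=> z; apply: fg; near: z; exact: open_nbhs_nbhs.
split.
  move=> y Oy; have [cf _] := Hf; rewrite /prop_for /continuous_at -fg//.
  by apply: cvg_trans (cf y Oy); apply: near_eq_cvg; exact: nfg.
move=> v; split.
  by move=> y Oy; apply: near_eq_derivable (nfg y Oy) (Ck_derivable Hf Oy).
apply: IH (Ck_derive v Hf) => y Oy; apply: near_eq_derive; exact: nfg.
Unshelve. all: by end_near. Qed.

End Ck.

Lemma linear_lipschitz_continuous {R : realType} {V W : normedModType R}
    (l : {linear V -> W}) (K : R) :
  (forall v, `|l v| <= K * `|v|) -> continuous l.
Proof.
move=> lK y; apply/cvgrPdist_lt => e e0.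
have K1 : 0 < 1 + `|K| by rewrite ltr_pwDl.
near=> z; rewrite -linearB.
apply: (@le_lt_trans _ _ ((1 + `|K|) * `|y - z|)).
  by rewrite (le_trans (lK _))// ler_wpM2r// ler_wpDl// ler_norm.
rewrite -ltr_pdivlMl// mulrC; near: z.
have /cvgrPdist_lt : id @ y --> y by exact: cvg_id.
by apply; rewrite divr_gt0.
Unshelve. all: by end_near. Qed.

Lemma Ck1_is_deriveD {R : realType} {V W : normedModType R} (f : V -> W)
    (O : set V) (a v w : V) : open O -> O a -> Ck 1 O f ->
  'D_(v + w) f a = 'D_v f a + 'D_w f a.
Proof.
move=> Oo Oa Hf.
have : is_derive a (v + w) f ('D_v f a + 'D_w f a).
  apply: (is_deriveDv Oo Oa (Ck_derivable (v := v) Hf Oa)).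
    exact: Ck_continuous (Ck_derive w Hf) a Oa.
  exact: Ck_derivable Hf.
by move=> ?; rewrite derive_val.
Qed.

Lemma Ck1_derive_linear {R : realType} {V W : normedModType R} (f : V -> W)
    (O : set V) (a : V) : open O -> O a -> Ck 1 O f ->
  linear (fun v => 'D_v f a).
Proof.
move=> Oo Oa Hf k v w; rewrite (Ck1_is_deriveD _ _ Oo Oa Hf).
have ? := is_deriveZv k (Ck_derivable (v := v) Hf Oa).
by rewrite derive_val.
Qed.

Section ContinuouslyDifferentiable.
Context {R : realType} {V W : normedModType R} {fV : finite_dim V}.
Implicit Types (f : V -> W) (O : set V).

(** Continuity of the finitely many ['D_(b i) f] makes ['D_h f] at points near [a] close to
    ['D_h f a], up to a small multiple of the norm of [h]; the mean value inequality on the segment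
    turns this into the estimate of the remainder. *)
Lemma Ck1_differentiable f O a : open O -> O a -> Ck 1 O f ->
  differentiable f a.
Proof.
move=> Oo Oa Hf; have [I [b [c [cl cb ce]]]] := fV.
pose L v := 'D_v f a.
have Ll : linear L by exact: Ck1_derive_linear Oo Oa Hf.
pose LL : {linear V -> W} := HB.pack L (GRing.isLinear.Build _ _ _ _ L Ll).
have LE y : O y -> forall v, 'D_v f y = \sum_i c i v *: 'D_(b i) f y.
  move=> Oy v; rewrite {1}(ce v).
  pose L' v := 'D_v f y.
  have L'l : linear L' by exact: Ck1_derive_linear Oo Oy Hf.
  pose LL' : {linear V -> W} := HB.pack L' (GRing.isLinear.Build _ _ _ _ L' L'l).
  rewrite -[LHS]/(LL' _) linear_sum; apply: eq_bigr => i _.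
  by rewrite linearZ.
have Lc : continuous LL.
  apply: (@linear_lipschitz_continuous _ _ _ _ (\sum_i `|'D_(b i) f a|)) => v.
  rewrite -[LL v]/('D_v f a) (LE a Oa) mulr_suml.
  apply: le_trans (ler_norm_sum _ _ _) _; apply: ler_sum => i _.
  by rewrite normrZ mulrC ler_wpM2l.
suff E : f \o shift a = cst (f a) + LL +o_ 0 id.
  by apply/diff_locallyP; rewrite (diff_unique Lc E).
apply/eqaddoP => e e0; rewrite -nbhs_nearE.
(* Errors of [e / N] in each of the [#|I|] directions sum up to at most [e]; adding 1 keeps [N]
   positive when [I] is empty. *)
pose N := (#|I|%:R + 1 : R); have N0 : 0 < N by rewrite ltr_wpDl.
have [d d0 dP] : exists2 d : R, 0 < d & forall h : V, `|h| < d ->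
    O (h + a) /\ forall i, `|'D_(b i) f (h + a) - 'D_(b i) f a| <= e / N.
  apply/(near_shiftP a (fun y => O y /\
    forall i, `|'D_(b i) f y - 'D_(b i) f a| <= e / N)).
  near=> y; split; first by near: y; exact: open_nbhs_nbhs.
  near: y; apply: filter_forall => i.
  have := Ck_continuous (Ck_derive (b i) Hf) Oa.
  move=> /cvgrPdist_le /(_ (e / N)); rewrite divr_gt0// => /(_ isT) H.
  by apply: filterS H => y; rewrite distrC.
apply/nbhs_norm0P; exists d => // h /= hd.
have -> : (f \o +%R^~ a - (cst (f a) + L)) h = f (h + a) - f a - 'D_h f a.
  by rewrite -addrA -opprD.
apply: mean_value_segment => t /andP[t0 t1].
have [|Oh De] := dP (t *: h).
  apply: le_lt_trans hd; rewrite normrZ ger0_norm// ler_piMl//.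
split; first exact: (Ck_derivable Hf Oh).
rewrite (LE _ Oh) (LE _ Oa) -sumrB; apply: le_trans (ler_norm_sum _ _ _) _.
apply: (@le_trans _ _ (\sum_(i : I) e / N * `|h|)).
  by apply: ler_sum => i _; rewrite -scalerBr normrZ mulrC ler_pM.
rewrite -mulr_suml ler_wpM2r// sumr_const -mulr_natr -mulrA ler_piMr ?(ltW e0)//.
by rewrite mulrC ler_pdivrMr// mul1r /N lerDl.
Unshelve. all: by end_near. Qed.

End ContinuouslyDifferentiable.

Section Closure.
Context {R : realType}.
Implicit Types V W : normedModType R.

Lemma is_derive_lin V W W' (l : {linear W -> W'}) (f : V -> W) a v :
  continuous l -> derivable f a v -> is_derive a v (l \o f) (l ('D_v f a)).
Proof.
move=> lc df.
have H : (fun h : R => h^-1 *: (((l \o f) \o shift a) (h *: v) - (l \o f) a)) @ 0^'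
    --> l ('D_v f a).
  have -> : (fun h : R => h^-1 *: (((l \o f) \o shift a) (h *: v) - (l \o f) a))
      = l \o (fun h : R => h^-1 *: ((f \o shift a) (h *: v) - f a)).
    by apply/funext => h /=; rewrite -linearB -linearZ.
  by apply: cvg_comp; [exact: df|exact: lc].
by split; [apply/cvg_ex; exists (l ('D_v f a))|apply/cvg_lim].
Qed.

Lemma Ck_cst V W k (O : set V) (w : W) : Ck k O (cst w).
Proof.
elim: k w => [|k IH] w; first by split=> // y _; exact: cvg_cst.
split; first by move=> y _; exact: cvg_cst.
move=> v; split; first by move=> y _; exact: derivable_cst.
have -> : 'D_v (cst w) = cst (0 : W) :> (V -> W).
  by apply/funext => y; rewrite derive_cst.
exact: IH.
Qed.

Lemma Ck_lin_comp V W W' (l : {linear W -> W'}) k (O : set V) (f : V -> W) :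
  open O -> continuous l -> Ck k O f -> Ck k O (l \o f).
Proof.
move=> Oo lc; elim: k f => [|k IH] f Hf.
  by split=> // y Oy; apply: continuous_comp; [exact: (Hf.1 y Oy)|exact: lc].
split.
  by move=> y Oy; apply: continuous_comp; [exact: (Hf.1 y Oy)|exact: lc].
move=> v; have dl y : O y -> is_derive y v (l \o f) (l ('D_v f y)).
  by move=> Oy; apply: is_derive_lin lc (Ck_derivable Hf Oy).
split; first by move=> y /dl ?; exact: ex_derive.
apply: eq_Ck Oo _ (IH _ (Ck_derive v Hf)) => y /dl ?.
by rewrite derive_val.
Qed.

Lemma CkD V W k (O : set V) (f g : V -> W) : open O ->
  Ck k O f -> Ck k O g -> Ck k O (f + g).
Proof.
move=> Oo; elim: k f g => [|k IH] f g Hf Hg.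
  split=> // y Oy; apply: continuousD; [exact: Hf.1|exact: Hg.1].
split; first by move=> y Oy; apply: continuousD; [exact: Hf.1|exact: Hg.1].
move=> v; split.
  by move=> y Oy; apply: derivableD; [exact: (Ck_derivable Hf Oy)|exact: (Ck_derivable Hg Oy)].
apply: eq_Ck Oo _ (IH _ _ (Ck_derive v Hf) (Ck_derive v Hg)) => y Oy.
by rewrite deriveD//; [exact: (Ck_derivable Hf Oy)|exact: (Ck_derivable Hg Oy)].
Qed.

Lemma CkN V W k (O : set V) (f : V -> W) : open O ->
  Ck k O f -> Ck k O (- f).
Proof.
move=> Oo Hf; apply: (@Ck_lin_comp _ _ _ -%R) => // y.
exact: opp_continuous.
Qed.

Lemma Ck_sum V W k (O : set V) (I : Type) (r : seq I) (P : pred I)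
    (f : I -> V -> W) : open O -> (forall i, P i -> Ck k O (f i)) ->
  Ck k O (fun y => \sum_(i <- r | P i) f i y).
Proof.
move=> Oo Hf; elim: r => [|i r IH].
  under eq_fun do rewrite big_nil; exact: Ck_cst.
under eq_fun do rewrite big_cons.
case: (boolP (P i)) => [Pi|//].
exact: CkD Oo (Hf i Pi) IH.
Qed.

Lemma is_derive_scale V W (c : V -> R) (f : V -> W) y v :
  {for y, continuous c} -> derivable c y v -> derivable f y v ->
  is_derive y v (fun z => c z *: f z) (c y *: 'D_v f y + 'D_v c y *: f y).
Proof.
move=> cc dc df.
suff cl : (fun h : R => h^-1 *: (((fun z => c z *: f z) \o shift y) (h *: v)
      - c y *: f y)) @ 0^' --> c y *: 'D_v f y + 'D_v c y *: f y.
  split; [apply/cvg_ex; eexists; exact: cl|exact/cvg_lim/cl].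
have -> : (fun h : R => h^-1 *: (((fun z => c z *: f z) \o shift y) (h *: v)
      - c y *: f y)) =
    (fun h => c (h *: v + y) *: (h^-1 *: ((f \o shift y) (h *: v) - f y))) +
    (fun h => (h^-1 *: ((c \o shift y) (h *: v) - c y)) *: f y).
  apply/funext => h; rewrite /= !fctE /= scalerA [_ * h^-1]mulrC -scalerA.
  rewrite -[(h^-1 *: (_ - c y)) *: f y]scalerA -scalerDr; congr (_ *: _).
  by rewrite scalerBr scalerBl addrA subrK.
apply: cvgD; last exact: cvgZr_tmp dc.
apply: cvgZ; last exact: df.
suff : {for 0, continuous (fun h : R => c (h *: v + y))}.
  by move=> /continuous_withinNx; rewrite scale0r add0r.
apply: (@continuous_comp _ _ _ (fun h : R => h *: v + y) c); last first.
  by rewrite scale0r add0r.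
apply: cvgD; last exact: cvg_cst.
by apply: cvgZr_tmp; exact: cvg_id.
Qed.

Lemma CkZ V W k (O : set V) (c : V -> R) (f : V -> W) : open O ->
  Ck k O c -> Ck k O f -> Ck k O (fun y => c y *: f y).
Proof.
move=> Oo; elim: k c f => [|k IH] c f Hc Hf.
  split=> // y Oy; apply: cvgZ; [exact: Hc.1|exact: Hf.1].
split; first by move=> y Oy; apply: cvgZ; [exact: Hc.1|exact: Hf.1].
move=> v; have dl y : O y -> is_derive y v (fun y => c y *: f y)
    (c y *: 'D_v f y + 'D_v c y *: f y).
  move=> Oy; apply: is_derive_scale; [exact: Hc.1|exact: (Ck_derivable Hc Oy)|
    exact: (Ck_derivable Hf Oy)].
split; first by move=> y /dl ?; exact: ex_derive.
apply: (@eq_Ck _ _ _ _ _ ((fun y => c y *: 'D_v f y) + (fun y => 'D_v c y *: f y))).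
- exact: Oo.
- by move=> y /dl ?; rewrite derive_val.
- by apply: CkD => //; apply: IH; [exact: CkW|exact: Ck_derive|exact: Ck_derive|exact: CkW].
Qed.

(** Induction on [k]: by the chain rule ['D_v (g \o f)] is the sum of the coordinates of ['D_v f]
    times the composites ['D_(b i) g \o f], whose factors are all of one order less. *)
Lemma Ck_comp V V' W {fV : finite_dim V} {fV' : finite_dim V'} k (O : set V)
    (O' : set V') (f : V -> V') (g : V' -> W) :
  open O -> open O' -> (forall y, O y -> O' (f y)) ->
  Ck k O f -> Ck k O' g -> Ck k O (g \o f).
Proof.
move=> Oo Oo' ff; elim: k f g ff => [|k IH] f g ff Hf Hg.
  by split=> // y Oy; apply: continuous_comp; [exact: Hf.1|apply: Hg.1; exact: ff].
split.
  by move=> y Oy; apply: continuous_comp; [exact: Hf.1|apply: Hg.1; exact: ff].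
have C1 (n : nat) (U U' : normedModType R) (A : set U) (h : U -> U') :
    Ck n.+1 A h -> Ck 1 A h.
  by elim: n h => // n IHn h /CkW; exact: IHn.
have df y : O y -> differentiable f y.
  by move=> Oy; apply: Ck1_differentiable Oo Oy _; exact: C1 Hf.
have dg y : O' y -> differentiable g y.
  by move=> Oy; apply: Ck1_differentiable Oo' Oy _; exact: C1 Hg.
move=> v; split.
  move=> y Oy; apply/diff_derivable/differentiable_comp.
    exact: (df y Oy).
  exact: (dg _ (ff y Oy)).
have [I [b [c [cl cb ce]]]] := fV'.
apply: (@eq_Ck _ _ _ _ _ (fun y => \sum_i c i ('D_v f y) *: ('D_(b i) g \o f) y)).
- exact: Oo.
- move=> y Oy; have dfy := df y Oy; have dgy := dg _ (ff y Oy).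
  have dgf : differentiable (g \o f) y by exact: differentiable_comp.
  rewrite (deriveE v dgf) (diff_comp dfy dgy) /= -(deriveE v dfy).
  rewrite [in RHS](ce ('D_v f y)) linear_sum.
  by apply: eq_bigr => i _; rewrite linearZ/= (deriveE (b i) dgy).
- apply: Ck_sum => // i _; apply: CkZ => //; last first.
    by apply: IH; [exact: ff|exact: CkW|exact: Ck_derive].
  pose ci : {linear V' -> R^o} := HB.pack (c i)
    (GRing.isLinear.Build _ _ _ _ (c i : V' -> R^o) (cl i)).
  apply: (@Ck_lin_comp _ _ _ ci) => //; last exact: Ck_derive.
  apply: (@linear_lipschitz_continuous _ _ _ ci 1) => w.
  by rewrite mul1r; exact: cb.
Qed.

Lemma CkV V {fV : finite_dim V} k (O : set V) (f : V -> R) : open O ->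
  (forall y, O y -> f y != 0) -> Ck k O f -> Ck k O (fun y => (f y)^-1).
Proof.
move=> Oo f0; elim: k f f0 => [|k IH] f f0 Hf.
  by split=> // y Oy; apply: cvgV; [exact: f0|exact: Hf.1].
split; first by move=> y Oy; apply: cvgV; [exact: f0|exact: Hf.1].
move=> v; split=> [y Oy|].
  by apply: derivableV; [exact: f0|exact: (Ck_derivable Hf Oy)].
apply: (@eq_Ck _ _ _ _ _ (fun y => (- ((f y)^-1 *: (f y)^-1)) *: 'D_v f y)).
- exact: Oo.
- move=> y Oy; rewrite deriveV ?f0//; last exact: (Ck_derivable Hf Oy).
  by rewrite expr2 invfM.
- apply: CkZ => //; last exact: Ck_derive.
  apply: CkN => //; apply: CkZ => //; apply: IH => //; exact: CkW.
Qed.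

End Closure.

(** * Symmetry of second derivatives *)

Section Schwarz.
Context {R : realType} {V W : normedModType R}.
Implicit Types (f : V -> W) (O : set V).

(* Two applications of the mean value inequality to the second difference
   [f (s v + t w + a) - f (s v + a) - f (t w + a) + f a]. *)
Lemma second_difference O f a v w e : open O -> O a -> Ck 2 O f -> 0 < e ->
  exists2 d : R, 0 < d & forall s t : R, `|s| < d -> `|t| < d ->
    `|f (s *: v + (t *: w + a)) - f (t *: w + a) - (f (s *: v + a) - f a)
      - (s * t) *: 'D_w ('D_v f) a| <= `|s| * `|t| * e.
Proof.
move=> Oo Oa Hf e0.
have [d d0 dP] : exists2 d : R, 0 < d & forall h : V, `|h| < d ->
    O (h + a) /\ `|'D_w ('D_v f) (h + a) - 'D_w ('D_v f) a| <= e.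
  apply/(near_shiftP a (fun y => O y /\
    `|'D_w ('D_v f) y - 'D_w ('D_v f) a| <= e)).
  near=> y; split; first by near: y; exact: open_nbhs_nbhs.
  rewrite distrC; near: y.
  have := Ck_continuous (Ck_derive w (Ck_derive v Hf)) Oa.
  by move=> /cvgrPdist_le /(_ e e0).
have vw0 : 0 < 1 + `|v| + `|w| by rewrite -addrA ltr_pwDl// addr_ge0.
exists (d / (1 + `|v| + `|w|)); first by rewrite divr_gt0.
move=> s t sd td.
have small (x y : R) : 0 <= x <= 1 -> 0 <= y <= 1 ->
    `|(x * s) *: v + (y * t) *: w| < d.
  move=> /andP[x0 x1] /andP[y0 y1].
  apply: (le_lt_trans (ler_normD _ _)); rewrite !normrZ.
  rewrite (ger0_norm x0) (ger0_norm y0).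
  move: sd td; rewrite !ltr_pdivlMr//.
  have := normr_ge0 v; have := normr_ge0 w; have := normr_ge0 s.
  have := normr_ge0 t.
  move: (`|v|) (`|w|) (`|s|) (`|t|) => nv nw ns nt nt0 ns0 nw0 nv0 sd td.
  have X1 : x * ns * nv <= ns * nv by rewrite ler_wpM2r// ler_piMl.
  have X2 : y * nt * nw <= nt * nw by rewrite ler_wpM2r// ler_piMl.
  apply: (@le_lt_trans _ _ (ns * nv + nt * nw)); first exact: lerD.
  have [st|ts] := leP ns nt.
    have : ns * nv <= nt * nv by rewrite ler_wpM2r.
    nra.
  have : nt * nw <= ns * nw by rewrite ler_wpM2r// ltW.
  nra.
(* The second difference is an increment of [g] along [s *: v], and the derivative of [g] along [v]
   is an increment of ['D_v f] along [t *: w]: one mean value inequality for each. *)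
pose g := fun z => f (z + t *: w) - f z.
have -> : f (s *: v + (t *: w + a)) - f (t *: w + a) - (f (s *: v + a) - f a) =
    g (s *: v + a) - g a.
  have -> : s *: v + (t *: w + a) = s *: v + a + t *: w by lmod_ring_over R.
  have -> : t *: w + a = a + t *: w by rewrite addrC.
  by rewrite /g !opprB [LHS]addrACA [RHS]addrACA [- f (a + _) - _]addrC.
have dg y : O y -> O (y + t *: w) ->
    is_derive y v g ('D_v f (y + t *: w) - 'D_v f y).
  move=> Oy Oty; apply: is_deriveB; last first.
    exact/derivableP/(Ck_derivable Hf).
  have E : (fun h : R => h^-1 *: (((fun z => f (z + t *: w)) \o shift y)
       (h *: v) - f (y + t *: w))) =
      (fun h : R => h^-1 *: ((f \o shift (y + t *: w)) (h *: v)
         - f (y + t *: w))).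
    by apply/funext => h /=; rewrite addrA.
  have := Ck_derivable (v := v) Hf Oty.
  by split; rewrite /derivable /derive E.
apply: mean_value_segment => x x01.
have := small x 0 x01; rewrite lexx ler01 => /(_ isT).
rewrite mul0r scale0r addr0 -scalerA => /dP [yO1 _].
have := small x 1 x01; rewrite lexx ler01 => /(_ isT).
rewrite mul1r -scalerA => /dP []; rewrite addrAC => yO2 _.
have ? := dg _ yO1 yO2.
have ? := is_deriveZv s (@ex_derive _ _ _ _ _ _ _ (dg _ yO1 yO2)).
split; first exact: ex_derive.
rewrite derive_val derive_val -scalerA -scalerBr normrZ -mulrA ler_wpM2l//.
rewrite addrC.
have := @mean_value_segment _ _ _ ('D_v f) (x *: (s *: v) + a) (t *: w)
  (t *: 'D_w ('D_v f) a) (`|t| * e).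
rewrite [t *: w + _]addrC => H; rewrite addrC; apply: H => y y01.
have := small x y x01 y01; rewrite addrC -!scalerA => /dP [].
rewrite -addrA => yO3 D3.
have ? := is_deriveZv t (Ck_derivable (v := w) (Ck_derive v Hf) yO3).
split; first exact: ex_derive.
by rewrite derive_val -scalerBr normrZ ler_wpM2l.
Unshelve. all: by end_near. Qed.

(** For [s = t] the second difference is symmetric in [v] and [w], so that both mixed derivatives,
    multiplied by [s * s], lie within [s * s * (e / 2)] of the same vector. *)
Lemma schwarz O f a v w : open O -> O a -> Ck 2 O f ->
  'D_v ('D_w f) a = 'D_w ('D_v f) a.
Proof.
move=> Oo Oa Hf; apply/eqP; rewrite -subr_eq0 -normr_eq0 eq_le normr_ge0 andbT.
apply/ler_addgt0Pr => e e0; rewrite add0r.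
have e20 : 0 < e / 2 by rewrite divr_gt0.
have [d1 d10 H1] := second_difference v w Oo Oa Hf e20.
have [d2 d20 H2] := second_difference w v Oo Oa Hf e20.
pose s := Num.min d1 d2 / 2.
have s0 : 0 < s by rewrite divr_gt0// lt_min d10.
have sd : s < Num.min d1 d2 by rewrite /s; have := s0; rewrite /s; lra.
have /andP[sd1 sd2] : (s < d1) && (s < d2) by move: sd; rewrite lt_min.
have ns : `|s| = s by rewrite gtr0_norm.
have {}H1 := H1 s s; have {}H2 := H2 s s; rewrite !ns in H1 H2.
have {}H1 := H1 sd1 sd1; have {}H2 := H2 sd2 sd2.
have E : f (s *: w + (s *: v + a)) - f (s *: v + a) - (f (s *: w + a) - f a) =
    f (s *: v + (s *: w + a)) - f (s *: w + a) - (f (s *: v + a) - f a).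
  rewrite [s *: w + (s *: v + a)]addrCA.
  have swap (x b c d : W) : x - b - (c - d) = x - c - (b - d).
    by lmod_ring_over R.
  exact: swap.
rewrite {}E in H2.
move: (f (s *: v + (s *: w + a)) - f (s *: w + a) - (f (s *: v + a) - f a)) H1 H2.
move=> X H1 H2.
have ss0 : 0 < s * s by rewrite mulr_gt0.
rewrite -(ler_pM2l ss0) -[X in X * `|_|](gtr0_norm ss0) -normrZ scalerBr.
rewrite -[X in `|X|](subrKA X) -opprB.
apply: le_trans (ler_normD _ _) _; rewrite normrN.
have -> : s * s * e = s * s * (e / 2) + s * s * (e / 2).
  by rewrite -mulrDr -splitr.
exact: lerD.
Qed.

End Schwarz.

(** * Germs of smooth maps *)

Section SmoothAt.
Context {R : realType}.
Implicit Types V W : normedModType R.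

Lemma smooth_atP V W (f : V -> W) y :
  smooth_at f y <-> exists O, [/\ open O, O y & forall k, Ck k O f].
Proof.
by split=> -[ O [Oo Oy /smooth_onP H]]; exists O; split=> //; apply/smooth_onP.
Qed.

Lemma smooth_at_near V W (f : V -> W) y :
  smooth_at f y -> \forall z \near y, smooth_at f z.
Proof.
move=> [ O [Oo Oy Hf]]; apply: filterS (open_nbhs_nbhs (conj Oo Oy)) => z Oz.
by exists O.
Qed.

Lemma near_open V (P : V -> Prop) y : (\forall z \near y, P z) ->
  exists O, [/\ open O, O y & forall z, O z -> P z].
Proof. by rewrite -nbhs_nearE nbhsE => -[ O [Oo Oy] OP]; exists O. Qed.

Lemma eq_smooth_at V W (f g : V -> W) y :
  (\forall z \near y, f z = g z) -> smooth_at f y -> smooth_at g y.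
Proof.
move=> /near_open[ O1 [ O1o O1y H]] /smooth_atP[ O [Oo Oy Hf]].
apply/smooth_atP; exists (O `&` O1); split=> //; first exact: openI.
move=> k; apply: eq_Ck (openI Oo O1o) _ (Ck_sub _ (Hf k)); last by move=> z [].
by move=> z [_ /H].
Qed.

Lemma smooth_at2 V W W' W'' (f : V -> W) (g : V -> W') (h : V -> W'') y :
  (forall O, open O -> (forall k, Ck k O f) -> (forall k, Ck k O g) ->
     forall k, Ck k O h) ->
  smooth_at f y -> smooth_at g y -> smooth_at h y.
Proof.
move=> H /smooth_atP[ O [Oo Oy Hf]] /smooth_atP[ O' [Oo' Oy' Hg]].
apply/smooth_atP; exists (O `&` O'); split=> //; first exact: openI.
apply: H; first exact: openI.
- by move=> k; apply: Ck_sub (Hf k) => z [].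
- by move=> k; apply: Ck_sub (Hg k) => z [].
Qed.

Lemma smooth_at_cst V W (w : W) (y : V) : smooth_at (cst w) y.
Proof. by exists setT; split=> //; [exact: openT|apply/smooth_onP => k; exact: Ck_cst]. Qed.

Lemma smooth_atD V W (f g : V -> W) y :
  smooth_at f y -> smooth_at g y -> smooth_at (f + g) y.
Proof. by apply: smooth_at2 => O Oo Hf Hg k; exact: CkD. Qed.

Lemma smooth_atZ V W (c : V -> R) (f : V -> W) y :
  smooth_at c y -> smooth_at f y -> smooth_at (fun z => c z *: f z) y.
Proof. by apply: smooth_at2 => O Oo Hf Hg k; exact: CkZ. Qed.

Lemma smooth_at_lin V W W' (l : {linear W -> W'}) (f : V -> W) y :
  continuous l -> smooth_at f y -> smooth_at (l \o f) y.
Proof.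
move=> lc /smooth_atP[ O [Oo Oy Hf]]; apply/smooth_atP; exists O; split=> // k.
exact: Ck_lin_comp.
Qed.

Lemma smooth_atN V W (f : V -> W) y : smooth_at f y -> smooth_at (- f) y.
Proof.
by move=> Hf; apply: (smooth_at_lin (l := -%R)) Hf => z; exact: opp_continuous.
Qed.

Lemma smooth_atB V W (f g : V -> W) y :
  smooth_at f y -> smooth_at g y -> smooth_at (f - g) y.
Proof. by move=> Hf Hg; apply: smooth_atD => //; exact: smooth_atN. Qed.

Lemma smooth_at_sum V W (I : Type) (r : seq I) (P : pred I) (f : I -> V -> W) y :
  (forall i, P i -> smooth_at (f i) y) ->
  smooth_at (fun z => \sum_(i <- r | P i) f i z) y.
Proof.
move=> Hf; elim: r => [|i r IH].
  under eq_fun do rewrite big_nil; exact: smooth_at_cst.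
under eq_fun do rewrite big_cons.
by case: (boolP (P i)) => [/Hf Pi|//]; exact: smooth_atD.
Qed.

Lemma smooth_at_continuous V W (f : V -> W) y :
  smooth_at f y -> {for y, continuous f}.
Proof. by move=> /smooth_atP[ O [_ Oy /(_ 0%N)[H _]]]; exact: H. Qed.

Lemma smooth_at_derivable V W (f : V -> W) y v :
  smooth_at f y -> derivable f y v.
Proof. by move=> /smooth_atP[ O [_ Oy /(_ 1%N)Hf]]; exact: (Ck_derivable Hf). Qed.

Lemma smooth_at_derive V W (f : V -> W) y v :
  smooth_at f y -> smooth_at ('D_v f) y.
Proof.
move=> /smooth_atP[ O [Oo Oy Hf]]; apply/smooth_atP; exists O; split=> // k.
exact: (Ck_derive v (Hf k.+1)).
Qed.

Lemma smooth_at_derive_linear V W (f : V -> W) y :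
  smooth_at f y -> linear (fun v => 'D_v f y).
Proof. by move=> /smooth_atP[ O [Oo Oy /(_ 1%N)]]; exact: Ck1_derive_linear. Qed.

Lemma smooth_at_schwarz V W (f : V -> W) y v w :
  smooth_at f y -> 'D_v ('D_w f) y = 'D_w ('D_v f) y.
Proof. by move=> /smooth_atP[ O [Oo Oy /(_ 2%N)]]; exact: schwarz. Qed.

Lemma smooth_atV V {fV : finite_dim V} (f : V -> R) y :
  f y != 0 -> smooth_at f y -> smooth_at (fun z => (f z)^-1) y.
Proof.
move=> f0 /[dup] /smooth_at_continuous cf /smooth_atP[ O [Oo Oy Hf]].
have : \forall z \near y, f z != 0.
  by apply: cvgr_neq0 cf f0.
move=> /near_open[ O1 [ O1o O1y H]]; apply/smooth_atP; exists (O `&` O1).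
split=> //; first exact: openI.
move=> k; apply: CkV; first exact: openI.
  by move=> z [_ /H].
by apply: Ck_sub (Hf k) => z [].
Qed.

Lemma smooth_at_comp V V' W {fV : finite_dim V} {fV' : finite_dim V'}
    (f : V -> V') (g : V' -> W) y :
  smooth_at f y -> smooth_at g (f y) -> smooth_at (g \o f) y.
Proof.
move=> /[dup] /smooth_at_continuous cf /smooth_atP[ O [Oo Oy Hf]].
move=> /smooth_atP[ O' [Oo' Oy' Hg]].
have : \forall z \near y, O' (f z).
  have : \forall u \near f y, O' u by exact: open_nbhs_nbhs.
  by move=> /cf.
move=> /near_open[ O1 [ O1o O1y H]]; apply/smooth_atP; exists (O `&` O1).
split=> //; first exact: openI.
move=> k; apply: (@Ck_comp _ _ _ _ _ _ k _ O') => //; first exact: openI.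
  by move=> z [_ /H].
by apply: Ck_sub (Hf k) => z [].
Qed.

Lemma smooth_at_differentiable V W {fV : finite_dim V} (f : V -> W) y :
  smooth_at f y -> differentiable f y.
Proof. by move=> /smooth_atP[ O [Oo Oy /(_ 1%N)]]; exact: Ck1_differentiable. Qed.

Lemma derive_comp V V' W {fV : finite_dim V} {fV' : finite_dim V'}
    (f : V -> V') (g : V' -> W) y v :
  smooth_at f y -> smooth_at g (f y) ->
  'D_v (g \o f) y = 'D_('D_v f y) g (f y).
Proof.
move=> /smooth_at_differentiable df /smooth_at_differentiable dg.
rewrite (deriveE v (differentiable_comp df dg)) (diff_comp df dg) /=.
by rewrite -(deriveE v df) (deriveE _ dg).
Qed.

Lemma is_derive_bigsum V W (I : Type) (r : seq I) (f : I -> V -> W)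
    (df : I -> W) y v : (forall i, is_derive y v (f i) (df i)) ->
  is_derive y v (fun z => \sum_(i <- r) f i z) (\sum_(i <- r) df i).
Proof.
move=> H; elim: r => [|i r IH].
  by under eq_fun do rewrite big_nil; rewrite big_nil; exact: is_derive_cst.
by under eq_fun do rewrite big_cons; rewrite big_cons; exact: is_deriveD.
Qed.

(** Expanding the moving direction in the fixed family [b] leaves finitely many products of smooth
    functions. *)
Lemma smooth_at_derive_along V W {fV : finite_dim V} (f : V -> W) (w : V -> V) y :
  smooth_at f y -> smooth_at w y -> smooth_at (fun z => 'D_(w z) f z) y.
Proof.
move=> Hf Hw; have [I [b [c [cl cb ce]]]] := fV.
apply: (@eq_smooth_at _ _ (fun z => \sum_i c i (w z) *: 'D_(b i) f z)).
  apply: filterS (smooth_at_near Hf) => z Hfz.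
  pose L v := 'D_v f z.
  pose LL : {linear V -> W} := HB.pack L
    (GRing.isLinear.Build _ _ _ _ L (smooth_at_derive_linear Hfz)).
  rewrite -[RHS]/(LL (w z)) (ce (w z)) linear_sum -(ce (w z)).
  by apply: eq_bigr => i _; rewrite linearZ.
apply: smooth_at_sum => i _; apply: smooth_atZ; last exact: smooth_at_derive.
pose ci : {linear V -> R^o} := HB.pack (c i)
  (GRing.isLinear.Build _ _ _ _ (c i : V -> R^o) (cl i)).
apply: (smooth_at_lin (l := ci)) Hw.
by apply: (@linear_lipschitz_continuous _ _ _ ci 1) => u; rewrite mul1r; exact: cb.
Qed.

(** The first term is symmetric in [v] and [w y] by Schwarz's theorem; in the commutator of two
    fields only the terms of the second kind survive. *)
Lemma derive_derive_along V W {fV : finite_dim V} (f : V -> W) (w : V -> V) y v :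
  smooth_at f y -> smooth_at w y ->
  'D_v (fun z => 'D_(w z) f z) y = 'D_v ('D_(w y) f) y + 'D_('D_v w y) f y.
Proof.
move=> Hf Hw; have [I [b [c [cl cb ce]]]] := fV.
have fE (g : V -> W) z : smooth_at g z ->
    forall u, 'D_u g z = \sum_i c i u *: 'D_(b i) g z.
  move=> Hgz u; pose L v := 'D_v g z.
  pose LL : {linear V -> W} := HB.pack L
    (GRing.isLinear.Build _ _ _ _ L (smooth_at_derive_linear Hgz)).
  rewrite -[LHS]/(LL u) {1}(ce u) linear_sum.
  by apply: eq_bigr => i _; rewrite linearZ.
have Hci i : smooth_at (c i \o w) y /\ 'D_v (c i \o w) y = c i ('D_v w y).
  pose ci : {linear V -> R^o} := HB.pack (c i)
    (GRing.isLinear.Build _ _ _ _ (c i : V -> R^o) (cl i)).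
  have cic : continuous ci.
    by apply: (@linear_lipschitz_continuous _ _ _ ci 1) => u; rewrite mul1r; exact: cb.
  split; first exact: (smooth_at_lin (l := ci)) Hw.
  have ? := is_derive_lin cic (smooth_at_derivable (v := v) Hw).
  by rewrite derive_val.
rewrite (near_eq_derive (g := fun z => \sum_i (c i \o w) z *: 'D_(b i) f z)).
  have H i : is_derive y v (fun z => (c i \o w) z *: 'D_(b i) f z)
      (c i (w y) *: 'D_v ('D_(b i) f) y + c i ('D_v w y) *: 'D_(b i) f y).
    have [sc <-] := Hci i; apply: is_derive_scale.
    - exact: smooth_at_continuous.
    - exact: smooth_at_derivable.
    - exact/smooth_at_derivable/smooth_at_derive.
  have ? := is_derive_bigsum (index_enum I) H.
  rewrite derive_val big_split /= -(fE _ _ Hf); congr (_ + _).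
  (* Schwarz's theorem brings [w y] to the outer derivative, where it can be expanded in the family
     [b]; a second use on each term restores the order. *)
  rewrite smooth_at_schwarz// (fE _ _ (smooth_at_derive v Hf)).
  by apply: eq_bigr => i _; rewrite smooth_at_schwarz.
by apply: filterS (smooth_at_near Hf) => z /fE.
Qed.
End SmoothAt.

(** * Smooth matrix-valued maps *)

Section SmoothMatrix.
Context {R : realType} {V : normedModType R}.

Lemma smooth_atM (f g : V -> R) y :
  smooth_at f y -> smooth_at g y -> smooth_at (fun z => f z * g z) y.
Proof. exact: (@smooth_atZ R V R^o f g). Qed.

Lemma smooth_at_prod (I : Type) (r : seq I) (f : I -> V -> R) y :
  (forall i, smooth_at (f i) y) -> smooth_at (fun z => \prod_(i <- r) f i z) y.
Proof.
move=> Hf; elim: r => [|i r IH].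
  by under eq_fun do rewrite big_nil; exact: smooth_at_cst.
by under eq_fun do rewrite big_cons; exact: smooth_atM (Hf i) IH.
Qed.

Lemma entry_linear m n (i : 'I_m) (j : 'I_n) :
  linear (fun A : 'M[R]_(m, n) => A i j : R^o).
Proof. by move=> a A B; rewrite !mxE. Qed.

Lemma linear_mx_continuous (W : normedModType R) m n
    (l : {linear 'M[R]_(m, n) -> W}) : continuous l.
Proof.
apply: (@linear_lipschitz_continuous _ _ _ l
  (\sum_(k : 'I_m * 'I_n) `|l (delta_mx k.1 k.2)|)) => A.
rewrite {1}(matrix_sum_delta A) pair_big linear_sum mulr_suml.
apply: le_trans (ler_norm_sum _ _ _) _; apply: ler_sum => k _.
by rewrite linearZ normrZ mulrC ler_wpM2l// ler_mx_entry.
Qed.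

Lemma smooth_mxP m n (M : V -> 'M[R]_(m, n)) y :
  smooth_at M y <-> forall i j, smooth_at (fun z => M z i j) y.
Proof.
split=> [HM i j|HM].
  pose l : {linear 'M[R]_(m, n) -> R^o} := HB.pack
    (fun A : 'M[R]_(m, n) => A i j : R^o)
    (GRing.isLinear.Build _ _ _ _ _ (@entry_linear m n i j)).
  by apply: (smooth_at_lin (l := l)) HM; exact: linear_mx_continuous.
apply: (@eq_smooth_at _ _ _
  (fun z => \sum_(k : 'I_m * 'I_n) M z k.1 k.2 *: delta_mx k.1 k.2)).
  by apply: nearW => z; rewrite [RHS]matrix_sum_delta pair_big.
apply: smooth_at_sum => k _; apply: smooth_atZ; first exact: HM.
exact: smooth_at_cst.
Qed.

Lemma smooth_at_mulmx m n p (A : V -> 'M[R]_(m, n)) (B : V -> 'M[R]_(n, p)) y :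
  smooth_at A y -> smooth_at B y -> smooth_at (fun z => A z *m B z) y.
Proof.
move=> /smooth_mxP HA /smooth_mxP HB; apply/smooth_mxP => i j.
under eq_fun do rewrite mxE.
by apply: smooth_at_sum => k _; apply: smooth_atM; [exact: HA|exact: HB].
Qed.

Lemma smooth_at_mulmxl m n p (A : 'M[R]_(m, n)) (B : V -> 'M[R]_(n, p)) y :
  smooth_at B y -> smooth_at (fun z => A *m B z) y.
Proof. by apply: smooth_at_mulmx; exact: smooth_at_cst. Qed.

Lemma smooth_at_trmx m n (A : V -> 'M[R]_(m, n)) y :
  smooth_at A y -> smooth_at (fun z => (A z)^T) y.
Proof.
move=> /smooth_mxP HA; apply/smooth_mxP => i j.
by under eq_fun do rewrite mxE.
Qed.

Lemma derive_mx_entry m n (A : V -> 'M[R]_(m, n)) y v i j :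
  smooth_at A y -> ('D_v A y) i j = 'D_v (fun z => A z i j) y.
Proof. by move=> HA; rewrite derive_mx ?mxE//; exact: smooth_at_derivable. Qed.

Lemma derive_mulmx m n p (A : V -> 'M[R]_(m, n)) (B : V -> 'M[R]_(n, p)) y v :
  smooth_at A y -> smooth_at B y ->
  'D_v (fun z => A z *m B z) y = 'D_v A y *m B y + A y *m 'D_v B y.
Proof.
move=> HA HB; have /smooth_mxP HA' := HA; have /smooth_mxP HB' := HB.
apply/matrixP => i j; rewrite derive_mx_entry; last exact: smooth_at_mulmx.
under eq_fun do rewrite mxE.
have H k : is_derive y v (fun z => A z i k * B z k j)
    (A y i k *: ('D_v B y) k j + ('D_v A y) i k *: B y k j).
  rewrite !derive_mx_entry//; apply: is_derive_scale.
  - exact: smooth_at_continuous.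
  - exact: smooth_at_derivable.
  - exact: smooth_at_derivable.
have ? := is_derive_bigsum (index_enum 'I_n) H.
by rewrite derive_val big_split /= !mxE addrC.
Qed.

Lemma derive_mulmxl m n p (A : 'M[R]_(m, n)) (B : V -> 'M[R]_(n, p)) y v :
  smooth_at B y -> 'D_v (fun z => A *m B z) y = A *m 'D_v B y.
Proof.
move=> HB; rewrite (derive_mulmx _ (smooth_at_cst _ _) HB).
by rewrite derive_cst mul0mx add0r.
Qed.

Lemma smooth_at_det n (A : V -> 'M[R]_n) y :
  smooth_at A y -> smooth_at (fun z => \det (A z)) y.
Proof.
move=> /smooth_mxP HA; rewrite /determinant.
apply: smooth_at_sum => s _.
apply: (@smooth_atM (fun=> (-1) ^+ perm.odd_perm s)); first exact: smooth_at_cst.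
by apply: smooth_at_prod => i; exact: HA.
Qed.

(** Near [y] the determinant does not vanish and Cramer's formula writes the inverse as a rational
    function of the entries. *)
Lemma smooth_at_invmx {fV : finite_dim V} n (A : V -> 'M[R]_n) y :
  A y \in unitmx -> smooth_at A y -> smooth_at (fun z => invmx (A z)) y.
Proof.
move=> Ay HA; have dA := smooth_at_det HA.
have dA0 : \det (A y) != 0 by rewrite -unitfE -unitmxE.
apply: (@eq_smooth_at _ _ _ (fun z => (\det (A z))^-1 *: \adj (A z))).
  have H : \forall z \near y, \det (A z) != 0.
    by have dAc := smooth_at_continuous dA; apply: cvgr_neq0 dAc dA0.
  by apply: filterS H => z z0; rewrite /invmx unitmxE unitfE z0.
apply: smooth_atZ; first exact: smooth_atV.
apply/smooth_mxP => i j; under eq_fun do rewrite mxE /cofactor.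
apply: (@smooth_atM (fun=> (-1) ^+ (j + i))); first exact: smooth_at_cst.
apply: smooth_at_det; apply/smooth_mxP => k l.
have /smooth_mxP/(_ (lift j k) (lift i l)) := HA.
by apply: eq_smooth_at; apply: nearW => z; rewrite !mxE.
Qed.

End SmoothMatrix.

Section LinearProp.
Context {R : pzRingType} {U W : lmodType R} (f : U -> W) (fl : linear f).

(** Maps such as [omega u], [Phi u] or [mder f x] come with a proof of [linear], often conditional
    on smoothness; packing such a proof here gives the usual rules without declaring instances. *)
Let fL : {linear U -> W} := HB.pack f (GRing.isLinear.Build _ _ _ _ f fl).

Lemma linearP0 : f 0 = 0. Proof. exact: (linear0 fL). Qed.
Lemma linearPN u : f (- u) = - f u. Proof. exact: (linearN fL). Qed.
Lemma linearPD u v : f (u + v) = f u + f v. Proof. exact: (linearD fL). Qed.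
Lemma linearPB u v : f (u - v) = f u - f v. Proof. exact: (linearB fL). Qed.
Lemma linearPZ a u : f (a *: u) = a *: f u.
Proof. by have := fl a u 0; rewrite !addr0 linearP0 addr0. Qed.
Lemma linearP_sum I (r : seq I) (P : pred I) (E : I -> U) :
  f (\sum_(i <- r | P i) E i) = \sum_(i <- r | P i) f (E i).
Proof. exact: (linear_sum fL). Qed.
End LinearProp.

(** * Calculus on manifolds *)

Section ManifoldSmoothness.
Context {R : realType} {n : nat} (M : manifold R n).
Implicit Types (x c : M) (V : normedModType R).

Definition msmooth_at {V} (f : M -> V) x := smooth_at (f \o cinv x) (chart x x).

Lemma near_cdom c x : cdom c x -> \forall y \near x, cdom c y.
Proof. by move=> cx; apply: open_nbhs_nbhs; split=> //; exact: cdom_open. Qed.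

Lemma near_chart c x (P : 'rV[R]_n -> Prop) : cdom c x ->
  (\forall z \near chart c x, P z) -> \forall y \near x, P (chart c y).
Proof. by move=> cx HP; exact: (chart_continuous cx). Qed.

Lemma near_cinv c x (P : M -> Prop) : cdom c x ->
  (\forall y \near x, P y) -> \forall z \near chart c x, P (cinv c z).
Proof.
move=> cx HP; have := cinv_continuous cx.
by rewrite /prop_for /continuous_at chartK//; apply.
Qed.

Lemma near_chart_image c x : cdom c x ->
  \forall z \near chart c x, cdom c (cinv c z) /\ chart c (cinv c z) = z.
Proof.
move=> cx; have : nbhs (chart c x) (chart c @` cdom c).
  by apply: open_nbhs_nbhs; split; [exact: cimage_open|exists x].
by apply: filterS => z [y cy <-]; rewrite chartK.
Qed.

Lemma smooth_transition a b x : cdom a x -> cdom b x ->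
  smooth_at (chart b \o cinv a) (chart a x).
Proof.
move=> ax bx.
have : \forall z \near chart a x, (chart a @` (cdom a `&` cdom b)) z.
  have := near_cinv ax (near_cdom bx); have := near_chart_image ax.
  by apply: filterS2 => z [az zE] bz; exists (cinv a z).
move=> /near_open[U [Uo Ux HU]]; exists U; split=> //.
by move=> vs z /HU; exact: chart_compatible.
Qed.

Lemma cinv_transition {V} (f : M -> V) a b x : cdom a x -> cdom b x ->
  \forall z \near chart a x,
    (f \o cinv a) z = ((f \o cinv b) \o (chart b \o cinv a)) z.
Proof.
move=> ax bx; apply: filterS (near_cinv ax (near_cdom bx)) => z bz /=.
by rewrite chartK.
Qed.

Lemma smooth_at_transition {V} (f : M -> V) a b x : cdom a x -> cdom b x ->
  smooth_at (f \o cinv b) (chart b x) -> smooth_at (f \o cinv a) (chart a x).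
Proof.
move=> ax bx Hf; have := cinv_transition f ax bx.
move=> H; apply: eq_smooth_at (filterS _ H) _ => [z|]; first by move=> ->.
apply: smooth_at_comp; first exact: smooth_transition.
by rewrite /= chartK.
Qed.

Lemma msmooth_atP {V} (f : M -> V) c x : cdom c x ->
  msmooth_at f x <-> smooth_at (f \o cinv c) (chart c x).
Proof.
move=> cx; have xx := cdom_center x.
by split; apply: smooth_at_transition.
Qed.

Lemma near_msmooth_at {V} (f : M -> V) x :
  msmooth_at f x -> \forall y \near x, msmooth_at f y.
Proof.
move=> /smooth_at_near/(near_chart (cdom_center x)); have xx := cdom_center x.
by apply: filterS2 (near_cdom xx) => y xy; rewrite (msmooth_atP _ xy).
Qed.

Lemma eq_msmooth_at {V} (f g : M -> V) x :
  (\forall y \near x, f y = g y) -> msmooth_at f x -> msmooth_at g x.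
Proof.
move=> fg; apply: eq_smooth_at; exact: near_cinv (cdom_center x) fg.
Qed.

Lemma eq_mder {V} (f g : M -> V) x v :
  (\forall y \near x, f y = g y) -> mder f x v = mder g x v.
Proof.
by move=> fg; apply: near_eq_derive; exact: near_cinv (cdom_center x) fg.
Qed.

Lemma msmooth_at_continuous {V} (f : M -> V) x :
  msmooth_at f x -> {for x, continuous f}.
Proof.
move=> /smooth_at_continuous cf; have xx := cdom_center x.
have H : {for x, continuous ((f \o cinv x) \o chart x)}.
  by apply: continuous_comp; [exact: chart_continuous|exact: cf].
rewrite /prop_for /continuous_at.
have -> : f x = ((f \o cinv x) \o chart x) x by rewrite /= chartK.
apply: cvg_trans H; apply: near_eq_cvg.
by apply: filterS (near_cdom xx) => y xy; rewrite /= chartK.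
Qed.

Lemma msmooth_at_chart c x : cdom c x -> msmooth_at (chart c) x.
Proof. by move=> cx; apply: smooth_transition => //; exact: cdom_center. Qed.

Lemma mder_linear {V} (f : M -> V) x : msmooth_at f x -> linear (mder f x).
Proof. exact: smooth_at_derive_linear. Qed.

(** [mder f x] is computed in the chart centred at [x], which moves with [x]. A second
    differentiation requires that all points near [x] be read in a single chart [c]. *)
Lemma mder_chartE {V} (f : M -> V) c x v : cdom c x -> msmooth_at f x ->
  mder f x v = 'D_(mder (chart c) x v) (f \o cinv c) (chart c x).
Proof.
move=> cx Hf; have xx := cdom_center x.
rewrite /mder (near_eq_derive _ (cinv_transition f xx cx)) derive_comp.
- by rewrite /= chartK.
- exact: smooth_transition.
- by rewrite /= chartK//; apply/msmooth_atP.
Qed.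

Lemma mder_chart_center x v : mder (chart x) x v = v.
Proof.
rewrite /mder (near_eq_derive (g := id)) ?derive_id//.
by apply: filterS (near_chart_image (cdom_center x)) => z [].
Qed.

Definition vsmooth_at (X : vfield M) x :=
  msmooth_at (fun y => mder (chart x) y (X y)) x.

Lemma mder_along_near {V} (f : M -> V) (X : vfield M) c x :
  cdom c x -> msmooth_at f x ->
  \forall z \near chart c x, ((fun y => mder f y (X y)) \o cinv c) z =
    'D_(((fun y => mder (chart c) y (X y)) \o cinv c) z) (f \o cinv c) z.
Proof.
move=> cx Hf.
have := near_cinv cx (near_msmooth_at Hf); have := near_chart_image cx.
apply: filterS2 => z [cz zE] Hz /=.
by rewrite (mder_chartE _ cz Hz) zE.
Qed.

Lemma vsmooth_atP (X : vfield M) c x : cdom c x ->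
  vsmooth_at X x <-> msmooth_at (fun y => mder (chart c) y (X y)) x.
Proof.
have H a b : cdom a x -> cdom b x ->
    msmooth_at (fun y => mder (chart a) y (X y)) x ->
    msmooth_at (fun y => mder (chart b) y (X y)) x.
  move=> ax bx /(msmooth_atP _ ax) Ha; apply/(msmooth_atP _ ax).
  have E := mder_along_near X ax (msmooth_at_chart bx).
  apply: eq_smooth_at (filterS _ E) _ => [z|]; first by move=> ->.
  exact: (smooth_at_derive_along (smooth_transition ax bx) Ha).
by move=> cx; split; apply: H => //; exact: cdom_center.
Qed.

Lemma near_vsmooth_at (X : vfield M) x :
  vsmooth_at X x -> \forall y \near x, vsmooth_at X y.
Proof.
move=> /near_msmooth_at; have xx := cdom_center x.
apply: filterS2 (near_cdom xx) => y xy.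
by rewrite (vsmooth_atP _ xy).
Qed.

Lemma smooth_vfield_onP (U : set M) (X : vfield M) :
  smooth_vfield_on U X <-> forall x, U x -> vsmooth_at X x.
Proof.
split=> H x => [Ux|y [Uy xy]].
  by apply: (H x x); split=> //; exact: cdom_center.
exact: ((vsmooth_atP X xy).1 (H y Uy)).
Qed.

Lemma smooth_vfieldP (X : vfield M) :
  smooth_vfield X <-> forall x, vsmooth_at X x.
Proof.
by rewrite /smooth_vfield smooth_vfield_onP; split=> H x; [exact: H|move=> _].
Qed.

Lemma msmooth_at_along {V} (f : M -> V) (X : vfield M) x :
  msmooth_at f x -> vsmooth_at X x -> msmooth_at (fun y => mder f y (X y)) x.
Proof.
move=> Hf HX; have E := mder_along_near X (cdom_center x) Hf.
apply: eq_smooth_at (filterS _ E) _ => [z|]; first by move=> ->.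
exact: (smooth_at_derive_along Hf HX).
Qed.

(** By definition the bracket at [x] is the commutator applied to the coordinates centred at [x].
    For an arbitrary [f] the commutator contains in addition second derivatives of [f], and these
    cancel by Schwarz's theorem. *)
Lemma mder_bracket {V} (f : M -> V) (X Y : vfield M) x :
  msmooth_at f x -> vsmooth_at X x -> vsmooth_at Y x ->
  mder f x (lie_bracket X Y x) =
    mder (fun y => mder f y (Y y)) x (X x) -
    mder (fun y => mder f y (X y)) x (Y x).
Proof.
move=> Hf HX HY; have xx := cdom_center x.
have H (Z : vfield M) v : vsmooth_at Z x ->
    mder (fun y => mder f y (Z y)) x v =
    'D_v ('D_(Z x) (f \o cinv x)) (chart x x) +
    mder f x (mder (fun y => mder (chart x) y (Z y)) x v).
  move=> HZ; rewrite {1}/mder (near_eq_derive _ (mder_along_near Z xx Hf)).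
  pose fh := f \o cinv x.
  pose Zh := (fun y => mder (chart x) y (Z y)) \o cinv x.
  have Hf' : smooth_at fh (chart x x) by exact: Hf.
  have HZ' : smooth_at Zh (chart x x) by exact: HZ.
  have ZE : Zh (chart x x) = Z x by rewrite /Zh /= chartK// mder_chart_center.
  have := derive_derive_along v Hf' HZ'; rewrite ZE; exact.
have S := smooth_at_schwarz (X x) (Y x) Hf.
rewrite (H Y (X x) HY) (H X (Y x) HX) /lie_bracket (linearPB (mder_linear Hf)).
have swap (a b c d : V) : a = d -> b - c = a + b - (d + c).
  by move=> ->; lmod_ring_over R.
exact: swap S.
Qed.

Lemma msmooth_atB {V} (f g : M -> V) x : msmooth_at f x -> msmooth_at g x ->
  msmooth_at (fun y => f y - g y) x.
Proof. exact: smooth_atB. Qed.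

(** At each nearby [y] the bracket is defined in the chart of [y]; [mder_bracket], applied to the
    coordinates of the chart at [x], gives its components in that one chart. *)
Lemma vsmooth_at_bracket (X Y : vfield M) x :
  vsmooth_at X x -> vsmooth_at Y x -> vsmooth_at (lie_bracket X Y) x.
Proof.
move=> HX HY; have xx := cdom_center x; have Hc := msmooth_at_chart xx.
pose f := fun y => mder (fun y' => mder (chart x) y' (Y y')) y (X y) -
    mder (fun y' => mder (chart x) y' (X y')) y (Y y).
apply: (@eq_msmooth_at _ f).
  have := near_msmooth_at Hc; have := near_vsmooth_at HX.
  have := near_vsmooth_at HY; apply: filterS3 => y HYy HXy Hcy.
  by rewrite (mder_bracket Hcy HXy HYy).
exact: (msmooth_atB (msmooth_at_along (msmooth_at_along Hc HY) HX)
  (msmooth_at_along (msmooth_at_along Hc HX) HY)).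
Qed.

End ManifoldSmoothness.

Section ManifoldRules.
Context {R : realType} {n : nat} {M : manifold R n}.
Implicit Types (x c : M) (V : normedModType R).

Lemma msmooth_at_cst V (w : V) x : msmooth_at (fun _ : M => w) x.
Proof. exact: smooth_at_cst. Qed.

Lemma msmooth_atD V (f g : M -> V) x : msmooth_at f x -> msmooth_at g x ->
  msmooth_at (fun y => f y + g y) x.
Proof. exact: smooth_atD. Qed.

Lemma msmooth_atN V (f : M -> V) x : msmooth_at f x ->
  msmooth_at (fun y => - f y) x.
Proof. exact: smooth_atN. Qed.

Lemma msmooth_atZ V (a : M -> R) (f : M -> V) x :
  msmooth_at a x -> msmooth_at f x -> msmooth_at (fun y => a y *: f y) x.
Proof. exact: smooth_atZ. Qed.

Lemma msmooth_atM (f g : M -> R) x :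
  msmooth_at f x -> msmooth_at g x -> msmooth_at (fun y => f y * g y) x.
Proof. exact: smooth_atM. Qed.

Lemma msmooth_at_sum V (I : Type) (r : seq I) (f : I -> M -> V) x :
  (forall i, msmooth_at (f i) x) ->
  msmooth_at (fun y => \sum_(i <- r) f i y) x.
Proof. by move=> H; apply: smooth_at_sum => i _; exact: H. Qed.

Lemma msmooth_at_mulmx a b d (A : M -> 'M[R]_(a, b)) (B : M -> 'M[R]_(b, d)) x :
  msmooth_at A x -> msmooth_at B x -> msmooth_at (fun y => A y *m B y) x.
Proof. exact: smooth_at_mulmx. Qed.

Lemma msmooth_at_mulmxl a b d (A : 'M[R]_(a, b)) (B : M -> 'M[R]_(b, d)) x :
  msmooth_at B x -> msmooth_at (fun y => A *m B y) x.
Proof. exact: smooth_at_mulmxl. Qed.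

Lemma msmooth_at_trmx a b (A : M -> 'M[R]_(a, b)) x :
  msmooth_at A x -> msmooth_at (fun y => (A y)^T) x.
Proof. exact: smooth_at_trmx. Qed.

Lemma msmooth_mxP a b (A : M -> 'M[R]_(a, b)) x :
  msmooth_at A x <-> forall i j, msmooth_at (fun y => A y i j) x.
Proof. exact: smooth_mxP. Qed.

Lemma msmooth_at_invmx a (A : M -> 'M[R]_a) x : A x \in unitmx ->
  msmooth_at A x -> msmooth_at (fun y => invmx (A y)) x.
Proof.
move=> Ax; apply: smooth_at_invmx.
by rewrite /= chartK//; exact: cdom_center.
Qed.

Lemma mder_cst V (w : V) x v : mder (fun _ : M => w) x v = 0.
Proof. exact: derive_cst. Qed.

Lemma mderD V (f g : M -> V) x v : msmooth_at f x -> msmooth_at g x ->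
  mder (fun y => f y + g y) x v = mder f x v + mder g x v.
Proof.
move=> Hf Hg; exact: (deriveD (smooth_at_derivable Hf) (smooth_at_derivable Hg)).
Qed.

Lemma mderN V (f : M -> V) x v : msmooth_at f x ->
  mder (fun y => - f y) x v = - mder f x v.
Proof. move=> Hf; exact: (deriveN (smooth_at_derivable Hf)). Qed.

Lemma mderZ V (a : M -> R) (f : M -> V) x v :
  msmooth_at a x -> msmooth_at f x ->
  mder (fun y => a y *: f y) x v = mder a x v *: f x + a x *: mder f x v.
Proof.
move=> Ha Hf; have := is_derive_scale (smooth_at_continuous Ha)
  (smooth_at_derivable (v := v) Ha) (smooth_at_derivable (v := v) Hf).
move=> [_]; rewrite /comp (chartK (cdom_center x)) => D.
by rewrite [RHS]addrC; exact: D.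
Qed.

Lemma mderM (f g : M -> R) x v : msmooth_at f x -> msmooth_at g x ->
  mder (fun y => f y * g y) x v = mder f x v * g x + f x * mder g x v.
Proof. exact: (@mderZ R^o f g x v). Qed.

Lemma mder_mulmx a b d (A : M -> 'M[R]_(a, b)) (B : M -> 'M[R]_(b, d)) x v :
  msmooth_at A x -> msmooth_at B x ->
  mder (fun y => A y *m B y) x v = mder A x v *m B x + A x *m mder B x v.
Proof.
move=> HA HB; have := derive_mulmx v HA HB.
by rewrite /= chartK//; exact: cdom_center.
Qed.

Lemma mder_mulmxl a b d (A : 'M[R]_(a, b)) (B : M -> 'M[R]_(b, d)) x v :
  msmooth_at B x -> mder (fun y => A *m B y) x v = A *m mder B x v.
Proof. exact: derive_mulmxl. Qed.

Lemma mder_trmx a b (A : M -> 'M[R]_(a, b)) x v :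
  msmooth_at A x -> mder (fun y => (A y)^T) x v = (mder A x v)^T.
Proof.
move=> HA; have HAT : smooth_at (fun z => (A (cinv x z))^T) (chart x x).
  exact: smooth_at_trmx HA.
apply/matrixP => i j; rewrite mxE /mder.
rewrite (derive_mx_entry _ _ _ HAT) (derive_mx_entry _ _ _ HA).
have -> : (fun z => (A (cinv x z))^T i j) = (fun z => (A \o cinv x) z j i).
  by apply/funext => z; rewrite mxE.
by [].
Qed.

Lemma mder_entry a b (A : M -> 'M[R]_(a, b)) x v i j :
  msmooth_at A x -> mder (fun y => A y i j) x v = mder A x v i j.
Proof. by move=> HA; rewrite /mder derive_mx_entry. Qed.

Lemma vsmooth_atD (X Y : vfield M) x : vsmooth_at X x -> vsmooth_at Y x ->
  vsmooth_at (fun y => X y + Y y) x.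
Proof.
move=> HX HY; have xx := cdom_center x; have Hc := msmooth_at_chart xx.
apply: eq_msmooth_at (msmooth_atD HX HY).
apply: filterS (near_msmooth_at Hc) => y Hy.
by rewrite (linearPD (mder_linear Hy)).
Qed.

Lemma vsmooth_atZ (a : M -> R) (X : vfield M) x :
  msmooth_at a x -> vsmooth_at X x -> vsmooth_at (fun y => a y *: X y) x.
Proof.
move=> Ha HX; have xx := cdom_center x; have Hc := msmooth_at_chart xx.
apply: eq_msmooth_at (msmooth_atZ Ha HX).
apply: filterS (near_msmooth_at Hc) => y Hy.
by rewrite (linearPZ (mder_linear Hy)).
Qed.

Lemma vsmooth_atN (X : vfield M) x :
  vsmooth_at X x -> vsmooth_at (fun y => - X y) x.
Proof.
move=> HX; have -> : (fun y => - X y) = (fun y => (-1 : R) *: X y).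
  by apply/funext => y; rewrite scaleN1r.
exact: (vsmooth_atZ (msmooth_at_cst _ _) HX).
Qed.

Lemma vsmooth_atB (X Y : vfield M) x : vsmooth_at X x -> vsmooth_at Y x ->
  vsmooth_at (fun y => X y - Y y) x.
Proof. by move=> HX HY; exact: (vsmooth_atD HX (vsmooth_atN HY)). Qed.

Lemma vsmooth_at0 x : vsmooth_at (fun _ : M => 0) x.
Proof.
apply: (@eq_msmooth_at _ _ _ _ (fun=> 0)); last exact: msmooth_at_cst.
have Hc := msmooth_at_chart (cdom_center x).
apply: filterS (near_msmooth_at Hc) => y Hy.
by rewrite (linearP0 (mder_linear Hy)).
Qed.

Lemma vsmooth_at_sum (I : Type) (r : seq I) (X : I -> vfield M) x :
  (forall i, vsmooth_at (X i) x) ->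
  vsmooth_at (fun y => \sum_(i <- r) X i y) x.
Proof.
move=> HX; elim: r => [|i r IH]; last first.
  have -> : (fun y => \sum_(j <- i :: r) X j y) =
      (fun y => X i y + \sum_(j <- r) X j y).
    by apply/funext => y; rewrite big_cons.
  exact: (vsmooth_atD (HX i) IH).
have -> : (fun y => \sum_(j <- [::]) X j y) = (fun y => 0 : 'rV[R]_n).
  by apply/funext => y; rewrite big_nil.
exact: vsmooth_at0.
Qed.

Lemma eq_vsmooth_at (X Y : vfield M) x :
  (\forall y \near x, X y = Y y) -> vsmooth_at X x -> vsmooth_at Y x.
Proof. by move=> XY; apply: eq_msmooth_at; apply: filterS XY => y ->. Qed.

(* The vector at [y] whose components in the chart [c] are [w]. *)
Definition cvec c y (w : 'rV[R]_n) : 'rV[R]_n :=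
  'D_w (chart y \o cinv c) (chart c y).

Lemma mder_cvec c y w : cdom c y -> mder (chart c) y (cvec c y w) = w.
Proof.
move=> cy; have yy := cdom_center y.
have H1 := smooth_transition cy yy; have H2 := smooth_transition yy cy.
rewrite /mder /cvec.
have E : chart y y = (chart y \o cinv c) (chart c y) by rewrite /= chartK.
have H2' : smooth_at (chart c \o cinv y) ((chart y \o cinv c) (chart c y)).
  by rewrite -E.
have D := derive_comp w H1 H2'; rewrite -E in D; rewrite -D.
transitivity ('D_w (id : 'rV[R]_n -> 'rV[R]_n) (chart c y)).
  apply: near_eq_derive.
  have := near_cinv cy (near_cdom yy); have := near_chart_image cy.
  by apply: filterS2 => z [_ zE] yz /=; rewrite chartK.
exact: derive_id.
Qed.

Lemma cvecK c y v : cdom c y -> cvec c y (mder (chart c) y v) = v.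
Proof.
move=> cy; have yy := cdom_center y.
by rewrite /cvec -(mder_chartE _ cy (msmooth_at_chart yy)) mder_chart_center.
Qed.

Lemma cvec_linear c y : cdom c y -> linear (cvec c y).
Proof.
move=> cy; apply: smooth_at_derive_linear.
exact: smooth_transition cy (cdom_center y).
Qed.

Lemma vsmooth_at_cvec c x (f : M -> 'rV[R]_n) : cdom c x ->
  msmooth_at f x -> vsmooth_at (fun y => cvec c y (f y)) x.
Proof.
move=> cx Hf; apply/(vsmooth_atP _ cx); apply: eq_msmooth_at Hf.
by apply: filterS (near_cdom cx) => y cy; rewrite mder_cvec.
Qed.

Lemma cvec_frame c y v : cdom c y ->
  v = \sum_i mder (chart c) y v 0 i *: cvec c y (delta_mx 0 i).
Proof.
move=> cy; rewrite -{1}(cvecK v cy) {1}(row_sum_delta (mder _ _ _)).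
rewrite (linearP_sum (cvec_linear cy)); apply: eq_bigr => i _.
by rewrite (linearPZ (cvec_linear cy)).
Qed.

End ManifoldRules.

Section SmoothMaps.
Context {R : realType} {n k : nat} {M : manifold R n} {P : manifold R k}.
Implicit Types (x : M) (V : normedModType R).

Definition psmooth_at (f : M -> P) x :=
  {for x, continuous f} /\ smooth_at (chart (f x) \o f \o cinv x) (chart x x).

Lemma comp_near V (f : M -> P) (g : P -> V) x : psmooth_at f x ->
  \forall z \near chart x x, ((g \o f) \o cinv x) z =
    ((g \o cinv (f x)) \o (chart (f x) \o f \o cinv x)) z.
Proof.
move=> [cf _]; have xx := cdom_center x.
have : \forall y \near x, cdom (f x) (f y).
  exact: (cf _ (near_cdom (cdom_center (f x)))).
by move=> /(near_cinv xx); apply: filterS => z fz; rewrite /= chartK.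
Qed.

Lemma msmooth_at_comp V (f : M -> P) (g : P -> V) x :
  psmooth_at f x -> msmooth_at g (f x) -> msmooth_at (fun y => g (f y)) x.
Proof.
move=> Hf Hg; have E := comp_near g Hf.
apply: eq_smooth_at (filterS _ E) _ => [z|]; first by move=> ->.
apply: smooth_at_comp; first exact: Hf.2.
by rewrite /= chartK//; exact: cdom_center.
Qed.

Lemma mder_comp V (f : M -> P) (g : P -> V) x v :
  psmooth_at f x -> msmooth_at g (f x) ->
  mder (fun y => g (f y)) x v = mder g (f x) (tmap f x v).
Proof.
move=> Hf Hg; have xx := cdom_center x.
rewrite {1}/mder (near_eq_derive _ (comp_near g Hf)) derive_comp.
- by rewrite /= chartK.
- exact: Hf.2.
- by rewrite /= chartK.
Qed.

End SmoothMaps.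

Lemma psmooth_at_comp {R : realType} n k l (M : manifold R n) (P : manifold R k)
    (Q : manifold R l) (f : M -> P) (g : P -> Q) (x : M) :
  psmooth_at f x -> psmooth_at g (f x) -> psmooth_at (fun y => g (f y)) x.
Proof.
move=> Hf Hg; split; first exact: continuous_comp Hf.1 Hg.1.
exact: (msmooth_at_comp Hf Hg.2).
Qed.

Lemma tmap_comp {R : realType} n k l (M : manifold R n) (P : manifold R k)
    (Q : manifold R l) (f : M -> P) (g : P -> Q) (x : M) v :
  psmooth_at f x -> psmooth_at g (f x) ->
  tmap (fun y => g (f y)) x v = tmap g (f x) (tmap f x v).
Proof. by move=> Hf Hg; exact: (mder_comp v Hf Hg.2). Qed.

Lemma tmap_linear {R : realType} n k (M : manifold R n) (P : manifold R k)
    (f : M -> P) (x : M) : psmooth_at f x -> linear (tmap f x).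
Proof. by move=> Hf; exact: (@mder_linear _ _ _ _ _ x Hf.2). Qed.

(** * Bump functions *)

Section FlatFunctions.
Context {R : realType}.
Implicit Types (p : {poly R}) (t s : R).

Lemma exprn_le_expR k s : 0 <= s -> s ^+ k <= k`!%:R * expR s.
Proof.
move=> s0; case: k => [|k].
  by rewrite expr0 fact0 mul1r (le_trans _ (expR_ge1Dx s))// lerDl.
rewrite -ler_pdivrMl ?ltr0n ?fact_gt0// mulrC.
by apply: le_trans (expR_ge1Dxn k s0); rewrite lerDr.
Qed.

Lemma poly_le_expR p : exists2 K : R, 0 <= K &
  forall s, 0 <= s -> `|p.[s]| <= K * expR s.
Proof.
exists (\sum_(i < size p) `|p`_i| * i`!%:R).
  by apply: sumr_ge0 => i _; rewrite mulr_ge0.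
move=> s s0; rewrite horner_coef mulr_suml.
apply: le_trans (ler_norm_sum _ _ _) _; apply: ler_sum => i _.
rewrite normrM -mulrA ler_wpM2l// ger0_norm ?exprn_ge0//.
exact: exprn_le_expR.
Qed.

(** The polynomial factor makes the family stable under derivation: since 1/t has derivative -1/t^2,
    [p] becomes X^2 (p - p'). Smoothness of exp(-1/t) at the origin then follows by induction on the
    order. *)
Definition flat p t : R := if 0 < t then p.[t^-1] * expR (- t^-1) else 0.

Lemma is_derive_flat p t :
  is_derive t 1 (flat p) (flat ('X^2 * (p - p^`())) t).
Proof.
have [t0|t0|->] := ltgtP t 0.
- have E : \forall z \near t, cst 0 z = flat p z.
    have : \forall z \near t, z < 0 by exact: lt_nbhsl.
    by apply: filterS => z z0; rewrite /flat ltNge (ltW z0).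
  rewrite {2}/flat ltNge (ltW t0) /=.
  exact: (near_eq_is_derive E).
- have E : \forall z \near t, ((horner p \o GRing.inv) * (expR \o (-%R \o GRing.inv))) z = flat p z.
    have : \forall z \near t, 0 < z by exact: lt_nbhsr.
    by apply: filterS => z z0; rewrite /flat z0.
  apply: (near_eq_is_derive E).
  have t1 : t != 0 by rewrite gt_eqF.
  have di : is_derive t 1 (GRing.inv : R -> R) (- t ^- 2).
    have := @is_deriveV R id t 1 1 t1 (is_derive_id _ _).
    by rewrite /GRing.scale /= mulr1.
  have d1 : is_derive t 1 (horner p \o GRing.inv) (p^`().[t^-1] * (- t ^- 2)).
    exact: is_derive1_comp.
  have d2 : is_derive t 1 (-%R \o GRing.inv : R -> R) (-1 * (- t ^- 2)).
    by apply: is_derive1_comp.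
  have d3 : is_derive t 1 (expR \o (-%R \o GRing.inv))
      (expR (- t^-1) * (-1 * (- t ^- 2))).
    exact: is_derive1_comp.
  apply: is_derive_eq; rewrite /flat t0 /= /GRing.scale /= !hornerE /=.
  by rewrite exprVn; ring.
- rewrite {2}/flat ltxx.
  (* Evaluated at 1/h, the bound of X^2 p by [K] times the exponential says that [flat p h] is at
     most K h^2 in absolute value; hence the derivative at 0 exists and vanishes. *)
  have [K K0 HK] := poly_le_expR ('X^2 * p).
  apply: is_derive_near => e e0; apply/nbhs_norm0P.
  exists (e / (K + 1)); first by rewrite /= divr_gt0// ltr_wpDl.
  move=> h /= he; rewrite /flat ltxx scaler0 !subr0 addr0 [h *: _]mulr1.
  case: ifPn => [h0|_]; last by rewrite normr0 mulr_ge0// ltW.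
  rewrite gtr0_norm// in he *.
  have := HK h^-1; rewrite invr_ge0 (ltW h0) => /(_ isT).
  rewrite !hornerE normrM exprVn ger0_norm; last by rewrite invr_ge0 exprn_ge0// ltW.
  have h2 : 0 < h ^+ 2 by rewrite exprn_gt0.
  rewrite ler_pdivrMl// => H.
  rewrite normrM (ger0_norm (expR_ge0 _)) expRN ler_pdivrMr ?expR_gt0//.
  apply: le_trans H _; rewrite mulrA ler_wpM2r ?expR_ge0//.
  move: he; rewrite ltr_pdivlMr ?ltr_wpDl// => he.
  nra.
Qed.

Lemma Ck_flat k p : Ck k setT (flat p).
Proof.
have cf q : continuous (flat q).
  move=> t; apply: differentiable_continuous; apply/derivable1_diffP.
  exact: (@ex_derive _ _ _ _ _ _ _ (is_derive_flat q t)).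
elim: k p => [|k IH] p; first by split=> // y _; exact: cf.
split=> [y _|v]; first exact: cf.
pose q := 'X^2 * (p - p^`()).
have dv t : is_derive t v (flat p) (v *: flat q t).
  have d1 := is_derive_flat p t.
  have := is_deriveZv v (@ex_derive _ _ _ _ _ _ _ d1).
  by rewrite (@derive_val _ _ _ _ _ _ _ d1) /GRing.scale /= mulr1.
split=> [t _|]; first exact: (@ex_derive _ _ _ _ _ _ _ (dv t)).
apply: (@eq_Ck _ _ _ _ _ (fun t => cst v t *: flat q t)).
- exact: openT.
- by move=> t _; rewrite (@derive_val _ _ _ _ _ _ _ (dv t)).
- by apply: CkZ (IH q); [exact: openT|exact: Ck_cst].
Qed.

Lemma smooth_at_flat p t : smooth_at (flat p) t.
Proof.
apply/smooth_atP; exists setT; split=> // [|k]; first exact: openT.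
exact: Ck_flat.
Qed.

Lemma flat1_gt0 t : (0 < flat 1 t) = (0 < t).
Proof.
by rewrite /flat; case: ifP => t0; rewrite ?ltxx// hornerC mul1r expR_gt0.
Qed.

Lemma flat1_eq0 t : t <= 0 -> flat 1 t = 0.
Proof. by rewrite /flat ltNge => ->. Qed.

End FlatFunctions.

Lemma smooth_at_id {R : realType} (V : normedModType R) (y : V) :
  smooth_at id y.
Proof.
apply/smooth_atP; exists setT; split=> // [|[|k]]; first exact: openT.
  by split=> // z _; exact: cvg_id.
split=> [z _|v]; first exact: cvg_id.
split=> [z _|]; first exact: derivable_id.
apply: (@eq_Ck _ _ _ _ _ (cst v)); [exact: openT| |exact: Ck_cst].
by move=> z _; rewrite derive_id.
Qed.

Section GlobalFields.
Context {R : realType} {n : nat} {M : manifold R n}.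

(** In the chart at [x0] the function vanishes outside a closed ball, whose image [K] in M is
    compact, hence closed because M is Hausdorff. So the extension by zero vanishes near every point
    outside the domain of the chart. *)
Lemma bump_exists (x0 : M) : exists (b : M -> R),
  [/\ b x0 = 1, forall x, msmooth_at b x &
      forall x, ~ cdom x0 x -> \forall y \near x, b y = 0].
Proof.
have xx := cdom_center x0; pose c := chart x0 x0.
have [r r0 rP] : exists2 r : R, 0 < r & forall z, `|c - z| <= r ->
    (chart x0 @` cdom x0) z.
  have : nbhs c (chart x0 @` cdom x0).
    by apply: open_nbhs_nbhs; split; [exact: cimage_open|exists x0].
  move=> /nbhs_normP[r r0 rP]; exists (r / 2); first by rewrite divr_gt0.
  by move=> z zr; apply: rP; rewrite /ball_/= (le_lt_trans zr)// ltr_pdivrMr//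
    ltr_pMr// ltr1n.
pose K := cinv x0 @` [set z | `|c - z| <= r].
have KP y : cdom x0 y -> `|c - chart x0 y| <= r -> K y.
  by move=> cy yr; exists (chart x0 y) => //; rewrite chartK.
have Kdom y : K y -> cdom x0 y.
  by move=> [z /rP[y' cy' <-] <-]; rewrite chartK.
have Kc : closed K.
  apply: compact_closed; first exact: mhausdorff.
  apply: continuous_compact.
    apply: continuous_in_subspaceT => z; rewrite inE => /rP[y cy <-].
    exact: cinv_continuous.
  apply: bounded_closed_compact; last exact: closed_closed_ball_.
  exists (`|c| + r); split; first exact: num_real.
  move=> k kr z /= zr; apply: le_trans (ltW kr).
  by rewrite -[z](subKr c) (le_trans (ler_normB _ _))// lerD2l.
(* The norm of row vectors is a maximum and not smooth; the Euclidean square is a polynomial and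
   dominates the square of that norm. *)
pose sq (z : 'rV[R]_n) := \sum_(i < n) (z 0 i - c 0 i) * (z 0 i - c 0 i) : R.
have sq_lt (z : 'rV[R]_n) : sq z < r ^+ 2 -> `|c - z| <= r.
  move=> zr; rewrite [leLHS]/Num.norm /= mx_normrE; apply: bigmax_le.
    exact: ltW.
  move=> [i j] _ /=; rewrite (ord1 i) !mxE distrC -(ler_pXn2r (n := 2)) ?nnegrE ?(ltW r0)//.
  rewrite real_normK ?num_real//; apply: le_trans (ltW zr).
  rewrite /sq (bigD1 j)//= expr2 lerDl; apply: sumr_ge0 => k _.
  by rewrite -expr2 sqr_ge0.
pose g (z : 'rV[R]_n) := flat 1 (r ^+ 2 - sq z).
have g0 : 0 < g c.
  rewrite flat1_gt0 /sq big1 ?subr0 ?exprn_gt0// => i _.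
  by rewrite subrr mul0r.
pose b y := if `[< cdom x0 y >] then g (chart x0 y) / g c else 0.
have bK y : ~ K y -> b y = 0.
  move=> nK; rewrite /b; case: asboolP => // cy.
  rewrite /g flat1_eq0 ?mul0r// subr_le0 leNgt; apply/negP => /sq_lt.
  by move=> /(KP y cy).
have bout x : ~ cdom x0 x -> \forall y \near x, b y = 0.
  move=> ncx; have nK : ~ K x by move=> /Kdom.
  have : nbhs x (~` K).
    by apply: open_nbhs_nbhs; split=> //; exact: closed_openC.
  by apply: filterS => y; exact: bK.
exists b; split=> //.
  by rewrite /b; case: asboolP => // _; rewrite divff// gt_eqF.
move=> x; case: (pselect (cdom x0 x)) => [cx|/bout bx]; last first.
  apply: (@eq_msmooth_at _ _ _ _ (fun=> 0)); last exact: msmooth_at_cst.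
  by apply: filterS bx => y ->.
have gs (z : 'rV[R]_n) : smooth_at g z.
  have ss : smooth_at (fun z => r ^+ 2 - sq z) z.
    apply: smooth_atB; first exact: smooth_at_cst.
    apply: smooth_at_sum => i _.
    have si : smooth_at (fun z : 'rV[R]_n => z 0 i - c 0 i) z.
      apply: smooth_atB; last exact: smooth_at_cst.
      exact: ((smooth_mxP id z).1 (smooth_at_id z)).
    exact: smooth_atM.
  exact: (smooth_at_comp ss (smooth_at_flat 1 _)).
apply/(msmooth_atP _ cx).
apply: (@eq_smooth_at _ _ _ (fun z => (g c)^-1 *: g z)).
  apply: filterS (near_chart_image cx) => z [cz zE].
  by rewrite /= /b; case: asboolP => // _; rewrite zE mulrC.
by apply: smooth_atZ; [exact: smooth_at_cst|exact: gs].
Qed.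

(** [T_omega] is specified through global fields with given values at a point; a field with constant
    components in a chart, multiplied by a bump function, realizes any value. *)
Lemma global_field (x0 : M) (v : 'rV[R]_n) :
  exists2 X : vfield M, smooth_vfield X & X x0 = v.
Proof.
have [b [b0 bs bout]] := bump_exists x0.
exists (fun y => b y *: cvec x0 y v); last first.
  have xx := cdom_center x0; rewrite b0 scale1r.
  by rewrite -[RHS](cvecK v xx) mder_chart_center.
apply/smooth_vfieldP => x; case: (pselect (cdom x0 x)) => [cx|/bout bx].
  apply: vsmooth_atZ; first exact: bs.
  exact: (vsmooth_at_cvec cx (msmooth_at_cst _ _)).
by apply: eq_vsmooth_at (vsmooth_at0 x); apply: filterS bx => y ->; rewrite scale0r.
Qed.
End GlobalFields.

(** * Lorentzian linear algebra *)

Section LorentzAlgebra.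
Context {R : realType} {m : nat}.
Local Notation L := 'cV[R]_(1 + m + 1).
Local Notation J := (@lorentz_gram R m).
Implicit Types (v w : L) (g B : 'M[R]_(1 + m + 1)).

Definition lvec (a : R) (x : 'cV[R]_m) (b : R) : L :=
  col_mx (col_mx a%:M x) b%:M.

Lemma lvecP v : exists a x b, v = lvec a x b.
Proof.
exists (usubmx (usubmx v) 0 0), (dsubmx (usubmx v)), (dsubmx v 0 0).
by rewrite /lvec -!mx11_scalar !vsubmxK.
Qed.

Lemma lvec_inj a x b a' x' b' :
  lvec a x b = lvec a' x' b' -> [/\ a = a', x = x' & b = b'].
Proof.
move=> /eq_col_mx[/eq_col_mx[/matrixP/(_ 0 0) ea ->] /matrixP/(_ 0 0) eb].
by move: ea eb; rewrite !mxE !eqxx !mulr1n.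
Qed.

Lemma lvecD a x b a' x' b' :
  lvec a x b + lvec a' x' b' = lvec (a + a') (x + x') (b + b').
Proof. by rewrite /lvec !add_col_mx !raddfD. Qed.

Lemma lvecZ k a x b : k *: lvec a x b = lvec (k * a) (k *: x) (k * b).
Proof. by rewrite /lvec !scale_col_mx !scale_scalar_mx. Qed.

Lemma lvecN a x b : - lvec a x b = lvec (- a) (- x) (- b).
Proof. by rewrite /lvec !opp_col_mx !raddfN. Qed.

Lemma ellE : ell m = lvec 1 0 0 :> L.
Proof. by rewrite /ell /lvec; congr col_mx; rewrite raddf0. Qed.

Lemma ennE : enn m = lvec 0 0 1 :> L.
Proof. by rewrite /enn /lvec; congr col_mx; rewrite raddf0. Qed.

Lemma gram_lvec a x b : J *m lvec a x b = lvec b x a.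
Proof.
rewrite /lorentz_gram /lvec mul_block_col mul_block_col mul_col_mx mul_row_col.
by rewrite !mul0mx !mul1mx !addr0 !add0r add_col_mx addr0 add0r.
Qed.

Lemma lorentz_lvec a x b a' x' b' :
  lorentz (lvec a x b) (lvec a' x' b') = a * b' + b * a' + (x^T *m x') 0 0.
Proof.
rewrite /lorentz -mulmxA gram_lvec /lvec !tr_col_mx !mul_row_col.
rewrite !tr_scalar_mx -!scalar_mxM [LHS]mxE [X in X + _]mxE.
by rewrite !mxE !eqxx !mulr1n; ring.
Qed.

Lemma mulmx_cV_inj (p q : nat) (A B : 'M[R]_(p, q)) :
  (forall v : 'cV[R]_q, A *m v = B *m v) -> A = B.
Proof.
move=> H; apply/matrixP => i j; have := H (delta_mx j 0).
by rewrite -!colE => /matrixP/(_ i 0); rewrite !mxE.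
Qed.

Lemma gramK : J *m J = 1%:M.
Proof.
apply: mulmx_cV_inj => v; have [a [x [b ->]]] := lvecP v.
by rewrite -mulmxA !gram_lvec mul1mx.
Qed.

Lemma lorentzC v w : lorentz v w = lorentz w v.
Proof.
have [a [x [b ->]]] := lvecP v; have [a' [x' [b' ->]]] := lvecP w.
rewrite !lorentz_lvec -[x'^T *m x]trmxK trmx_mul trmxK [_^T 0 0]mxE; ring.
Qed.

Lemma lorentz_linearr v : scalar (lorentz v).
Proof. by move=> k w w'; rewrite /lorentz mulmxDr -scalemxAr !mxE. Qed.

Lemma lorentzDr v w w' : lorentz v (w + w') = lorentz v w + lorentz v w'.
Proof. exact: (linearPD (lorentz_linearr v : linear (_ : _ -> R^o))). Qed.
Lemma lorentzZr k v w : lorentz v (k *: w) = k * lorentz v w.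
Proof. exact: (linearPZ (lorentz_linearr v : linear (_ : _ -> R^o))). Qed.
Lemma lorentzNr v w : lorentz v (- w) = - lorentz v w.
Proof. by rewrite -scaleN1r lorentzZr mulN1r. Qed.
Lemma lorentzBr v w w' : lorentz v (w - w') = lorentz v w - lorentz v w'.
Proof. by rewrite lorentzDr lorentzNr. Qed.
Lemma lorentz0r v : lorentz v 0 = 0.
Proof. by rewrite -(scale0r 0) lorentzZr mul0r. Qed.
Lemma lorentzDl v w w' : lorentz (w + w') v = lorentz w v + lorentz w' v.
Proof. by rewrite !(lorentzC _ v) lorentzDr. Qed.
Lemma lorentzZl k v w : lorentz (k *: w) v = k * lorentz w v.
Proof. by rewrite !(lorentzC _ v) lorentzZr. Qed.
Lemma lorentzBl v w w' : lorentz (w - w') v = lorentz w v - lorentz w' v.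
Proof. by rewrite !(lorentzC _ v) lorentzBr. Qed.
Lemma groupG_gram g : groupG g -> g^T *m J *m g = J.
Proof.
move=> [H _]; apply: mulmx_cV_inj => w; apply/colP => i.
have := H (delta_mx i 0) w.
by rewrite /lorentz trmx_mul -!mulmxA trmx_delta -!rowE !mxE.
Qed.

Lemma groupG_unit g : groupG g -> g \in unitmx.
Proof.
move=> /groupG_gram E; have : (J *m g^T *m J) *m g = 1%:M.
  by rewrite -!mulmxA [g^T *m (J *m g)]mulmxA E gramK.
by move=> /mulmx1_unit[].
Qed.

Lemma lorentz_groupG g v w : groupG g ->
  lorentz (g *m v) (g *m w) = lorentz v w.
Proof. by move=> [H _]; exact: H. Qed.

Lemma groupH1 : groupH (1%:M : 'M[R]_(1 + m + 1)).
Proof.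
split; last by rewrite mul1mx.
by split=> [v w|v]; rewrite ?mul1mx.
Qed.

Lemma groupHM g g' : groupH g -> groupH g' -> groupH (g *m g').
Proof.
move=> [[g1 g2] ge] [[g1' g2'] ge']; split; last by rewrite -mulmxA ge'.
by split=> [v w|v]; rewrite -!mulmxA ?g1 // g2.
Qed.

Lemma groupHV g : groupH g -> groupH (invmx g).
Proof.
move=> [Gg ge]; have gu := groupG_unit Gg.
have K v : g *m (invmx g *m v) = v by rewrite mulmxA mulmxV// mul1mx.
split; last by rewrite -[in LHS]ge mulmxA mulVmx// mul1mx.
split=> [v w|v]; first by rewrite -(lorentz_groupG _ _ Gg) !K.
by rewrite -(Gg.2 (invmx g *m v)) K.
Qed.

Lemma groupH_unit g : groupH g -> g \in unitmx.
Proof. by move=> [/groupG_unit]. Qed.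

Lemma block_cVE (al : 'M[R]_1) (z : 'rV[R]_m) (x : 'cV[R]_m) (A : 'M[R]_m)
    (p : 'M[R]_1) (q : 'cV[R]_m) (r : 'M[R]_1) (s : 'rV[R]_m) (de : 'M[R]_1)
    c y d :
  block_mx (block_mx al z x A) (col_mx p q) (row_mx r s) de *m lvec c y d =
  lvec (al 0 0 * c + (z *m y) 0 0 + p 0 0 * d) (c *: x + A *m y + d *: q)
    (r 0 0 * c + (s *m y) 0 0 + de 0 0 * d).
Proof.
rewrite /lvec mul_block_col mul_block_col mul_col_mx mul_row_col add_col_mx.
rewrite !mul_mx_scalar; congr (col_mx (col_mx _ _) _).
- rewrite {1}[al]mx11_scalar {1}[p]mx11_scalar {1}[z *m y]mx11_scalar.
  by rewrite !scale_scalar_mx -!raddfD /= [c * _]mulrC [d * _]mulrC.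
- rewrite {1}[r]mx11_scalar {1}[de]mx11_scalar {1}[s *m y]mx11_scalar.
  by rewrite !scale_scalar_mx -!raddfD /= [c * _]mulrC [d * _]mulrC.
Qed.

Lemma gmx_lvec a X (A : 'M[R]_m) z c y d : gmx a X A z *m lvec c y d =
  lvec (a * c + (z *m y) 0 0) (c *: X + A *m y - d *: z^T)
       (- (X^T *m y) 0 0 - a * d).
Proof.
rewrite /gmx block_cVE; congr lvec.
- by move: ((z *m y) 0 0) => k; rewrite !mxE eqxx mulr1n; ring.
- by rewrite scalerN.
- by rewrite mulNmx [(- (X^T *m y)) 0 0]mxE; move: ((X^T *m y) 0 0) => k;
    rewrite !mxE eqxx mulr1n; ring.
Qed.

Lemma lieg_skew B v w : lieg B ->
  lorentz (B *m v) w + lorentz v (B *m w) = 0.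
Proof.
move=> [a [X [A [z [At ->]]]]].
have [c [y [d ->]]] := lvecP v; have [c' [y' [d' ->]]] := lvecP w.
rewrite !gmx_lvec !lorentz_lvec.
have -> : (c *: X + A *m y - d *: z^T)^T =
    c *: X^T - y^T *m A - d *: z.
  rewrite raddfB raddfD /= !linearZ /= trmxK trmx_mul At mulmxN.
  by [].
rewrite !mulmxDr !mulmxDl !mulNmx !mulmxN -!scalemxAl -!scalemxAr mulmxA.
have e1 : (y^T *m z^T) 0 0 = (z *m y) 0 0 by rewrite -trmx_mul mxE.
have e2 : (y^T *m X) 0 0 = (X^T *m y) 0 0.
  by rewrite -[y^T *m X]trmxK trmx_mul trmxK mxE.
have mxD (M N : 'M[R]_1) : (M + N) 0 0 = M 0 0 + N 0 0 by rewrite mxE.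
have mxN (M : 'M[R]_1) : (- M) 0 0 = - M 0 0 by rewrite mxE.
have mxZ k (M : 'M[R]_1) : (k *: M) 0 0 = k * M 0 0 by rewrite mxE.
by rewrite !(mxD, mxN, mxZ, e1, e2); ring.
Qed.

(** In block form, vanishing on [ell] kills the first column, and skew-symmetry tested on suitable
    vectors determines the other blocks. *)
Lemma lieh_of_skew B : (forall v w, lorentz (B *m v) w + lorentz v (B *m w) = 0) ->
  B *m ell m = 0 -> lieh B.
Proof.
rewrite -[B]submxK -[ulsubmx B]submxK -[ursubmx B]vsubmxK -[dlsubmx B]hsubmxK.
move: (ulsubmx (ulsubmx B)) (ursubmx (ulsubmx B)) (dlsubmx (ulsubmx B))
  (drsubmx (ulsubmx B)) (usubmx (ursubmx B)) (dsubmx (ursubmx B))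
  (lsubmx (dlsubmx B)) (rsubmx (dlsubmx B)) (drsubmx B) => al z x A p q r s de.
move=> H; rewrite ellE block_cVE.
have zero_lvec : 0 = lvec 0 0 0 by rewrite /lvec !raddf0 !col_mx0.
rewrite zero_lvec => /lvec_inj[]; rewrite !mulmx0 !mulr0 !mxE !addr0 !mulr1.
rewrite scale0r addr0 scale1r => al0 x0 r0.
have {}H c y d c' y' d' := H (lvec c y d) (lvec c' y' d').
have trmx00 (M : 'M[R]_1) : M^T 0 0 = M 0 0 by rewrite mxE.
have mx00 (M : 'M[R]_1) : M 0 0 = 0 -> M = 0.
  by move=> M0; rewrite [M]mx11_scalar M0 raddf0.
have rowdot0 (u : 'rV[R]_m) :
    (forall y : 'cV[R]_m, (u *m y) 0 0 = 0) -> u = 0.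
  by move=> Hu; apply: mulmx_cV_inj => y; rewrite mul0mx; apply/mx00/Hu.
subst x; have {}al0 := mx00 _ al0; have {}r0 := mx00 _ r0; subst al r.
have {}H c y d c' y' d' :
    ((z *m y) 0 0 + p 0 0 * d) * d' + ((s *m y) 0 0 + de 0 0 * d) * c'
    + ((A *m y + d *: q)^T *m y') 0 0
    + (c * ((s *m y') 0 0 + de 0 0 * d') + d * ((z *m y') 0 0 + p 0 0 * d')
    + (y^T *m (A *m y' + d' *: q)) 0 0) = 0.
  have := H c y d c' y' d'; rewrite !block_cVE !lorentz_lvec.
  by rewrite !scaler0 !mxE !mul0r !add0r.
have mx0 : (0 : 'M[R]_1) 0 0 = 0 by rewrite mxE.
(* From here on each choice of coordinates for the two test vectors leaves a single block in [H], or
   a single relation between two blocks. *)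
have s0 : s = 0.
  by apply: rowdot0 => y; have := H 0 y 0 1 0 0; rewrite
    !(scale0r, scale1r, mulmx0, mul0mx, trmx0, mx0, mulr0, mul0r, addr0, add0r,
      mulr1, mul1r).
subst s; have de0 : de = 0.
  by apply: mx00; have := H 0 0 1 1 0 0; rewrite
    !(scale0r, scale1r, mulmx0, mul0mx, trmx0, mx0, mulr0, mul0r, addr0, add0r,
      mulr1, mul1r).
have p0 : p = 0.
  by apply: mx00; have := H 0 0 1 0 0 1; rewrite
    !(scale0r, scale1r, mulmx0, mul0mx, trmx0, mx0, mulr0, mul0r, addr0, add0r,
      mulr1, mul1r) => E; lra.
subst de p; have qz : q = - z^T.
  apply/eqP; rewrite -subr_eq0 opprK; apply/eqP/trmx_inj; rewrite trmx0.
  apply: rowdot0 => y; have := H 0 0 1 0 y 0; rewrite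
    !(scale0r, scale1r, mulmx0, mul0mx, trmx0, mx0, mulr0, mul0r, addr0, add0r,
      mulr1, mul1r) => E.
  by rewrite raddfD /= trmxK mulmxDl mxE.
have At : A^T = - A.
  apply/eqP; rewrite -subr_eq0 opprK; apply/eqP; apply: mulmx_cV_inj => y.
  rewrite mul0mx; apply/trmx_inj; rewrite trmx0; apply: rowdot0 => y'.
  have := H 0 y 0 0 y' 0; rewrite
    !(scale0r, scale1r, mulmx0, mul0mx, trmx0, mx0, mulr0, mul0r, addr0, add0r,
      mulr1, mul1r) => E.
  rewrite mulmxDl raddfD /= !trmx_mul trmxK mulmxDl mxE addrC.
  by rewrite -[y^T *m A *m y']mulmxA -trmx_mul.
exists A, z; split=> //; subst q.
by rewrite /gmx !raddf0.
Qed.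

(** The orbit map of [ell] identifies g/h with the orthogonal of [ell]. It is the link between
    [phi], which defines the lightlike structure, and [Phi], which is [omega] applied to [ell]. *)
Lemma lieg_ell B : lieg B -> B *m ell m = lvec (gmodh B).1 (gmodh B).2 0.
Proof.
move=> [a [X [A [z [_ ->]]]]]; rewrite ellE gmx_lvec /gmodh /gmx /=.
rewrite !block_mxKul block_mxKdl !mulmx0 scale0r scale1r mulr1 mulr0.
by rewrite !mxE !eqxx !mulr1n !subr0 !addr0 oppr0.
Qed.

Lemma lieg_gmodh a X : exists2 B, lieg B & gmodh B = (a, X) :> R * 'cV[R]_m.
Proof.
exists (gmx a X 0 0); first by exists a, X, 0, 0; rewrite trmx0 oppr0.
by rewrite /gmodh /gmx !block_mxKul block_mxKdl mxE eqxx mulr1n.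
Qed.

End LorentzAlgebra.

Section LorentzFields.
Context {R : realType} {m n : nat} {M : manifold R n}.
Implicit Types (f g : M -> 'cV[R]_(1 + m + 1)) (x : M).

Lemma msmooth_at_lorentz f g x : msmooth_at f x -> msmooth_at g x ->
  msmooth_at (fun y => lorentz (f y) (g y)) x.
Proof.
move=> Hf Hg; have H := msmooth_at_mulmx (msmooth_at_trmx Hf)
  (msmooth_at_mulmxl (@lorentz_gram R m) Hg).
have E : (fun y => lorentz (f y) (g y)) =
    (fun y => ((f y)^T *m (@lorentz_gram R m *m g y)) 0 0).
  by apply/funext => y; rewrite /lorentz mulmxA.
by rewrite E; exact: ((msmooth_mxP _ x).1 H 0 0).
Qed.

Lemma mder_lorentz f g x v : msmooth_at f x -> msmooth_at g x ->
  mder (fun y => lorentz (f y) (g y)) x v =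
  lorentz (mder f x v) (g x) + lorentz (f x) (mder g x v).
Proof.
move=> Hf Hg; have HJ := msmooth_at_mulmxl (@lorentz_gram R m) Hg.
have H := msmooth_at_mulmx (msmooth_at_trmx Hf) HJ.
have E : (fun y => lorentz (f y) (g y)) =
    (fun y => ((f y)^T *m (@lorentz_gram R m *m g y)) 0 0).
  by apply/funext => y; rewrite /lorentz mulmxA.
rewrite E (mder_entry _ _ _ H) (mder_mulmx _ (msmooth_at_trmx Hf) HJ).
rewrite (mder_trmx _ Hf) (mder_mulmxl _ _ Hg) mxE.
by rewrite /lorentz !mulmxA.
Qed.

End LorentzFields.

(** * Local sections of the Cartan bundle *)

Section SmoothPairs.
Context {R : realType} {V W W' : normedModType R}.

Lemma inl_linear : linear (fun w : W => (w, 0 : W')).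
Proof. by move=> k a b; rewrite -[RHS]/(_, _) /= scaler0 addr0. Qed.

Lemma inr_linear : linear (fun w : W' => (0 : W, w)).
Proof. by move=> k a b; rewrite -[RHS]/(_, _) /= scaler0 addr0. Qed.

Let inlL : {linear W -> (W * W')%type} := HB.pack (fun w : W => (w, 0 : W'))
  (GRing.isLinear.Build _ _ _ _ _ inl_linear).
Let inrL : {linear W' -> (W * W')%type} := HB.pack (fun w : W' => (0 : W, w))
  (GRing.isLinear.Build _ _ _ _ _ inr_linear).

Let inlc : continuous inlL.
Proof.
apply: (@linear_lipschitz_continuous _ _ _ _ 1) => w.
by rewrite mul1r [leLHS]/Num.norm /= ge_max lexx normr0 normr_ge0.
Qed.
Let inrc : continuous inrL.
Proof.
apply: (@linear_lipschitz_continuous _ _ _ _ 1) => w.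
by rewrite mul1r [leLHS]/Num.norm /= ge_max lexx normr0 normr_ge0.
Qed.

Lemma pair_split (f : V -> W) (g : V -> W') :
  (fun y => (f y, g y)) = (inlL \o f) + (inrL \o g).
Proof.
apply/funext => y; rewrite -[RHS]/(f y + 0, 0 + g y).
by rewrite addr0 add0r.
Qed.

Lemma smooth_at_pair (f : V -> W) (g : V -> W') y :
  smooth_at f y -> smooth_at g y -> smooth_at (fun z => (f z, g z)) y.
Proof.
move=> Hf Hg; rewrite pair_split.
exact: (smooth_atD (smooth_at_lin inlc Hf) (smooth_at_lin inrc Hg)).
Qed.

Lemma derive_pair (f : V -> W) (g : V -> W') y v :
  smooth_at f y -> smooth_at g y ->
  'D_v (fun z => (f z, g z)) y = ('D_v f y, 'D_v g y).
Proof.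
move=> Hf Hg; rewrite pair_split.
have [df1 df2] := is_derive_lin inlc (smooth_at_derivable (v := v) Hf).
have [dg1 dg2] := is_derive_lin inrc (smooth_at_derivable (v := v) Hg).
rewrite (deriveD df1 dg1) df2 dg2 -[LHS]/('D_v f y + 0, 0 + 'D_v g y).
by rewrite addr0 add0r.
Qed.

End SmoothPairs.

Section CartanBundle.
Context {R : realType} {m : nat} {N : manifold R m.+1}.
Variable C : lightlike_cartan_geometry N.
Local Notation P := (tot C).
Local Notation L := 'cV[R]_(1 + m + 1).
Local Notation pr := (@Defs.proj _ _ _ _ _ C).
Implicit Types (u : P) (x : N) (g : 'M[R]_(1 + m + 1)).

Lemma proj_psmooth_at u : psmooth_at pr u.
Proof. exact: (@proj_smooth _ _ _ _ _ C u). Qed.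

Lemma near_action u g : groupH g ->
  exists F : 'rV[R]_(tot_dim C) * 'M[R]_(1 + m + 1) -> 'rV[R]_(tot_dim C),
    smooth_at F (chart u u, g) /\
    \forall z \near (chart u u, g), groupH z.2 ->
      cdom (act u g) (act (cinv u z.1) z.2) /\
      chart (act u g) (act (cinv u z.1) z.2) = F z.
Proof.
move=> Hg; have [U [F [Uo Uu Fs FE]]] := act_smooth u Hg.
exists F; split; first by exists U.
apply: filterS (open_nbhs_nbhs (conj Uo Uu)) => -[y g'] Uyg Hg'.
by have [_ ? ?] := FE y g' Uyg Hg'.
Qed.

(** The hypothesis on the action provides a smooth function [F] between charts. Continuity of the
    action is recovered by writing it near [u] as [F] between [chart u] and the inverse chart at
    [act u g]. *)
Lemma act_psmooth_at g u : groupH g -> psmooth_at (fun u' : P => act u' g) u.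
Proof.
move=> Hg; have uu := cdom_center u; have [F [Fs FE]] := near_action u Hg.
have sp : smooth_at (fun y : 'rV[R]_(tot_dim C) => (y, g)) (chart u u).
  by apply: smooth_at_pair; [exact: smooth_at_id|exact: smooth_at_cst].
have FE' : \forall y \near chart u u, cdom (act u g) (act (cinv u y) g) /\
    chart (act u g) (act (cinv u y) g) = F (y, g).
  have H : \forall y \near chart u u, groupH g ->
      cdom (act u g) (act (cinv u y) g) /\
      chart (act u g) (act (cinv u y) g) = F (y, g).
    exact: (smooth_at_continuous sp FE).
  by apply: filterS H => y; apply.
have sF : smooth_at (fun y => F (y, g)) (chart u u).
  exact: (smooth_at_comp sp Fs).
split; last first.
  by apply: eq_smooth_at sF; apply: filterS FE' => y [_ /= ->].
have FE2 : \forall u' \near u, cdom (act u g) (act u' g) /\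
    chart (act u g) (act u' g) = F (chart u u', g).
  have := near_chart uu FE'; apply: filterS2 (near_cdom uu) => u' cu'.
  by rewrite chartK.
have c0 : chart (act u g) (act u g) = F (chart u u, g).
  by have [] := nbhs_singleton FE2.
rewrite /prop_for /continuous_at.
have cF : {for u, continuous (fun u' => cinv (act u g) (F (chart u u', g)))}.
  apply: (@continuous_comp _ _ _ (fun u' : P => F (chart u u', g))).
    apply: (@continuous_comp _ _ _ (chart u) (fun y => F (y, g))).
      exact: chart_continuous.
    exact: smooth_at_continuous sF.
  by rewrite -c0; exact/cinv_continuous/cdom_center.
have -> : act u g = cinv (act u g) (F (chart u u, g)).
  by rewrite -c0 chartK//; exact: cdom_center.
apply: cvg_trans cF; apply: near_eq_cvg; apply: filterS FE2 => u' [cu' <-].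
by rewrite chartK.
Qed.

(* [kappa] is the H-component of the trivialization given by [s]. *)
Definition section_through (U : set N) (s : N -> P)
    (kappa : P -> 'M[R]_(1 + m + 1)) u : Prop :=
  [/\ open U /\ U (pr u), forall y, U y -> psmooth_at s y,
      forall v, U (pr v) -> msmooth_at kappa v,
      forall y, U y -> pr (s y) = y &
      [/\ forall v, U (pr v) -> groupH (kappa v) /\ act (s (pr v)) (kappa v) = v,
          s (pr u) = u & kappa u = 1%:M]].

(** A trivialization around [pr u] has a section that meets the fibre of [u] somewhere; translating
    it by [h], the H-component of [u], makes it pass through [u], and multiplying the H-component by
    the inverse of [h] normalizes it there. *)
Lemma section_exists u : exists U s kappa, section_through U s kappa u.
Proof.
have [U [s [ka [Ux [Uo [ss ks] ps sk ks1]]]]] := locally_trivial C (pr u).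
have [Hh hE] := sk u Ux; set h := ka u in Hh hE.
have hu := groupH_unit Hh.
exists U, (fun y => act (s y) h), (fun v => invmx h *m ka v); split.
- by split.
- move=> y Uy; apply: (psmooth_at_comp (f := s) (g := fun v : P => act v h)).
    exact: (ss y Uy).
  exact: act_psmooth_at.
- by move=> v Uv; exact: (msmooth_at_mulmxl _ (ks v Uv)).
- by move=> y Uy; rewrite proj_act// ps.
- split; [|exact: hE|by rewrite mulVmx].
  move=> v Uv; have [Hk kE] := sk v Uv.
  split; first by apply: groupHM => //; exact: groupHV.
  rewrite actM//; last by apply: groupHM => //; exact: groupHV.
  by rewrite mulmxA mulmxV// mul1mx.
Qed.

Lemma near_proj u (A : N -> Prop) :
  (\forall y \near pr u, A y) -> \forall v \near u, A (pr v).
Proof. by move=> HA; exact: ((proj_psmooth_at u).1 _ HA). Qed.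

Lemma near_section U s kappa u (A : P -> Prop) :
  section_through U s kappa u ->
  (\forall v \near u, A v) -> \forall y \near pr u, A (s y).
Proof.
move=> [[_ Ux] ss _ _ [_ su _]] HA; have [cs _] := ss _ Ux.
by move: cs; rewrite /prop_for /continuous_at su; exact.
Qed.

Lemma fiber_act u v : pr u = pr v -> exists2 g, groupH g & v = act u g.
Proof.
move=> uv; have [U [s [ka [[Uo Ux] _ _ _ [sk su _]]]]] := section_exists u.
have [Hk kE] := sk v (eq_ind _ U Ux _ uv).
by exists (ka v) => //; rewrite -{1}kE -uv su.
Qed.

(** Differentiating the preservation of the Lorentzian product and the equation
    [kap *m ell m = ell m] at a point where [kap] is the identity gives the two conditions of
    [lieh_of_skew]. *)
Lemma groupH_curve_lieh k (Q : manifold R k) (kap : Q -> 'M[R]_(1 + m + 1))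
    (q : Q) v :
  msmooth_at kap q -> kap q = 1%:M -> (\forall q' \near q, groupH (kap q')) ->
  lieh (mder kap q v).
Proof.
move=> ks k1 kH.
have kv a : msmooth_at (fun y => kap y *m a) q /\
    mder (fun y => kap y *m a) q v = mder kap q v *m a :> L.
  have ha := msmooth_at_cst a q; split; first exact: (msmooth_at_mulmx ks ha).
  by rewrite (mder_mulmx _ ks ha) mder_cst mulmx0 addr0.
apply: lieh_of_skew => [a b|].
  have [sa <-] := kv a; have [sb <-] := kv b.
  have := mder_lorentz v sa sb; rewrite k1 !mul1mx => <-.
  rewrite (@eq_mder _ _ _ _ _ (fun=> lorentz a b)) ?mder_cst//.
  by apply: filterS kH => y [/lorentz_groupG].
have [_ <-] := kv (ell m).
rewrite (@eq_mder _ _ _ _ _ (fun=> ell m)) ?mder_cst//.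
by apply: filterS kH => y [_].
Qed.

End CartanBundle.

Section CutoffTime.
Context {R : realType}.

(* [fundamental_vector] asks for curves in H defined for all times: composition
   with [phi] makes a curve defined near 0 global and keeps its velocity at 0. *)
Lemma bounded_time (r : R) : 0 < r -> exists phi : R -> R,
  [/\ forall t, smooth_at phi t, forall t, `|phi t| <= r, phi 0 = 0 &
      'D_1 phi 0 = 1].
Proof.
(* The function is t / (1 + t^2 / r^2), and its bound amounts to the nonnegativity of the square of
   |t| - r/2. *)
move=> r0; pose K := (r * r)^-1; have K0 : 0 < K by rewrite invr_gt0 mulr_gt0.
pose q (t : R) := 1 + K * (t * t).
have q0 t : 0 < q t by rewrite ltr_pwDl// mulr_ge0 ?(ltW K0)// -expr2 sqr_ge0.
have sid (t : R) : smooth_at (id : R -> R) t := smooth_at_id t.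
have sq t : smooth_at q t.
  apply: (smooth_atD (smooth_at_cst (1 : R) t)).
  exact: (smooth_atM (smooth_at_cst K t) (smooth_atM (sid t) (sid t))).
have sV t : smooth_at (fun t => (q t)^-1) t.
  by apply: smooth_atV (sq t); rewrite gt_eqF.
exists (fun t => t * (q t)^-1); split.
- by move=> t; exact: (smooth_atM (sid t) (sV t)).
- move=> t; rewrite normrM normfV (gtr0_norm (q0 t)) ler_pdivrMr// /q.
  have E : K * (r * r) = 1 by rewrite mulVf// gt_eqF// mulr_gt0.
  have -> : t * t = `|t| * `|t| by rewrite -normrM ger0_norm// -expr2 sqr_ge0.
  have Kr : K * r * r = 1 by rewrite -mulrA.
  have := normr_ge0 t; move: (`|t|) => x x0.
  rewrite mulrDr mulr1.
  have -> : r * (K * (x * x)) = K * r * x * x by ring.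
  have h : 0 <= K * r by rewrite mulr_ge0// ltW.
  have : 0 <= K * r * ((x - r / 2) * (x - r / 2)).
    by rewrite mulr_ge0// -expr2 sqr_ge0.
  have -> : K * r * ((x - r / 2) * (x - r / 2)) =
     K * r * x * x - (K * r * r) * x + (K * r * r) * (r / 4) by field.
  by rewrite Kr; lra.
- by rewrite mul0r.
- have [_ D] := is_derive_scale (smooth_at_continuous (sid 0))
    (smooth_at_derivable (v := (1 : R)) (sid 0)) (smooth_at_derivable (v := (1 : R)) (sV 0)).
  move: D; rewrite scale0r add0r derive_id /q mulr0 mulr0 addr0 invr1.
  by rewrite scale1r => D; exact: D.
Qed.

Lemma smooth_at_smooth_on {V W : normedModType R} (f : V -> W) (O : set V) :
  (forall y, O y -> smooth_at f y) -> smooth_on O f.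
Proof. by move=> H vs y /H[ O' [_ Oy' Hf]]; exact: Hf. Qed.
End CutoffTime.

(** * Equivariant functions and vertical vectors *)

Section Tractors.
Context {R : realType} {m : nat} {N : manifold R m.+1}.
Variable C : lightlike_cartan_geometry N.
Local Notation P := (tot C).
Local Notation L := 'cV[R]_(1 + m + 1).
Local Notation pr := (@Defs.proj _ _ _ _ _ C).
Implicit Types (u : P) (x : N) (g : 'M[R]_(1 + m + 1)) (F : P -> L).

Definition equivariant F :=
  forall u g, groupH g -> F (act u g) = invmx g *m F u.

(** An equivariant function is recovered near [u] from its values along the section. In this form a
    derivative has a part through [s] and [pr], which sees only the projected vector, and a part
    through [kappa]. *)
Lemma section_factor U s kappa u : section_through U s kappa u ->
  forall F, equivariant F -> \forall v \near u,
    invmx (kappa v) *m F (s (pr v)) = F v.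
Proof.
move=> [[Uo Ux] _ _ _ [sk _ _]] F HF.
have : \forall v \near u, U (pr v).
  by apply: near_proj; apply: open_nbhs_nbhs.
by apply: filterS => v /sk[Hk {3}<-]; rewrite HF.
Qed.

Lemma equivariant_msmooth_at U s kappa u F : section_through U s kappa u ->
  equivariant F -> msmooth_at (fun y => F (s y)) (pr u) -> msmooth_at F u.
Proof.
move=> Hs HF Hsm; have E := section_factor Hs HF.
have [[Uo Ux] ss ks ps [sk su ku]] := Hs.
apply: (eq_msmooth_at E); apply: msmooth_at_mulmx.
  by apply: msmooth_at_invmx; [rewrite ku unitmx1|exact: ks].
exact: (msmooth_at_comp (proj_psmooth_at u) Hsm).
Qed.

Lemma section_msmooth_at (V : normedModType R) U s kappa u (F : P -> V) :
  section_through U s kappa u ->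
  msmooth_at F u -> msmooth_at (fun y => F (s y)) (pr u).
Proof.
move=> [[Uo Ux] ss ks ps [sk su ku]] HF.
by apply: msmooth_at_comp; [exact: ss|rewrite su].
Qed.

Lemma mder_vertical U s kappa u v F : section_through U s kappa u ->
  equivariant F -> msmooth_at F u -> tmap pr u v = 0 ->
  mder F u v = - mder kappa u v *m F u.
Proof.
move=> Hs HF Fs v0; have E := section_factor Hs HF.
have [[Uo Ux] ss ks ps [sk su ku]] := Hs.
have Hk := ks u Ux.
have Hki : msmooth_at (fun v => invmx (kappa v)) u.
  by apply: msmooth_at_invmx Hk; rewrite ku unitmx1.
have HFs := section_msmooth_at Hs Fs.
have HFsp := msmooth_at_comp (proj_psmooth_at u) HFs.
rewrite -(eq_mder v E) (mder_mulmx v Hki HFsp) su.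
rewrite (mder_comp v (proj_psmooth_at u) HFs) v0.
rewrite (linearP0 (mder_linear HFs)) mulmx0 addr0; congr (_ *m _).
(* Differentiated at [u], where [kappa] is the identity, this product gives the derivative of the
   inverse of [kappa] as minus that of [kappa]. *)
have EK : \forall v \near u, 1%:M = invmx (kappa v) *m kappa v.
  have : \forall v \near u, U (pr v).
    by apply: near_proj; apply: open_nbhs_nbhs.
  by apply: filterS => w /sk[/groupH_unit kw _]; rewrite mulVmx.
have := mder_mulmx v Hki Hk; rewrite -(eq_mder v EK) mder_cst ku invmx1.
rewrite mulmx1 mul1mx => /esym/eqP; rewrite addr_eq0 => /eqP ->.
by [].
Qed.

(** The axiom on [omega] and fundamental vectors asks for a curve in H. It is [kappa] along the line
    of direction [v] in the chart at [u], reparametrized by [bounded_time] so as to exist for all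
    times. Its orbit has velocity [v] because every [w] near [u] is [act (s (pr w)) (kappa w)], and
    along a vertical [v] the factor [s (pr w)] has zero derivative. *)
Lemma vertical_fundamental U s kappa u v : section_through U s kappa u ->
  tmap pr u v = 0 -> fundamental_vector (mder kappa u v) u v.
Proof.
move=> Hs v0; have [[Uo Ux] ss ks ps [sk su ku]] := Hs.
have uu := cdom_center u; have Hk : smooth_at (kappa \o cinv u) (chart u u).
  exact: (ks u Ux).
have nearU : \forall w \near u, U (pr w).
  by apply: near_proj; apply: open_nbhs_nbhs.
have [d d0 dP] : exists2 d : R, 0 < d & forall h, `|h| < d ->
    smooth_at (kappa \o cinv u) (h + chart u u) /\
    U (pr (cinv u (h + chart u u))).
  apply/(near_shiftP (chart u u) (fun z =>
    smooth_at (kappa \o cinv u) z /\ U (pr (cinv u z)))).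
  exact: (filterI (smooth_at_near Hk) (near_cinv uu nearU)).
(* With this bound on [phi] the vectors [phi t *: v] have norm at most [d / 2]; the summand 1 covers
   [v = 0]. *)
have r0 : 0 < d / 2 / (`|v| + 1) by rewrite !divr_gt0// ltr_wpDl.
have [phi [sphi bphi phi0 dphi]] := bounded_time r0.
have phiv t : `|phi t *: v| < d.
  rewrite normrZ; have := bphi t; rewrite ler_pdivlMr ?ltr_wpDl// => H.
  have := normr_ge0 (phi t); lra.
pose ga (t : R) := phi t *: v + chart u u.
have sga t : smooth_at ga t.
  apply: (smooth_atD (smooth_atZ (sphi t) (smooth_at_cst v t))).
  exact: smooth_at_cst.
have ga0 : ga 0 = chart u u by rewrite /ga phi0 scale0r add0r.
have dga : 'D_1 ga 0 = v.
  have D1 := smooth_atZ (sphi 0) (smooth_at_cst v 0).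
  rewrite (deriveD (smooth_at_derivable D1)
    (smooth_at_derivable (smooth_at_cst (chart u u) 0))).
  rewrite derive_cst addr0.
  have [_ ->] := is_derive_scale (smooth_at_continuous (sphi 0))
    (smooth_at_derivable (v := (1 : R)) (sphi 0))
    (smooth_at_derivable (v := (1 : R)) (smooth_at_cst v 0)).
  by rewrite derive_cst scaler0 add0r dphi scale1r.
pose c (t : R) := kappa (cinv u (ga t)).
have sc t : smooth_at c t.
  exact: (smooth_at_comp (sga t) (dP _ (phiv t)).1).
have c0 : c 0 = 1%:M by rewrite /c ga0 chartK.
have Hc t : groupH (c t) by exact: (sk _ (dP _ (phiv t)).2).1.
have dc : 'D_1 c 0 = mder kappa u v.
  have Hk0 : smooth_at (kappa \o cinv u) (ga 0) by rewrite ga0.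
  have D := derive_comp (1 : R) (sga 0) Hk0; rewrite dga ga0 in D; exact: D.
exists c; split=> //.
- by apply: smooth_at_smooth_on => t _; exact: sc.
- by rewrite derive1E.
have [F [Fs FE]] := near_action u (@groupH1 R m).
have act1u : act u 1%:M = u by exact: act1.
rewrite act1u in FE.
have scu : smooth_at (fun t => (chart u u, c t)) (0 : R).
  exact: (smooth_at_pair (smooth_at_cst _ _) (sc 0)).
have E1 : \forall t \near (0 : R), F (chart u u, c t) = chart u (act u (c t)).
  have FE' : \forall z \near ((chart u u, c 0)), groupH z.2 ->
    cdom u (act (cinv u z.1) z.2) /\ chart u (act (cinv u z.1) z.2) = F z.
    by rewrite c0.
  have H : \forall t \near (0 : R), groupH (c t) ->
      cdom u (act (cinv u (chart u u)) (c t)) /\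
      chart u (act (cinv u (chart u u)) (c t)) = F (chart u u, c t).
    exact: (smooth_at_continuous scu FE').
  by apply: filterS H => t /(_ (Hc t))[_]; rewrite chartK.
have Fs0 : smooth_at F ((fun t => (chart u u, c t)) (0 : R)) by rewrite c0.
have D1 : derive1 (fun t => chart u (act u (c t))) 0 =
    'D_(0, mder kappa u v) F (chart u u, 1%:M).
  rewrite derive1E -(near_eq_derive (1 : R) E1).
  have D := derive_comp (1 : R) scu Fs0; have {}D := D _ _.
  rewrite (derive_pair (1 : R) (smooth_at_cst _ _) (sc 0)) derive_cst dc c0 in D.
  exact: D.
rewrite D1.
have csm : msmooth_at (chart u) u by exact: msmooth_at_chart.
have csp : msmooth_at (fun y => chart u (s y)) (pr u).
  exact: (section_msmooth_at Hs csm).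
have cspp := msmooth_at_comp (proj_psmooth_at u) csp.
have sfac : smooth_at (fun z => (chart u (s (pr (cinv u z))), kappa (cinv u z)))
    (chart u u).
  exact: (smooth_at_pair cspp Hk).
have fac0 : (fun z => (chart u (s (pr (cinv u z))), kappa (cinv u z)))
    (chart u u) = (chart u u, 1%:M) by rewrite chartK// su ku.
(* The decomposition of a point of P into section and H-component, read in the chart at [u]: the
   action composed with it is the identity, so its derivative along [v] is [v]. *)
have E2 : \forall z \near chart u u,
    (F \o (fun z => (chart u (s (pr (cinv u z))), kappa (cinv u z)))) z = z.
  have FE' := FE; rewrite -fac0 in FE'.
  have H := smooth_at_continuous sfac FE'.
  have H' : \forall z \near chart u u, groupH (kappa (cinv u z)) ->
     cdom u (act (cinv u (chart u (s (pr (cinv u z))))) (kappa (cinv u z))) /\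
     chart u (act (cinv u (chart u (s (pr (cinv u z))))) (kappa (cinv u z))) =
     F (chart u (s (pr (cinv u z))), kappa (cinv u z)).
    exact: H.
  have Hsu : \forall w \near u, cdom u (s (pr w)).
    exact: (near_proj (A := fun y => cdom u (s y)) (near_section Hs (near_cdom uu))).
  have nU : \forall z \near chart u u, U (pr (cinv u z)) /\
      cdom u (s (pr (cinv u z))).
    apply: filterI; first exact: (near_cinv uu nearU).
    exact: (near_cinv uu Hsu).
  have := near_chart_image uu.
  apply: filterS3 H' nU => z Hz [Uz cz] [cdz zE].
  have [Hkz kE] := sk _ Uz.
  by have [_] := Hz Hkz; rewrite chartK// kE zE => /esym.
have D2 := derive_comp v sfac _.
rewrite fac0 in D2; have {}D2 := D2 _ _ _ F Fs.
rewrite -[LHS](derive_id (chart u u) v) -(near_eq_derive v E2) D2.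
have DP : 'D_v (fun z => (chart u (s (pr (cinv u z))), kappa (cinv u z)))
    (chart u u) = (mder (fun w => chart u (s (pr w))) u v, mder kappa u v).
  exact: (derive_pair v cspp Hk).
rewrite DP (mder_comp v (proj_psmooth_at u) csp) v0.
by rewrite (linearP0 (mder_linear csp)).
Qed.

End Tractors.

(** * The tractor connection *)

Section TractorConnection.
Context {R : realType} {m : nat} {N : manifold R m.+1}.
Variable C : lightlike_cartan_geometry N.
Local Notation P := (tot C).
Local Notation TN := 'rV[R]_(m.+1).
Local Notation L := 'cV[R]_(1 + m + 1).
Local Notation pr := (@Defs.proj _ _ _ _ _ C).
Implicit Types (u : P) (x : N) (g : 'M[R]_(1 + m + 1)) (F : P -> L) (w : TN).

Lemma omega_lieg u v : lieg (omega u v).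
Proof. by rewrite -[lieg _]/(@lieg R m (omega u v)) -(omega_image u); exists v. Qed.

Lemma omega_onto u B : lieg B -> exists v, omega u v = B.
Proof.
move=> HB; have : range (omega u) B by rewrite omega_image.
by move=> [v _ <-]; exists v.
Qed.

Lemma tmap_section U s kappa u w : section_through U s kappa u ->
  tmap pr u (tmap s (pr u) w) = w.
Proof.
move=> [[Uo Ux] ss ks ps [sk su ku]].
have Hs := ss _ Ux; have Hp := proj_psmooth_at (s (pr u)).
have := tmap_comp w Hs Hp; rewrite su => <-.
rewrite -[RHS](mder_chart_center (pr u) w) /tmap ps//.
apply: eq_mder; apply: filterS (open_nbhs_nbhs (conj Uo Ux)) => y Uy.
by rewrite /= ps.
Qed.

(** A local section provides a vector over [w], so the set from which [lift] chooses is nonempty. *)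
Lemma liftP u w : tmap pr u (Defs.lift u w) = w.
Proof.
have [U [s [ka Hs]]] := section_exists u.
have H : exists v, tmap pr u v = w by exists (tmap s (pr u) w); exact: tmap_section Hs.
by rewrite /Defs.lift; case: xgetP => [v _ ->|/forallNP H'] //; have [v] := H => /H'.
Qed.

Lemma tmap_pr_linear u : linear (tmap pr u).
Proof. by apply: tmap_linear; exact: proj_psmooth_at. Qed.

Lemma mder_vertical_omega u v F : equivariant F -> msmooth_at F u ->
  tmap pr u v = 0 -> mder F u v + omega u v *m F u = 0.
Proof.
move=> HF Fs v0; have [U [s [ka Hs]]] := section_exists u.
have [[Uo Ux] ss ks ps [sk su ku]] := Hs.
have Hl : lieh (mder ka u v).
  apply: groupH_curve_lieh => //; first exact: ks.
  have : \forall w \near u, U (pr w).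
    by apply: near_proj; apply: open_nbhs_nbhs.
  by apply: filterS => w /sk[].
rewrite (omega_fundamental Hl (vertical_fundamental Hs v0)).
by rewrite (mder_vertical Hs HF Fs v0) mulNmx addNr.
Qed.

(** Any vector over [w] may replace the chosen lift; in particular the images of vectors under the
    tangent map of a local section or of a right translation. *)
Lemma nablaT_lift u v F : equivariant F -> msmooth_at F u ->
  nablaT u (tmap pr u v) F = mder F u v + omega u v *m F u.
Proof.
move=> HF Fs; set w := tmap pr u v.
have v0 : tmap pr u (Defs.lift u w - v) = 0.
  by rewrite (linearPB (tmap_pr_linear u)) liftP subrr.
have := mder_vertical_omega HF Fs v0.
rewrite (linearPB (mder_linear Fs)) (linearPB (omega_linear u)) mulmxBl.
rewrite addrACA -opprD => /eqP; rewrite subr_eq0 => /eqP <-.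
by [].
Qed.

Lemma nablaT_linear u F : equivariant F -> msmooth_at F u ->
  linear (fun w => nablaT u w F).
Proof.
move=> HF Fs k w w'; have [U [s [ka Hs]]] := section_exists u.
rewrite -{1}(liftP u w) -{1}(liftP u w') -(tmap_pr_linear u).
rewrite (nablaT_lift _ HF Fs) (mder_linear Fs) (omega_linear u).
by rewrite mulmxDl -scalemxAl addrACA -scalerDr.
Qed.

Lemma equivariant_act_near F g u : equivariant F -> groupH g ->
  \forall u' \near u, F (act u' g) = invmx g *m F u'.
Proof. by move=> HF Hg; near=> u'; exact: HF. Unshelve. all: by end_near. Qed.

Lemma msmooth_at_fiber F g u : equivariant F -> groupH g ->
  msmooth_at F (act u g) -> msmooth_at F u.
Proof.
move=> HF Hg Fs; have Fsg := msmooth_at_comp (act_psmooth_at u Hg) Fs.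
apply: eq_msmooth_at (msmooth_at_mulmxl g Fsg); near=> u'.
by rewrite HF// mulmxA mulmxV ?groupH_unit// mul1mx.
Unshelve. all: by end_near. Qed.

(** Right translation by [g] sends a lift of [w] at [u] to a lift of [w] at [act u g]. Consequently
    [nablaT] produces equivariant functions and can be iterated. *)
Lemma nablaT_act u w F g : equivariant F -> msmooth_at F (act u g) ->
  groupH g -> nablaT (act u g) w F = invmx g *m nablaT u w F.
Proof.
move=> HF Fs Hg; have Fsu := msmooth_at_fiber HF Hg Fs.
pose r := fun u' : P => act u' g; have Hr : psmooth_at r u := act_psmooth_at u Hg.
set v := Defs.lift u w; pose v' := tmap r u v.
have v'E : tmap pr (act u g) v' = w.
  have Hp : psmooth_at pr (r u) by exact: proj_psmooth_at.
  rewrite /v' -(tmap_comp v Hr Hp) -[RHS](liftP u w).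
  rewrite /tmap /r proj_act//; apply: eq_mder; near=> u'.
  by rewrite /= proj_act.
rewrite -{1}v'E (nablaT_lift _ HF Fs).
have -> : mder F (act u g) v' = invmx g *m mder F u v.
  rewrite -(mder_comp v Hr Fs) -(mder_mulmxl _ v Fsu).
  exact: eq_mder (equivariant_act_near u HF Hg).
rewrite (omega_equivariant u v Hg) HF// /nablaT -/v mulmxDr -!mulmxA.
by rewrite (mulmxA g) mulmxV ?groupH_unit// mul1mx.
Unshelve. all: by end_near. Qed.

Lemma xi_equivariant : equivariant (@xi _ _ _ C).
Proof.
move=> u g /groupHV[_]; rewrite /xi => ->; by [].
Qed.

Lemma xi_smooth u : msmooth_at (@xi _ _ _ C) u.
Proof. exact: msmooth_at_cst. Qed.

Lemma Phi_lift u v : Phi u (tmap pr u v) = omega u v *m ell m.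
Proof.
rewrite /Phi (nablaT_lift _ xi_equivariant (xi_smooth u)).
by rewrite mder_cst add0r.
Qed.

Lemma PhiE u w : Phi u w = lvec (phi u w).1 (phi u w).2 0.
Proof.
rewrite -{1}(liftP u w) Phi_lift (lieg_ell (omega_lieg _ _)).
by [].
Qed.

Lemma Phi_linear u : linear (Phi u).
Proof. exact: (nablaT_linear xi_equivariant (xi_smooth u)). Qed.

Lemma Phi_act u w g : groupH g -> Phi (act u g) w = invmx g *m Phi u w.
Proof. by move=> Hg; apply: nablaT_act => //; [exact: xi_equivariant|exact: xi_smooth]. Qed.

Lemma Phi_onto u a (X : 'cV[R]_m) : exists w, Phi u w = lvec a X 0.
Proof.
have [B HB BE] := lieg_gmodh a X; have [v vE] := omega_onto u HB.
by exists (tmap pr u v); rewrite Phi_lift vE (lieg_ell HB) BE.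
Qed.

(** The values of [Phi u] have last coordinate 0. Dropping it leaves a square matrix, so that
    surjectivity onto the orthogonal of [ell] already makes it invertible. *)
Definition Phi_mx u : 'M[R]_(m.+1) :=
  \matrix_i (usubmx (Phi u (delta_mx 0 i)) : 'cV[R]_(1 + m))^T.

Lemma Phi_mxE u w : w *m Phi_mx u = (usubmx (Phi u w) : 'cV[R]_(1 + m))^T.
Proof.
rewrite {2}(row_sum_delta w) (linearP_sum (Phi_linear u)) !raddf_sum.
rewrite mulmx_sum_row; apply: eq_bigr => i _.
by rewrite rowK (linearPZ (Phi_linear u)); apply/rowP => j; rewrite !mxE.
Qed.

Lemma Phi_mx_unit u : Phi_mx u \in unitmx.
Proof.
rewrite -row_full_unit -sub1mx; apply/row_subP => i; rewrite rowE mulmx1.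
pose r : 'rV[R]_(1 + m) := delta_mx 0 i.
have [w wE] := Phi_onto u (usubmx r^T 0 0) (dsubmx r^T).
apply/submxP; exists w; rewrite Phi_mxE wE /lvec col_mxKu -mx11_scalar vsubmxK.
by rewrite trmxK.
Qed.

Lemma Phi_inj u : injective (Phi u).
Proof.
move=> w w' E; apply: (can_inj (mulmxK (Phi_mx_unit u))).
by rewrite !Phi_mxE E.
Qed.

(** Meaningful as an inverse on the orthogonal of [ell]: the last coordinate of [t] is discarded. *)
Definition Phi_inv u (t : L) : TN := (usubmx t : 'cV[R]_(1 + m))^T *m invmx (Phi_mx u).

Lemma PhiK u w : Phi_inv u (Phi u w) = w.
Proof. by rewrite /Phi_inv -Phi_mxE mulmxK// Phi_mx_unit. Qed.

Lemma Phi_invK u t : lorentz (ell m) t = 0 -> Phi u (Phi_inv u t) = t.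
Proof.
have [a [X [b ->]]] := lvecP t; rewrite ellE lorentz_lvec.
rewrite trmx0 mul0mx mxE mul0r mul1r !addr0 => ->.
by have [w <-] := Phi_onto u a X; rewrite PhiK.
Qed.

Lemma lorentz_ell_Phi u w : lorentz (ell m) (Phi u w) = 0.
Proof.
rewrite PhiE ellE lorentz_lvec.
by rewrite trmx0 mul0mx mxE mul0r mulr0 !addr0.
Qed.

End TractorConnection.

(** * Smoothness along local sections *)

Section SectionSmoothness.
Context {R : realType} {m : nat} {N : manifold R m.+1}.
Variable C : lightlike_cartan_geometry N.
Local Notation P := (tot C).
Local Notation TN := 'rV[R]_(m.+1).
Local Notation L := 'cV[R]_(1 + m + 1).
Local Notation pr := (@Defs.proj _ _ _ _ _ C).
Implicit Types (u : P) (x y : N) (g : 'M[R]_(1 + m + 1)) (F : P -> L) (w : TN).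

Lemma tractor_sectionP F :
  tractor_section F <-> (forall u, msmooth_at F u) /\ equivariant F.
Proof.
split=> -[Fs HF]; split; try exact: HF; first by move=> u; exact: (Fs u).
by move=> u _; exact: Fs.
Qed.

Lemma tmap_section_at U s kappa u y w : section_through U s kappa u -> U y ->
  tmap pr (s y) (tmap s y w) = w.
Proof.
move=> [[Uo _] ss _ ps _] Uy.
have Hs := ss _ Uy; have Hp := proj_psmooth_at (s y).
rewrite -(tmap_comp w Hs Hp) -[RHS](mder_chart_center y w) /tmap ps//.
apply: eq_mder; apply: filterS (open_nbhs_nbhs (conj Uo Uy)) => z Uz.
by rewrite /= ps.
Qed.

Lemma nablaT_section U s kappa u F y w : section_through U s kappa u -> U y ->
  equivariant F -> msmooth_at F (s y) ->
  nablaT (s y) w F =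
    mder (fun z => F (s z)) y w + omega (s y) (tmap s y w) *m F (s y).
Proof.
move=> Hs Uy HF Fs; rewrite -{1}(tmap_section_at w Hs Uy).
rewrite (nablaT_lift _ HF Fs); congr (_ + _).
by have [_ ss _ _ _] := Hs; rewrite (mder_comp w (ss _ Uy) Fs).
Qed.

(** Smoothness of [omega] is stated for vector fields on open sets of P, while Ts(W) lives only on
    the image of the section. It is expanded in the coordinate frame of a chart of P, whose fields
    are defined on an open set. *)
Lemma omega_section_smooth U s kappa u (W : vfield N) :
  section_through U s kappa u -> vsmooth_at W (pr u) ->
  msmooth_at (fun y => omega (s y) (tmap s y (W y))) (pr u).
Proof.
move=> Hs HW; have [[Uo Ux] ss ks ps [sk su ku]] := Hs.
have uu := cdom_center u; have cs := section_msmooth_at Hs (msmooth_at_chart uu).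
pose e i : 'rV[R]_(tot_dim C) := delta_mx 0 i.
have omc i : msmooth_at (fun u' => omega u' (cvec u u' (e i))) u.
  apply: (@omega_smooth _ _ _ C (cdom u) (fun u' => cvec u u' (e i))) => //.
    exact: cdom_open.
  apply/smooth_vfield_onP => u' uu'.
  exact: (vsmooth_at_cvec uu' (msmooth_at_cst _ _)).
apply: (@eq_msmooth_at _ _ _ _ (fun y => \sum_i
    (mder (fun z => chart u (s z)) y (W y)) 0 i *:
    omega (s y) (cvec u (s y) (e i)))).
  have nU : \forall y \near pr u, U y by exact: open_nbhs_nbhs.
  have nc := near_section Hs (near_cdom uu).
  apply: filterS2 nU nc => y Uy cy.
  rewrite [in RHS](cvec_frame (tmap s y (W y)) cy).
  rewrite (linearP_sum (omega_linear (s y))); apply: eq_bigr => i _.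
  rewrite (linearPZ (omega_linear (s y))).
  by rewrite (mder_comp (W y) (ss _ Uy) (msmooth_at_chart cy)).
apply: msmooth_at_sum => i; apply: msmooth_atZ; last first.
  exact: (section_msmooth_at Hs (omc i)).
exact: ((msmooth_mxP _ _).1 (msmooth_at_along cs HW) 0 i).
Qed.

Lemma nablaT_section_smooth U s kappa u F (W : vfield N) :
  section_through U s kappa u -> tractor_section F -> vsmooth_at W (pr u) ->
  msmooth_at (fun y => nablaT (s y) (W y) F) (pr u).
Proof.
move=> Hs /tractor_sectionP[Fs HF] HW; have [[Uo Ux] ss ks ps [sk su ku]] := Hs.
have Fss := section_msmooth_at Hs (Fs u).
apply: (eq_msmooth_at _ (msmooth_atD (msmooth_at_along Fss HW)
  (msmooth_at_mulmx (omega_section_smooth Hs HW) Fss))).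
have nU : \forall y \near pr u, U y by exact: open_nbhs_nbhs.
by apply: filterS nU => y Uy; rewrite (nablaT_section _ Hs Uy HF (Fs _)).
Qed.

Lemma nablaT_tractor F (W : vfield N) : tractor_section F -> smooth_vfield W ->
  tractor_section (fun u => nablaT u (W (pr u)) F).
Proof.
move=> HF /smooth_vfieldP HW; have /tractor_sectionP[Fs Fe] := HF.
apply/tractor_sectionP.
have He : equivariant (fun u => nablaT u (W (pr u)) F).
  by move=> u g Hg; rewrite proj_act//; apply: nablaT_act.
split; last exact: He.
move=> u; have [U [s [ka Hs]]] := section_exists u.
apply: (equivariant_msmooth_at Hs He).
have [[Uo Ux] ss ks ps [sk su ku]] := Hs.
apply: eq_msmooth_at (nablaT_section_smooth Hs HF (HW _)).
have nU : \forall y \near pr u, U y by exact: open_nbhs_nbhs.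
by apply: filterS nU => y Uy; rewrite ps.
Qed.

Lemma xi_tractor : tractor_section (@xi _ _ _ C).
Proof.
by apply/tractor_sectionP; split; [exact: xi_smooth|exact: xi_equivariant].
Qed.

Lemma Phi_tractor (W : vfield N) : smooth_vfield W ->
  tractor_section (fun u : P => Phi u (W (pr u))).
Proof. by move=> HW; exact: nablaT_tractor xi_tractor HW. Qed.

Lemma Phi_section_smooth U s kappa u (W : vfield N) :
  section_through U s kappa u -> vsmooth_at W (pr u) ->
  msmooth_at (fun y => Phi (s y) (W y)) (pr u).
Proof. by move=> Hs HW; exact: nablaT_section_smooth Hs xi_tractor HW. Qed.

(** In the coordinate frame of the chart at [pr u], applying [Phi] along the section is
    multiplication by a smooth invertible matrix [B]; its inverse recovers the components of [X].
    Every smoothness claim about a constructed field goes through this. *)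
Lemma vsmooth_of_Phi U s kappa u (X : vfield N) :
  section_through U s kappa u ->
  msmooth_at (fun y => Phi (s y) (X y)) (pr u) -> vsmooth_at X (pr u).
Proof.
move=> Hs HX; set x := pr u in Hs HX *; have xx := cdom_center x.
pose B y : 'M[R]_(m.+1) :=
  \matrix_i (usubmx (Phi (s y) (cvec x y (delta_mx 0 i))) : 'cV[R]_(1 + m))^T.
have BE y w : cdom x y ->
    w *m B y = (usubmx (Phi (s y) (cvec x y w)) : 'cV[R]_(1 + m))^T.
  move=> cy; rewrite {2}(row_sum_delta w) (linearP_sum (cvec_linear cy)).
  rewrite (linearP_sum (Phi_linear (s y))) !raddf_sum.
  rewrite mulmx_sum_row; apply: eq_bigr => i _.
  rewrite rowK (linearPZ (cvec_linear cy)) (linearPZ (Phi_linear (s y))).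
  by apply/rowP => j; rewrite !mxE.
have Bu y : cdom x y -> B y \in unitmx.
  move=> cy; pose K : 'M[R]_(m.+1) := \matrix_j mder (chart x) y
    (Phi_inv (s y) (col_mx (delta_mx j 0 : 'cV[R]_(1 + m)) 0)).
  have KB : K *m B y = 1%:M.
    apply/row_matrixP => j; rewrite row_mul rowK BE// cvecK// Phi_invK.
      by rewrite col_mxKu rowE mulmx1 trmx_delta.
    rewrite ellE; have -> : col_mx (delta_mx j 0 : 'cV[R]_(1 + m)) 0 =
      lvec (usubmx (delta_mx j 0 : 'cV[R]_(1 + m)) 0 0)
        (dsubmx (delta_mx j 0 : 'cV[R]_(1 + m))) 0.
      by rewrite /lvec raddf0 -mx11_scalar vsubmxK.
    by rewrite lorentz_lvec trmx0 mul0mx [X in _ + X]mxE mul0r mulr0 !addr0.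
  by have [] := mulmx1_unit KB.
have us (f : N -> L) : msmooth_at f x ->
    msmooth_at (fun y => (usubmx (f y) : 'cV[R]_(1 + m))^T) x.
  move=> Hf; apply/msmooth_mxP => i j.
  have := (msmooth_mxP _ _).1 Hf (lshift 1 j) i; apply: eq_msmooth_at.
  by near=> y; rewrite !mxE.
have Bs : msmooth_at B x.
  apply/msmooth_mxP => i j.
  have Hi := us _ (Phi_section_smooth Hs
    (vsmooth_at_cvec xx (msmooth_at_cst (delta_mx 0 i) x))).
  have := (msmooth_mxP _ _).1 Hi 0 j; apply: eq_msmooth_at.
  by near=> y; rewrite !mxE.
apply: (eq_msmooth_at _ (msmooth_at_mulmx (us _ HX)
  (msmooth_at_invmx (Bu x xx) Bs))).
apply: filterS (near_cdom xx) => y cy.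
by rewrite -{1}(cvecK (X y) cy) -BE// mulmxK// Bu.
Unshelve. all: by end_near. Qed.

End SectionSmoothness.

(** * The lightlike structure *)

Section LightlikeStructure.
Context {R : realType} {m : nat} {N : manifold R m.+1}.
Variable C : lightlike_cartan_geometry N.
Local Notation P := (tot C).
Local Notation TN := 'rV[R]_(m.+1).
Local Notation L := 'cV[R]_(1 + m + 1).
Local Notation pr := (@Defs.proj _ _ _ _ _ C).
Local Notation Z := (Z_omega C).
Local Notation h := (h_omega C).
Implicit Types (u : P) (x y : N) (g : 'M[R]_(1 + m + 1)) (F : P -> L) (v w : TN).

Lemma qform_Phi u v w : qform (phi u v) (phi u w) = lorentz (Phi u v) (Phi u w).
Proof. by rewrite !PhiE lorentz_lvec mulr0 mul0r !add0r. Qed.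

(** Two points of a fibre differ by an element of H, which changes [Phi] by an isometry; so the
    specification of [h_omega] has a solution, and any point of the fibre determines it. *)
Lemma h_omegaE u v w : h (pr u) v w = lorentz (Phi u v) (Phi u w).
Proof.
apply: xget_unique => [u' /esym/fiber_act[g Hg ->]|r Hr].
  by rewrite qform_Phi !Phi_act// lorentz_groupG//; case: (groupHV Hg).
by rewrite -(Hr u) ?qform_Phi.
Qed.

Lemma groupHV_ell g : groupH g -> invmx g *m ell m = ell m :> L.
Proof. by move=> /groupHV[]. Qed.

Lemma phi_unit u w : phi u w = (1, 0) <-> Phi u w = ell m.
Proof.
rewrite PhiE ellE; case: (phi u w) => a X /=; split=> [[-> ->]//|].
by move=> /lvec_inj[-> -> _].
Qed.

(** Independence of the point of the fibre comes from H fixing [ell], uniqueness from the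
    injectivity of [Phi u]. *)
Lemma Phi_Z u : Phi u (Z (pr u)) = ell m.
Proof.
have lt0 : lorentz (ell m) (ell m) = 0 :> R.
  by rewrite ellE lorentz_lvec trmx0 mul0mx [X in _ + X]mxE !(mulr0, mul0r, addr0).
apply/phi_unit; suff -> : Z (pr u) = Phi_inv u (ell m).
  by apply/phi_unit; rewrite Phi_invK.
apply: xget_unique => [u' /esym/fiber_act[g Hg ->]|z Hz].
  by apply/phi_unit; rewrite Phi_act// Phi_invK// groupHV_ell.
by apply: (@Phi_inj _ _ _ _ u); rewrite Phi_invK//; apply/phi_unit/Hz.
Qed.

Lemma lorentz_ell_ell : lorentz (ell m) (ell m) = 0 :> R.
Proof.
by rewrite ellE lorentz_lvec trmx0 mul0mx [X in _ + X]mxE !(mulr0, mul0r, addr0).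
Qed.

Lemma fiber_exists x : exists u, pr u = x.
Proof. exact: proj_surj. Qed.

Lemma h_omega_ge0 x v : 0 <= h x v v.
Proof.
have [u <-] := fiber_exists x; rewrite h_omegaE PhiE lorentz_lvec.
rewrite mulr0 mul0r !add0r mxE; apply: sumr_ge0 => i _.
by rewrite mxE -expr2 sqr_ge0.
Qed.

Lemma h_omega_eq0 x v : h x v v = 0 -> exists a, v = a *: Z x.
Proof.
have [u <-] := fiber_exists x; rewrite h_omegaE PhiE lorentz_lvec.
rewrite mulr0 mul0r !add0r mxE => /eqP; rewrite psumr_eq0; last first.
  by move=> i _; rewrite mxE -expr2 sqr_ge0.
move=> /allP H; exists (phi u v).1; apply: (@Phi_inj _ _ _ _ u).
rewrite (linearPZ (Phi_linear u)) Phi_Z PhiE ellE lvecZ mulr1 scaler0 mulr0.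
congr lvec; apply/colP => i; have := H i (mem_index_enum i).
by rewrite !mxE /= mulf_eq0 orbb => /eqP.
Qed.

Lemma h_omega_Z x w : h x (Z x) w = 0.
Proof.
by have [u <-] := fiber_exists x; rewrite h_omegaE Phi_Z lorentz_ell_Phi.
Qed.

Lemma Z_omega_neq0 x : Z x != 0.
Proof.
have [u <-] := fiber_exists x; apply/eqP => Z0; have := Phi_Z u.
rewrite Z0 (linearP0 (Phi_linear u)) ellE => E.
have : (0 : L) = lvec 0 0 0 by rewrite /lvec !raddf0 !col_mx0.
by rewrite E => /lvec_inj[/eqP]; rewrite oner_eq0.
Qed.

Lemma h_omegaC x v w : h x v w = h x w v.
Proof. by have [u <-] := fiber_exists x; rewrite !h_omegaE lorentzC. Qed.

Lemma h_omega_linear x v : scalar (h x v).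
Proof.
have [u <-] := fiber_exists x => k w w'; rewrite !h_omegaE (Phi_linear u).
exact: lorentz_linearr.
Qed.

Lemma radical_h_omega x : radical h x = line (Z x).
Proof.
apply/seteqP; split=> [v|_ [a ->] w]; first by move=> /(_ v)/h_omega_eq0.
have := h_omega_linear x w a (Z x) 0.
rewrite addr0 h_omegaC => ->; rewrite h_omegaC h_omega_Z mulr0 add0r.
have := h_omega_linear x w (-1) (Z x) (Z x).
by rewrite scaleN1r addNr (h_omegaC x w (Z x)) h_omega_Z mulr0 add0r.
Qed.

Lemma Z_omega_smooth : smooth_vfield Z.
Proof.
apply/smooth_vfieldP => x; have [u <-] := fiber_exists x.
have [U [s [ka Hs]]] := section_exists u; apply: (vsmooth_of_Phi Hs).
have [[Uo Ux] ss ks ps _] := Hs.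
apply: eq_msmooth_at (msmooth_at_cst (ell m) (pr u)).
have nU : \forall y \near pr u, U y by exact: open_nbhs_nbhs.
by apply: filterS nU => y Uy; rewrite -{2}(ps y Uy) Phi_Z.
Qed.

Lemma h_omega_smooth (X Y : vfield N) x : vsmooth_at X x -> vsmooth_at Y x ->
  msmooth_at (fun y => h y (X y) (Y y)) x.
Proof.
have [u <-] := fiber_exists x => HX HY.
have [U [s [ka Hs]]] := section_exists u; have [[Uo Ux] ss ks ps _] := Hs.
apply: eq_msmooth_at (msmooth_at_lorentz (Phi_section_smooth Hs HX)
  (Phi_section_smooth Hs HY)).
have nU : \forall y \near pr u, U y by exact: open_nbhs_nbhs.
by apply: filterS nU => y Uy; have := h_omegaE (s y) (X y) (Y y); rewrite ps// => ->.
Qed.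

Lemma h_omega_lightlike : lightlike_metric h.
Proof.
split; [split| |].
- exact: h_omega_linear.
- exact: h_omegaC.
- move=> U X Y Uo /smooth_vfield_onP HX /smooth_vfield_onP HY x Ux.
  exact: (h_omega_smooth (HX x Ux) (HY x Ux)).
- exact: h_omega_ge0.
- by move=> x; exists (Z x); [exact: Z_omega_neq0|exact: radical_h_omega].
Qed.

End LightlikeStructure.

(** * The lightlike section attached to a one-form *)

Section NullSection.
Context {R : realType} {m : nat} {N : manifold R m.+1}.
Variable C : lightlike_cartan_geometry N.
Local Notation P := (tot C).
Local Notation TN := 'rV[R]_(m.+1).
Local Notation L := 'cV[R]_(1 + m + 1).
Local Notation pr := (@Defs.proj _ _ _ _ _ C).
Local Notation Z := (Z_omega C).
Local Notation h := (h_omega C).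
Variables (tau : N -> TN -> R) (tauS : in_S C tau).
Implicit Types (u : P) (x y : N) (g : 'M[R]_(1 + m + 1)) (F : P -> L) (v w : TN).

Lemma tau_linear x : scalar (tau x). Proof. by case: tauS => [[]]. Qed.
Lemma tauD x v w : tau x (v + w) = tau x v + tau x w.
Proof. exact: (linearPD (tau_linear x : linear (_ : _ -> R^o))). Qed.
Lemma tau_scale x k v : tau x (k *: v) = k * tau x v.
Proof. exact: (linearPZ (tau_linear x : linear (_ : _ -> R^o))). Qed.
Lemma tauB x v w : tau x (v - w) = tau x v - tau x w.
Proof. exact: (linearPB (tau_linear x : linear (_ : _ -> R^o))). Qed.
Lemma tau_Z x : tau x (Z x) = 1. Proof. by case: tauS. Qed.

Lemma tau_smooth (X : vfield N) x : vsmooth_at X x ->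
  msmooth_at (fun y => tau y (X y)) x.
Proof.
move=> /near_vsmooth_at; rewrite -nbhs_nearE nbhsE => -[U [Uo Ux] UX].
case: tauS => -[_ H] _; apply: (H U X Uo) Ux.
by apply/smooth_vfield_onP.
Qed.

(** [en i] is the basis vector e_i. The conditions on eta leave one candidate [eta0]: its last
    coordinate is 1 by the pairing with [ell], its middle coordinates [B] are the values of tau on
    the vectors that [Phi u] sends to e_i, and nullity forces minus half the square of [B] in the
    first. *)
Let en i : L := lvec 0 (delta_mx i 0) 0.
Let B u : 'cV[R]_m := \col_i tau (pr u) (Phi_inv u (en i)).
Let eta0 u : L := lvec (- (2^-1 * ((B u)^T *m B u) 0 0)) (B u) 1.

Let eta0_Phi u w : lorentz (Phi u w) (eta0 u) = tau (pr u) w.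
Proof.
have enE i : Phi u (Phi_inv u (en i)) = en i.
  apply: Phi_invK; rewrite ellE lorentz_lvec trmx0 mul0mx [X in _ + X]mxE.
  by rewrite !(mulr0, mul0r, addr0).
set a := (phi u w).1; set X := (phi u w).2.
have wE : w = a *: Z (pr u) + \sum_i X i 0 *: Phi_inv u (en i).
  apply: (@Phi_inj _ _ _ _ u); rewrite (linearPD (Phi_linear u)).
  rewrite (linearPZ (Phi_linear u)) Phi_Z (linearP_sum (Phi_linear u)).
  under eq_bigr do rewrite (linearPZ (Phi_linear u)) enE lvecZ !mulr0.
  have -> : \sum_i lvec 0 (X i 0 *: delta_mx i 0) 0 = lvec 0 X 0.
    rewrite [in RHS](matrix_sum_delta X) -!(big_mkcond xpredT) /=.
    under [in RHS]eq_bigr do rewrite big_ord1.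
    elim/big_rec2: _ => [|i y1 y2 _ ->]; first by rewrite /lvec !raddf0 !col_mx0.
    by rewrite lvecD !addr0.
  by rewrite ellE lvecZ lvecD mulr1 scaler0 mulr0 !(addr0, add0r) PhiE.
rewrite [in RHS]wE PhiE -/a -/X lorentz_lvec mulr1 mul0r addr0 tauD tau_scale tau_Z mulr1.
congr (_ + _).
have tl : linear (tau (pr u) : _ -> R^o) := tau_linear (pr u).
rewrite (linearP_sum tl) mxE; apply: eq_bigr => i _.
by rewrite (linearPZ tl) !mxE.
Qed.

Let eta0_null u : lorentz (eta0 u) (eta0 u) = 0.
Proof. by rewrite lorentz_lvec; move: ((_ *m _) 0 0) => k; field. Qed.

Let eta0_ell u : lorentz (ell m) (eta0 u) = 1.
Proof.
by rewrite ellE lorentz_lvec trmx0 mul0mx [X in _ + X]mxE !(mulr1, mul0r, addr0).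
Qed.

(** The difference is orthogonal to the orthogonal of [ell], hence a multiple [a] of [ell]; since
    [n'] is null and pairs to 1 with [ell], the square of [n] is 2a. *)
Lemma null_unique u (n n' : L) :
  (forall w, lorentz (Phi u w) n = lorentz (Phi u w) n') ->
  lorentz (ell m) n' = 1 -> lorentz n n = 0 -> lorentz n' n' = 0 -> n = n'.
Proof.
move=> H en1 n0 n0'; pose d := n - n'.
have nE : n = n' + d by rewrite /d addrC subrK.
have Hd w : lorentz (Phi u w) d = 0 by rewrite lorentzBr H subrr.
have [a [x [b dE]]] := lvecP d.
have b0 : b = 0.
  have [w wE] := Phi_onto u 1 0; have := Hd w.
  by rewrite wE dE lorentz_lvec trmx0 mul0mx [X in _ + X]mxE mul1r mul0r !addr0.
have x0 : x = 0.
  apply/trmx_inj/matrixP => i j; rewrite trmx0 [RHS]mxE ord1.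
  have [w wE] := Phi_onto u 0 (delta_mx j 0); have := Hd w.
  rewrite wE dE lorentz_lvec !mul0r !add0r trmx_delta -rowE !mxE.
  by [].
have dE' : d = a *: ell m.
  by rewrite dE b0 x0 ellE lvecZ mulr1 scaler0 mulr0.
have a0 : a = 0.
  move: n0; rewrite nE dE' lorentzDl !lorentzDr !lorentzZl !lorentzZr.
  rewrite lorentz_ell_ell n0' en1 (lorentzC n') en1; lra.
by rewrite nE dE' a0 scale0r addr0.
Qed.

(** No computation with the coordinates: both sides are null and have the same products with the
    values of [Phi] at [act u g]. *)
Let eta0_act u g : groupH g -> eta0 (act u g) = invmx g *m eta0 u.
Proof.
move=> Hg; have HV := groupHV Hg; have [GV _] := HV.
apply: (@null_unique (act u g)) => [w|||].
- by rewrite eta0_Phi Phi_act// lorentz_groupG// eta0_Phi proj_act.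
- by rewrite -(groupHV_ell Hg) lorentz_groupG.
- exact: eta0_null.
- by rewrite lorentz_groupG.
Qed.

Let eta0_smooth u : msmooth_at eta0 u.
Proof.
have [U [s [ka Hs]]] := section_exists u; have [[Uo Ux] ss ks ps _] := Hs.
apply: (equivariant_msmooth_at Hs eta0_act).
have Bs i : msmooth_at (fun y => tau y (Phi_inv (s y) (en i))) (pr u).
  apply: (tau_smooth (X := fun y => Phi_inv (s y) (en i))).
  apply: (vsmooth_of_Phi Hs); apply: eq_msmooth_at (msmooth_at_cst (en i) _).
  near=> y; rewrite Phi_invK// ellE lorentz_lvec trmx0 mul0mx [X in _ + X]mxE.
  by rewrite !(mulr0, mul0r, addr0).
pose b y i := tau y (Phi_inv (s y) (en i)).
apply: (@eq_msmooth_at _ _ _ _ (fun y =>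
    - (2^-1 * \sum_i b y i * b y i) *: ell m + (\sum_i b y i *: en i + enn m))).
  have nU : \forall y \near pr u, U y by exact: open_nbhs_nbhs.
  apply: filterS nU => y Uy.
  have -> : \sum_i b y i *: en i = lvec 0 (B (s y)) 0.
    rewrite [in RHS](matrix_sum_delta (B (s y))).
    under [in RHS]eq_bigr do rewrite big_ord1.
    elim/big_rec2: _ => [|i y1 y2 _ ->]; first by rewrite /lvec !raddf0 !col_mx0.
    by rewrite lvecZ lvecD !mulr0 !addr0 mxE ps.
  rewrite ellE ennE lvecZ !lvecD scaler0 mulr0 mulr1 !(addr0, add0r) /eta0.
  congr lvec; congr (- (_ * _)); rewrite mxE; apply: eq_bigr => i _.
  by rewrite !mxE ps.
apply: msmooth_atD; last first.
  apply: (@msmooth_atD _ _ _ _ (fun y => \sum_i b y i *: en i) (fun=> enn m)).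
    apply: msmooth_at_sum => i; apply: msmooth_atZ; first exact: Bs.
    exact: msmooth_at_cst.
  exact: msmooth_at_cst.
apply: (@msmooth_atZ _ _ _ _ (fun y => - (2^-1 * \sum_i b y i * b y i)) (fun=> ell m)).
  apply: (@msmooth_atN _ _ _ R^o).
  apply: (@msmooth_atM _ _ _ (fun=> 2^-1)); first exact: msmooth_at_cst.
  apply: (@msmooth_at_sum _ _ _ R^o) => i.
  by apply: msmooth_atM; exact: Bs.
exact: msmooth_at_cst.
Unshelve. all: by end_near. Qed.

Local Notation eta_tau := (@Defs.eta _ _ _ C tau).

Let eta0E : eta_tau = eta0.
Proof.
have H0 : [/\ tractor_section eta0, forall u, eta0 u != 0 /\
    lorentz (eta0 u) (eta0 u) = 0, forall u, lorentz (@xi _ _ _ C u) (eta0 u) = 1 &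
    forall u w, tau (pr u) w = 0 -> lorentz (Phi u w) (eta0 u) = 0].
  split.
  - by apply/tractor_sectionP; split; [exact: eta0_smooth|exact: eta0_act].
  - move=> u; split; last exact: eta0_null.
    apply/eqP => e0; have := eta0_ell u; rewrite e0 lorentz0r => /eqP.
    by rewrite eq_sym oner_eq0.
  - exact: eta0_ell.
  - by move=> u w; rewrite eta0_Phi.
apply: xget_unique => // F [_ Fn F1 Fp]; apply/funext => u.
apply: (@null_unique u) => [w|||]; [|exact: eta0_ell|exact: (Fn u).2|exact: eta0_null].
(* The condition on [F] concerns the kernel of tau; splitting off the multiple of [Z], where [F]
   pairs to 1, gives its product with every [Phi u w]. *)
have wE : w = (w - tau (pr u) w *: Z (pr u)) + tau (pr u) w *: Z (pr u).
  by rewrite subrK.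
have w0 : tau (pr u) (w - tau (pr u) w *: Z (pr u)) = 0.
  by rewrite tauB tau_scale tau_Z mulr1 subrr.
rewrite eta0_Phi {1}wE (linearPD (Phi_linear u)) lorentzDl Fp// add0r.
by rewrite (linearPZ (Phi_linear u)) Phi_Z lorentzZl F1 mulr1.
Qed.

Lemma eta_Phi u w : lorentz (Phi u w) (eta_tau u) = tau (pr u) w.
Proof. by rewrite eta0E eta0_Phi. Qed.
Lemma eta_null u : lorentz (eta_tau u) (eta_tau u) = 0.
Proof. by rewrite eta0E eta0_null. Qed.
Lemma eta_ell u : lorentz (ell m) (eta_tau u) = 1.
Proof. by rewrite eta0E eta0_ell. Qed.
Lemma eta_tractor : tractor_section eta_tau.
Proof.
rewrite eta0E; apply/tractor_sectionP; split; first exact: eta0_smooth.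
exact: eta0_act.
Qed.

End NullSection.

(** * The Galilean connection of a one-form *)

Section NablaRules.
Context {R : realType} {m : nat} {N : manifold R m.+1}.
Variable C : lightlike_cartan_geometry N.
Local Notation P := (tot C).
Local Notation TN := 'rV[R]_(m.+1).
Local Notation L := 'cV[R]_(1 + m + 1).
Local Notation pr := (@Defs.proj _ _ _ _ _ C).
Implicit Types (u : P) (x y : N) (F G : P -> L) (v w : TN).

Lemma nablaT_add u w F G : msmooth_at F u -> msmooth_at G u ->
  nablaT u w (fun u' => F u' + G u') = nablaT u w F + nablaT u w G.
Proof. by move=> HF HG; rewrite /nablaT mderD// mulmxDr addrACA. Qed.

Lemma nablaT_scale u w (f : N -> R) F : msmooth_at f (pr u) -> msmooth_at F u ->
  nablaT u w (fun u' => f (pr u') *: F u') =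
    mder f (pr u) w *: F u + f (pr u) *: nablaT u w F.
Proof.
move=> Hf HF; have Hp := proj_psmooth_at u.
rewrite /nablaT (mderZ _ (msmooth_at_comp Hp Hf) HF) (mder_comp _ Hp Hf) liftP.
by rewrite -scalemxAr scalerDr addrA.
Qed.

Lemma tractor_add F G : tractor_section F -> tractor_section G ->
  tractor_section (fun u => F u + G u).
Proof.
move=> /tractor_sectionP[Fs HF] /tractor_sectionP[Gs HG].
apply/tractor_sectionP; split; first by move=> u; exact: msmooth_atD.
by move=> u g Hg; rewrite HF// HG// mulmxDr.
Qed.

Lemma tractor_scale (f : N -> R) F : (forall x, msmooth_at f x) ->
  tractor_section F -> tractor_section (fun u => f (pr u) *: F u).
Proof.
move=> Hf /tractor_sectionP[Fs HF]; apply/tractor_sectionP; split.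
  move=> u; apply: msmooth_atZ (Fs u).
  exact: (msmooth_at_comp (proj_psmooth_at u) (Hf _)).
by move=> u g Hg; rewrite HF// proj_act// scalemxAr.
Qed.

Lemma tractor_opp F : tractor_section F -> tractor_section (fun u => - F u).
Proof.
move=> HF; have := tractor_scale (fun x => msmooth_at_cst (-1 : R) x) HF.
by under eq_fun do rewrite scaleN1r.
Qed.

Lemma nablaT_opp u w F : msmooth_at F u ->
  nablaT u w (fun u' => - F u') = - nablaT u w F.
Proof. by move=> HF; rewrite /nablaT mderN// mulmxN opprD. Qed.

Lemma nablaT_metric U s kappa u w F G : section_through U s kappa u ->
  tractor_section F -> tractor_section G ->
  mder (fun y => lorentz (F (s y)) (G (s y))) (pr u) w =
    lorentz (nablaT u w F) (G u) + lorentz (F u) (nablaT u w G).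
Proof.
move=> Hs /tractor_sectionP[Fs HF] /tractor_sectionP[Gs HG].
have [[Uo Ux] ss ks ps [sk su ku]] := Hs.
rewrite (mder_lorentz _ (section_msmooth_at Hs (Fs u))
  (section_msmooth_at Hs (Gs u))).
have EF := nablaT_section w Hs Ux HF (Fs _).
have EG := nablaT_section w Hs Ux HG (Gs _).
rewrite !su in EF EG *; rewrite EF EG lorentzDl lorentzDr.
have := lieg_skew (F u) (G u) (omega_lieg u (tmap s (pr u) w)).
move: (lorentz (_ *m _) _) (lorentz _ (_ *m _)) => a b ab.
by rewrite addrACA ab addr0.
Qed.

Lemma nablaT_metric_cst u w F G (k : R) :
  tractor_section F -> tractor_section G ->
  (forall u, lorentz (F u) (G u) = k) ->
  lorentz (nablaT u w F) (G u) + lorentz (F u) (nablaT u w G) = 0.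
Proof.
move=> HF HG H; have [U [s [ka Hs]]] := section_exists u.
rewrite -(nablaT_metric w Hs HF HG).
have -> : (fun y => lorentz (F (s y)) (G (s y))) = (fun=> k).
  by apply/funext => y.
exact: mder_cst.
Qed.

End NablaRules.

Section Projection.
Context {R : realType} {m : nat} {N : manifold R m.+1}.
Variable C : lightlike_cartan_geometry N.
Local Notation P := (tot C).
Local Notation TN := 'rV[R]_(m.+1).
Local Notation L := 'cV[R]_(1 + m + 1).
Local Notation pr := (@Defs.proj _ _ _ _ _ C).
Local Notation Z := (Z_omega C).
Local Notation h := (h_omega C).
Variables (tau : N -> TN -> R) (tauS : in_S C tau).
Local Notation eta := (@Defs.eta _ _ _ C tau).
Implicit Types (u : P) (x y : N) (g : 'M[R]_(1 + m + 1)) (F : P -> L) (v w : TN).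

(* The component of a tractor in Phi(An(tau)). *)
Definition an u (t : L) : L :=
  t - lorentz t (eta u) *: ell m - lorentz (ell m) t *: eta u.

Lemma an_linear u : linear (an u).
Proof.
move=> k a b; rewrite /an lorentzDl lorentzZl lorentzDr lorentzZr.
by lmod_ring_over R.
Qed.

Lemma an_ell u : an u (ell m) = 0.
Proof.
by rewrite /an (eta_ell tauS) lorentz_ell_ell scale1r scale0r subrr subr0.
Qed.

Lemma an_eta u : an u (eta u) = 0.
Proof.
by rewrite /an (eta_null tauS) (eta_ell tauS) scale1r scale0r subr0 subrr.
Qed.

Lemma an_Phi u w : an u (Phi u w) = Phi u (P_tau C tau (pr u) w).
Proof.
rewrite /an (eta_Phi tauS) lorentz_ell_Phi scale0r subr0 /P_tau.
by rewrite (linearPB (Phi_linear u)) (linearPZ (Phi_linear u)) Phi_Z.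
Qed.

Lemma lorentz_an_eta u t : lorentz (an u t) (eta u) = 0.
Proof.
rewrite /an !lorentzBl !lorentzZl (eta_ell tauS) (eta_null tauS) mulr1 mulr0.
by rewrite subr0 subrr.
Qed.

Lemma lorentz_ell_an u t : lorentz (ell m) (an u t) = 0.
Proof.
rewrite /an !lorentzBr !lorentzZr (eta_ell tauS) lorentz_ell_ell mulr1 mulr0.
by rewrite subr0 subrr.
Qed.

(** Pairing a decomposition with [eta] and with [ell] forces its coefficients, so the remaining
    component can only be [an u (F u)]; equivariance makes this choice valid at all points of the
    fibre. *)
Lemma An_partE F u : equivariant F -> Phi u (An_part tau F (pr u)) = an u (F u).
Proof.
move=> HF; have /tractor_sectionP[_ He] := eta_tractor tauS.
suff -> : An_part tau F (pr u) = Phi_inv u (an u (F u)).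
  by rewrite Phi_invK// lorentz_ell_an.
have vE : Phi u (Phi_inv u (an u (F u))) = an u (F u).
  by rewrite Phi_invK// lorentz_ell_an.
apply: xget_unique.
  split; first by rewrite -(eta_Phi tauS) vE lorentz_an_eta.
  exists (lorentz (F u) (eta u)), (lorentz (ell m) (F u)).
  move=> u' /esym/fiber_act[g Hg ->]; rewrite HF// He// Phi_act// vE.
  rewrite /xi -(groupHV_ell Hg) !scalemxAr -!mulmxDr (groupHV_ell Hg).
  by congr (_ *m _); rewrite /an; lmod_ring_over R.
move=> v [tv [a [b H]]]; have Hu := H u erefl.
have [aE bE] : a = lorentz (F u) (eta u) /\ b = lorentz (ell m) (F u).
  have := eta_Phi tauS u v; have := lorentz_ell_Phi u v; move: Hu; rewrite tv.
  move: (Phi u v) => p -> pl pe; rewrite /xi !lorentzDl !lorentzDr.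
  rewrite !lorentzZl !lorentzZr (eta_ell tauS) (eta_null tauS) lorentz_ell_ell.
  by rewrite pl pe; split; ring.
apply: (@Phi_inj _ _ _ _ u); rewrite vE /an -aE -bE Hu /xi.
by lmod_ring_over R.
Qed.

Lemma nabla_etaE u w :
  nablaT u w eta = Phi u (D_omega C tau (pr u) w) - tau (pr u) w *: eta u.
Proof.
have He := eta_tractor tauS; have /tractor_sectionP[es ee] := He.
have eqv : equivariant (fun u => nablaT u w eta).
  by move=> u' g Hg; exact: nablaT_act.
rewrite /D_omega (An_partE u eqv) /an.
have e0 : lorentz (nablaT u w eta) (eta u) = 0.
  have := nablaT_metric_cst u w He He (eta_null tauS).
  by rewrite (lorentzC (eta u)); lra.
have e1 : lorentz (ell m) (nablaT u w eta) = - tau (pr u) w.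
  have := nablaT_metric_cst u w (xi_tractor C) He (eta_ell tauS).
  rewrite -[nablaT u w (@xi _ _ _ C)]/(Phi u w) (eta_Phi tauS).
  by move=> /eqP; rewrite addrC addr_eq0 => /eqP.
by rewrite e0 e1; lmod_ring_over R.
Qed.

Lemma P_tau_smooth (W : vfield N) x :
  vsmooth_at W x -> vsmooth_at (fun y => P_tau C tau y (W y)) x.
Proof.
move=> HW; have HZ := (smooth_vfieldP Z).1 (@Z_omega_smooth _ _ _ C) x.
exact: (vsmooth_atB HW (vsmooth_atZ (tau_smooth tauS HW) HZ)).
Qed.

(** [nabla_tau] is applied to the projection of [W], and [Phi] of that projection is Phi(W) - tau(W)
    xi. The derivative of the subtracted term has An-part tau(W) P(V), which is exactly the middle
    term in the definition of [tnabla]. *)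
Lemma tnablaE u (V W : vfield N) : smooth_vfield V -> smooth_vfield W ->
  Phi u (tnabla C tau V W (pr u)) =
    mder (fun y => tau y (W y) : R) (pr u) (V (pr u)) *: ell m
    + an u (nablaT u (V (pr u)) (fun u' => Phi u' (W (pr u')))).
Proof.
move=> HV HW; have /smooth_vfieldP HW' := HW.
set x := pr u; pose PW : vfield N := fun y => P_tau C tau y (W y).
have HPW : smooth_vfield PW.
  by apply/smooth_vfieldP => y; exact: (P_tau_smooth (HW' y)).
have tW y : msmooth_at (fun y => tau y (W y) : R) y := tau_smooth tauS (HW' y).
have HFW := Phi_tractor C HW.
have /tractor_sectionP[FWs _] := HFW.
have FPW : (fun u' : P => Phi u' (PW (pr u'))) = (fun u' => Phi u' (W (pr u')) -
    tau (pr u') (W (pr u')) *: xi u').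
  apply/funext => u'; rewrite /PW /P_tau (linearPB (Phi_linear u')).
  by rewrite (linearPZ (Phi_linear u')) Phi_Z.
have xs := xi_smooth u.
have txs := tractor_scale tW (xi_tractor C).
have /tractor_sectionP[txs' _] := txs.
have ntx : nablaT u (V x) (fun u' => - (tau (pr u') (W (pr u')) *: xi u')) =
    - (mder (fun y => tau y (W y) : R) x (V x) *: ell m +
       tau x (W x) *: Phi u (V x)).
  rewrite (nablaT_opp (V x) (txs' u)); congr (- _).
  exact: (nablaT_scale (V x) (tW x) xs).
rewrite /tnabla (linearPD (Phi_linear u)) (linearPD (Phi_linear u)).
rewrite !(linearPZ (Phi_linear u)) Phi_Z -/x -addrA; congr (_ + _).
rewrite /nabla_tau (An_partE u); last first.
  by have /tractor_sectionP[] := nablaT_tractor (Phi_tractor C HPW) HV.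
rewrite FPW (nablaT_add _ (FWs u) (msmooth_atN (txs' u))).
rewrite -/x ntx; move: (nablaT u (V x) _) (Phi u (V x)) (an_Phi u (V x)).
move=> t p pE; rewrite (linearPD (an_linear u)) (linearPN (an_linear u)).
rewrite (linearPD (an_linear u)) !(linearPZ (an_linear u)) an_ell pE.
by rewrite scaler0 add0r addrC subrK.
Qed.

End Projection.

Section GalileanConnection.
Context {R : realType} {m : nat} {N : manifold R m.+1}.
Variable C : lightlike_cartan_geometry N.
Local Notation P := (tot C).
Local Notation TN := 'rV[R]_(m.+1).
Local Notation L := 'cV[R]_(1 + m + 1).
Local Notation pr := (@Defs.proj _ _ _ _ _ C).
Local Notation Z := (Z_omega C).
Local Notation h := (h_omega C).
Variables (tau : N -> TN -> R) (tauS : in_S C tau).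
Local Notation eta := (@Defs.eta _ _ _ C tau).
Local Notation an := (an tau).
Local Notation nab := (tnabla C tau).
Implicit Types (u : P) (x y : N) (g : 'M[R]_(1 + m + 1)) (F : P -> L) (v w : TN).
Implicit Types (V W X Y : vfield N).

Lemma an_smooth F u : msmooth_at F u -> msmooth_at (fun u => an u (F u)) u.
Proof.
move=> HF; have /tractor_sectionP[He _] := eta_tractor tauS.
have h1 := msmooth_atZ (msmooth_at_lorentz HF (He u)) (msmooth_at_cst (ell m) u).
have h2 := msmooth_atZ (msmooth_at_lorentz (msmooth_at_cst (ell m) u) HF) (He u).
exact: (msmooth_atB (msmooth_atB HF h1) h2).
Qed.

Lemma lorentz_an u t v : tau (pr u) v = 0 ->
  lorentz (an u t) (Phi u v) = lorentz t (Phi u v).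
Proof.
move=> v0; have ev := eta_Phi tauS u v; have lv := lorentz_ell_Phi u v.
rewrite v0 in ev; move: (Phi u v) ev lv => p ev lv.
by rewrite /an !lorentzBl !lorentzZl lv (lorentzC (eta u)) ev !mulr0 !subr0.
Qed.

Lemma tau_tnabla V W x : smooth_vfield V -> smooth_vfield W ->
  tau x (nab V W x) = mder (fun y => tau y (W y) : R) x (V x).
Proof.
move=> HV HW; have [u <-] := fiber_exists C x.
rewrite -(eta_Phi tauS) (tnablaE tauS)//; move: (nablaT _ _ _) => t.
by rewrite lorentzDl lorentzZl (eta_ell tauS) (lorentz_an_eta tauS) mulr1 addr0.
Qed.

Lemma h_tnabla V W u v : smooth_vfield V -> smooth_vfield W -> tau (pr u) v = 0 ->
  h (pr u) (nab V W (pr u)) v =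
    lorentz (nablaT u (V (pr u)) (fun u' => Phi u' (W (pr u')))) (Phi u v).
Proof.
move=> HV HW v0; rewrite h_omegaE (tnablaE tauS)//; move: (nablaT _ _ _) => t.
have lv := lorentz_ell_Phi u v; have at_ := lorentz_an t v0.
by move: (Phi u v) lv at_ => p lv at_; rewrite lorentzDl lorentzZl lv mulr0 add0r.
Qed.

Lemma tnabla_smooth V W : smooth_vfield V -> smooth_vfield W ->
  smooth_vfield (nab V W).
Proof.
move=> HV HW; apply/smooth_vfieldP => x; have [u <-] := fiber_exists C x.
have [U [s [ka Hs]]] := section_exists u; apply: (vsmooth_of_Phi Hs).
have [[Uo Ux] ss ks ps _] := Hs.
have HV' := (smooth_vfieldP V).1 HV; have HW' := (smooth_vfieldP W).1 HW.
have /tractor_sectionP[Fs _] := nablaT_tractor (Phi_tractor C HW) HV.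
have h1 := section_msmooth_at Hs (an_smooth (Fs u)).
have h2 := msmooth_at_along (tau_smooth tauS (HW' (pr u))) (HV' (pr u)).
have h3 := msmooth_atD (msmooth_atZ h2 (msmooth_at_cst (ell m) (pr u))) h1.
apply: (eq_msmooth_at _ h3).
have nU : \forall y \near pr u, U y by exact: open_nbhs_nbhs.
apply: filterS nU => y Uy; have := tnablaE tauS (s y) HV HW.
by rewrite ps// => ->.
Qed.

Let tnabla_at u V W v : smooth_vfield V -> smooth_vfield W -> V (pr u) = v ->
  Phi u (nab V W (pr u)) = mder (fun y => tau y (W y) : R) (pr u) v *: ell m
    + an u (nablaT u v (fun u' => Phi u' (W (pr u')))).
Proof. by move=> HV HW <-; exact: tnablaE. Qed.

Lemma tnabla_linear_connection : linear_connection nab.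
Proof.
have lin u W : smooth_vfield W -> linear (fun v =>
    mder (fun y => tau y (W y) : R) (pr u) v *: ell m
    + an u (nablaT u v (fun u' => Phi u' (W (pr u')))) : L).
  move=> HW k a b; have HW' := (smooth_vfieldP W).1 HW.
  have /tractor_sectionP[Fs Fe] := Phi_tractor C HW.
  have ml := mder_linear (tau_smooth tauS (HW' (pr u))).
  rewrite (ml k a b) (nablaT_linear Fe (Fs u) k a b).
  move: (nablaT u a _) (nablaT u b _) => ta tb; rewrite (an_linear tau u k ta tb).
  move: (an u ta) (an u tb) (mder _ _ a) (mder _ _ b) => aa ab ma mb.
  by rewrite -[k *: ma]/(k * ma); lmod_ring_over R.
have smD V V' : smooth_vfield V -> smooth_vfield V' -> smooth_vfield (fun y => V y + V' y).
  move=> /smooth_vfieldP HV /smooth_vfieldP HV'; apply/smooth_vfieldP => y.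
  exact: (vsmooth_atD (HV y) (HV' y)).
have smZ (f : N -> R) V : msmooth_on setT f -> smooth_vfield V ->
    smooth_vfield (fun y => f y *: V y).
  move=> Hf /smooth_vfieldP HV; apply/smooth_vfieldP => y.
  exact: (vsmooth_atZ (Hf y I) (HV y)).
split.
- exact: tnabla_smooth.
- move=> V V' W HV HV' HW x; have [u <-] := fiber_exists C x.
  apply: (@Phi_inj _ _ _ _ u); rewrite [in RHS](linearPD (Phi_linear u)).
  rewrite (tnabla_at (smD _ _ HV HV') HW erefl) !tnablaE//.
  exact: (linearPD (lin u W HW)).
- move=> f V W Hf HV HW x; have [u <-] := fiber_exists C x.
  apply: (@Phi_inj _ _ _ _ u); rewrite [in RHS](linearPZ (Phi_linear u)).
  rewrite (tnabla_at (smZ _ _ Hf HV) HW erefl) !tnablaE//.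
  exact: (linearPZ (lin u W HW)).
- move=> V W W' HV HW HW' x; have [u <-] := fiber_exists C x.
  apply: (@Phi_inj _ _ _ _ u); rewrite [in RHS](linearPD (Phi_linear u)).
  have HWW := smD _ _ HW HW'.
  refine (etrans (tnablaE tauS u HV HWW) (etrans _ (esym (congr2 +%R
    (tnablaE tauS u HV HW) (tnablaE tauS u HV HW'))))).
  have /tractor_sectionP[Fs _] := Phi_tractor C HW.
  have /tractor_sectionP[Fs' _] := Phi_tractor C HW'.
  have -> : (fun u' : P => Phi u' (W (pr u') + W' (pr u'))) =
      (fun u' => Phi u' (W (pr u')) + Phi u' (W' (pr u'))).
    by apply/funext => u'; rewrite (linearPD (Phi_linear u')).
  have -> : (fun y => tau y (W y + W' y)) = (fun y => tau y (W y) + tau y (W' y)).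
    by apply/funext => y; rewrite (tauD tauS).
  rewrite (nablaT_add _ (Fs u) (Fs' u)).
  rewrite (mderD _ (tau_smooth tauS ((smooth_vfieldP W).1 HW (pr u)))
    (tau_smooth tauS ((smooth_vfieldP W').1 HW' (pr u)))).
  move: (nablaT _ _ _) (nablaT _ _ _) => t t'; rewrite (linearPD (an_linear tau u)).
  by rewrite scalerDl addrACA.
- move=> f V W Hf HV HW x; have [u <-] := fiber_exists C x.
  apply: (@Phi_inj _ _ _ _ u); rewrite [in RHS](linearPD (Phi_linear u)).
  rewrite ![in RHS](linearPZ (Phi_linear u)).
  have HfW := smZ _ _ Hf HW.
  refine (etrans (tnablaE tauS u HV HfW) (etrans _ (esym (congr2 +%R
    (erefl _) (congr1 _ (tnablaE tauS u HV HW)))))).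
  have /tractor_sectionP[Fs _] := Phi_tractor C HW.
  have -> : (fun u' : P => Phi u' (f (pr u') *: W (pr u'))) =
      (fun u' => f (pr u') *: Phi u' (W (pr u'))).
    by apply/funext => u'; rewrite (linearPZ (Phi_linear u')).
  have -> : (fun y => tau y (f y *: W y)) = (fun y => f y * tau y (W y)).
    by apply/funext => y; rewrite (tau_scale tauS).
  rewrite (nablaT_scale _ (Hf (pr u) I) (Fs u)).
  rewrite (mderM _ (Hf (pr u) I) (tau_smooth tauS ((smooth_vfieldP W).1 HW (pr u)))).
  (* The derivative of [f] multiplies tau(W) times [ell] plus the An-part of Phi(W); these two
     components reassemble into Phi(W), which is the Leibniz term. *)
  have pE := an_Phi tauS u (W (pr u)).
  rewrite /P_tau (linearPB (Phi_linear u)) (linearPZ (Phi_linear u)) Phi_Z in pE.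
  move: (nablaT _ _ _) (Phi u (W _)) pE => t p pE.
  rewrite (linearPD (an_linear tau u)) !(linearPZ (an_linear tau u)) pE.
  by lmod_ring_over R.
Qed.

Lemma tnabla_galilean : galilean_connection tau h nab.
Proof.
split; first exact: tnabla_linear_connection.
  by move=> V W HV HW x; rewrite tau_tnabla// subrr.
move=> V X Y HV [HX X0] [HY Y0] x; have [u <-] := fiber_exists C x.
have [U [s [ka Hs]]] := section_exists u; have [[Uo Ux] ss ks ps _] := Hs.
have H := nablaT_metric (V (pr u)) Hs (Phi_tractor C HX) (Phi_tractor C HY).
refine (etrans _ (etrans H (esym (congr2 +%R (h_tnabla HV HX (Y0 (pr u)))
  (etrans (h_omegaC C _ _ _) (etrans (h_tnabla HV HY (X0 (pr u))) (lorentzC _ _))))))).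
apply: eq_mder.
have nU : \forall y \near pr u, U y by exact: open_nbhs_nbhs.
apply: filterS nU => y Uy; have := h_omegaE (s y) (X y) (Y y).
by rewrite ps// => ->.
Qed.

Lemma tnabla_Z_Z x : nab Z Z x = 0.
Proof.
have [u <-] := fiber_exists C x; have HZ := @Z_omega_smooth _ _ _ C.
apply: (@Phi_inj _ _ _ _ u); rewrite (tnablaE tauS)//.
have -> : (fun y => tau y (Z y)) = (fun=> 1) by apply/funext => y; exact: tau_Z.
have -> : (fun u' : P => Phi u' (Z (pr u'))) = @xi _ _ _ C.
  by apply/funext => u'; rewrite Phi_Z.
rewrite mder_cst scale0r add0r -[nablaT _ _ _]/(Phi u (Z (pr u))) Phi_Z.
by rewrite (an_ell tauS) (linearP0 (Phi_linear u)).
Qed.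

Lemma tnabla_Z X x : smooth_vfield X -> nab X Z x = P_tau C tau x (X x).
Proof.
move=> HX; have [u <-] := fiber_exists C x; have HZ := @Z_omega_smooth _ _ _ C.
apply: (@Phi_inj _ _ _ _ u); rewrite (tnablaE tauS)//.
have -> : (fun y => tau y (Z y)) = (fun=> 1) by apply/funext => y; exact: tau_Z.
have -> : (fun u' : P => Phi u' (Z (pr u'))) = @xi _ _ _ C.
  by apply/funext => u'; rewrite Phi_Z.
by rewrite mder_cst scale0r add0r -[nablaT _ _ _]/(Phi u (X (pr u))) (an_Phi tauS).
Qed.

(** On sections of An(tau) the derivative of [Z] is the identity, which is symmetric for [h]. *)
Lemma rot_tnabla X Y x : An_section tau X -> An_section tau Y ->
  Defs.rot h nab Z X Y x = 0.
Proof.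
move=> [HX X0] [HY Y0]; rewrite /Defs.rot !tnabla_Z// /P_tau X0 Y0 !scale0r !subr0.
by rewrite subrr.
Qed.

Lemma Phi_torsion V W u : smooth_vfield V -> smooth_vfield W ->
  Phi u (torsion nab V W (pr u)) =
    dform tau V W (pr u) *: ell m + an u (curvT V W (@xi _ _ _ C) u).
Proof.
move=> HV HW; have E1 := tnablaE tauS u HV HW; have E2 := tnablaE tauS u HW HV.
rewrite /torsion; move: (nab V W (pr u)) (nab W V (pr u)) E1 E2 => a1 a2 E1 E2.
rewrite /curvT /dform -[nablaT u (lie_bracket _ _ _) _]/(Phi u (lie_bracket V W (pr u))).
move: (lie_bracket V W (pr u)) => b.
rewrite !(linearPB (Phi_linear u)) E1 E2 {E1 E2}.
have pE := an_Phi tauS u b.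
rewrite /P_tau (linearPB (Phi_linear u)) (linearPZ (Phi_linear u)) Phi_Z in pE.
rewrite -[fun u' : P => nablaT u' (W (pr u')) (@xi _ _ _ C)]/(fun u' : P => Phi u' (W (pr u'))).
rewrite -[fun u' : P => nablaT u' (V (pr u')) (@xi _ _ _ C)]/(fun u' : P => Phi u' (V (pr u'))).
move: (nablaT _ _ _) (nablaT _ _ _) (Phi u b) pE => t t' p pE.
rewrite !(linearPB (an_linear tau u)) pE.
by move: (mder _ _ _) (mder _ _ _) => k k'; lmod_ring_over R.
Qed.

End GalileanConnection.

(** * Curvature *)

Section Curvature.
Context {R : realType} {m : nat} {N : manifold R m.+1}.
Variable C : lightlike_cartan_geometry N.
Local Notation P := (tot C).
Local Notation TN := 'rV[R]_(m.+1).
Local Notation L := 'cV[R]_(1 + m + 1).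
Local Notation pr := (@Defs.proj _ _ _ _ _ C).
Local Notation xi := (@xi _ _ _ C).
Local Notation T := (T_omega C).
Implicit Types (u : P) (x y : N) (g : 'M[R]_(1 + m + 1)) (F : P -> L) (v w : TN).
Implicit Types (V W X Y : vfield N).

(* In the chart at [pr u] and along a local section of P, derivatives of the
   components of V and W cancel against those in the bracket. *)
Lemma curvT_xi_tensorial u : exists k : TN -> TN -> L,
  [/\ forall v, linear (k v), forall v w, k v w = - k w v &
    forall V W, smooth_vfield V -> smooth_vfield W ->
      curvT V W xi u = k (V (pr u)) (W (pr u))].
Proof.
have [U [s [ka Hs]]] := section_exists u; have [[Uo Ux] ss ks ps [sk su ku]] := Hs.
set x := pr u in Hs Ux *; have xx : cdom x x := cdom_center x.
pose Q y : 'M[R]_(m.+1, 1 + m + 1) :=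
  \matrix_i (Phi (s y) (cvec x y (delta_mx 0 i)))^T.
have QE y w : cdom x y -> Phi (s y) w = (mder (chart x) y w *m Q y)^T.
  move=> cy; rewrite {1}(cvec_frame w cy) (linearP_sum (Phi_linear (s y))).
  rewrite mulmx_sum_row raddf_sum; apply: eq_bigr => i _.
  by rewrite (linearPZ (Phi_linear (s y))) rowK /= linearZ /= trmxK.
have Qs : msmooth_at Q x.
  apply/msmooth_mxP => i j.
  have Hi := Phi_section_smooth Hs (vsmooth_at_cvec xx (msmooth_at_cst (delta_mx 0 i) x)).
  apply: (eq_msmooth_at _ ((msmooth_mxP _ _).1 Hi j 0)).
  by near=> y; rewrite !mxE.
have trZ a (r r' : 'rV[R]_(1 + m + 1)) : (a *: r + r')^T = a *: r^T + r'^T.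
  exact: linearP.
have trB (r r' : 'rV[R]_(1 + m + 1)) : (r - r')^T = r^T - r'^T by exact: linearB.
have trD (r r' : 'rV[R]_(1 + m + 1)) : (r + r')^T = r^T + r'^T by exact: linearD.
pose A v := omega u (tmap s x v).
have Al : linear A.
  move=> a v w; have Hsx := ss x Ux; rewrite /A (tmap_linear Hsx).
  have := omega_linear u; rewrite -{1 2 3}su => H.
  by have := omega_linear (s x) a (tmap s x v) (tmap s x w); rewrite su.
(* What remains of the curvature on xi without the derivatives of the components of the fields: [Q]
   is the matrix of [Phi] in the coordinate frame and [A] the connection form along the section. *)
pose k v w := (w *m mder Q x v - v *m mder Q x w)^T + (A v *m Phi u w - A w *m Phi u v).
exists k; split.
- move=> v a w w'; rewrite /k (mder_linear Qs) Al (Phi_linear u).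
  move: (Phi u w) (Phi u w') (Phi u v) (A v) (A w) (A w') => p p' q B B' B''.
  move: (mder Q x v) (mder Q x w) (mder Q x w') => M M' M''.
  rewrite !mulmxDl !mulmxDr -!scalemxAl -!scalemxAr.
  rewrite !trB !trZ; move: (w *m M)^T (w' *m M)^T (v *m M')^T (v *m M'')^T.
  move: (B *m p) (B *m p') (B' *m q) (B'' *m q) => a1 a2 a3 a4 b1 b2 b3 b4.
  by lmod_ring_over R.
- move=> v w; rewrite /k.
  move: (Phi u w) (Phi u v) (A v) (A w) (mder Q x v) (mder Q x w) => p q B B' M M'.
  rewrite !trB; move: (w *m M)^T (v *m M')^T (B *m p) (B' *m q) => a b c d.
  by lmod_ring_over R.
have nab V W : smooth_vfield V -> smooth_vfield W ->
    nablaT u (V x) (fun u' => Phi u' (W (pr u'))) =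
    (mder (fun y => mder (chart x) y (W y)) x (V x) *m Q x
      + W x *m mder Q x (V x))^T + A (V x) *m Phi u (W x).
  move=> HV HW; have /tractor_sectionP[Fs Fe] := Phi_tractor C HW.
  have HW' := (smooth_vfieldP W).1 HW x.
  have D := nablaT_section (V x) Hs Ux Fe (Fs (s x)).
  rewrite su in D; rewrite D -/(A (V x)) -/x; congr (_ + _).
  rewrite -[in X in _ + X](mder_chart_center x (W x)).
  rewrite -(mder_mulmx (V x) HW' Qs).
  rewrite -(mder_trmx (V x) (msmooth_at_mulmx HW' Qs)).
  apply: eq_mder; have nU : \forall y \near x, U y by exact: open_nbhs_nbhs.
  apply: filterS2 nU (near_cdom xx) => y Uy cy.
  by rewrite ps// (QE y (W y) cy).
move=> V W HV HW; rewrite /curvT.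
rewrite -[fun u' : P => nablaT u' (W (pr u')) xi]/(fun u' : P => Phi u' (W (pr u'))).
rewrite -[fun u' : P => nablaT u' (V (pr u')) xi]/(fun u' : P => Phi u' (V (pr u'))).
rewrite -[nablaT u (lie_bracket _ _ _) _]/(Phi u (lie_bracket V W x)).
rewrite (nab V W HV HW) (nab W V HW HV) /k.
have := QE x (lie_bracket V W x) xx; rewrite su mder_chart_center => ->.
move: (Phi u (W x)) (Phi u (V x)) => p q; rewrite /lie_bracket mulmxBl.
move: (A (V x)) (A (W x)) (mder Q x (V x)) (mder Q x (W x)) => B B' M M'.
move: (mder _ x (V x)) (mder _ x (W x)) => a b.
move: (a *m Q x) (b *m Q x) (W x *m M) (V x *m M') (B *m p) (B' *m q) => *.
rewrite !trB !trD.
by lmod_ring_over R.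
Unshelve. all: by end_near. Qed.

(** Differentiating the orthogonality of xi and Phi(Y) along X gives minus the product of Phi(X) and
    Phi(Y), symmetric in the two fields, so it cancels in the curvature. This places the curvature
    on xi in the image of [Phi], where [T_omega] can represent it. *)
Lemma lorentz_ell_curvT V W u : smooth_vfield V -> smooth_vfield W ->
  lorentz (ell m) (curvT V W xi u) = 0.
Proof.
move=> HV HW.
have H X Y : smooth_vfield Y ->
    lorentz (ell m) (nablaT u (X (pr u)) (fun u' => Phi u' (Y (pr u')))) =
    - lorentz (Phi u (X (pr u))) (Phi u (Y (pr u))).
  move=> HY; apply/eqP; rewrite -addr_eq0 addrC; apply/eqP.
  exact: (nablaT_metric_cst u (X (pr u)) (xi_tractor C) (Phi_tractor C HY)
    (fun u' => lorentz_ell_Phi u' (Y (pr u')))).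
rewrite /curvT.
rewrite -[fun u' : P => nablaT u' (W (pr u')) xi]/(fun u' : P => Phi u' (W (pr u'))).
rewrite -[fun u' : P => nablaT u' (V (pr u')) xi]/(fun u' : P => Phi u' (V (pr u'))).
rewrite -[nablaT u (lie_bracket _ _ _) _]/(Phi u (lie_bracket V W (pr u))).
have HVW := H V W HW; have HWV := H W V HV.
have HL := lorentz_ell_Phi u (lie_bracket V W (pr u)).
move: (Phi u (lie_bracket V W (pr u))) (nablaT _ _ _) (nablaT _ _ _) HVW HWV HL.
move=> b t t' HVW HWV HL.
by rewrite !lorentzBr HVW HWV HL (lorentzC (Phi u (W _))) subrr subr0.
Qed.

Lemma curvT_act V W u g : smooth_vfield V -> smooth_vfield W -> groupH g ->
  curvT V W xi (act u g) = invmx g *m curvT V W xi u.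
Proof.
move=> HV HW Hg; rewrite /curvT proj_act//.
have /tractor_sectionP[Vs Ve] := Phi_tractor C HV.
have /tractor_sectionP[Ws We] := Phi_tractor C HW.
have E1 := nablaT_act (V (pr u)) We (Ws (act u g)) Hg.
have E2 := nablaT_act (W (pr u)) Ve (Vs (act u g)) Hg.
have E3 := nablaT_act (lie_bracket V W (pr u))
  (@xi_equivariant _ _ _ C) (xi_smooth (act u g)) Hg.
refine (etrans (congr2 +%R (congr2 +%R E1 (congr1 -%R E2)) (congr1 -%R E3)) _).
by rewrite !mulmxBr.
Qed.

(** The specification of [T_omega] ranges over all fields with the given values and all points of
    the fibre: tensoriality handles the former, equivariance the latter, and orthogonality to [ell]
    provides the preimage under [Phi]. *)
Lemma T_omegaP V W u : smooth_vfield V -> smooth_vfield W ->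
  Phi u (T (pr u) (V (pr u)) (W (pr u))) = curvT V W xi u.
Proof.
move=> HV HW; have [k [_ _ kP]] := curvT_xi_tensorial u.
set v := V (pr u); set w := W (pr u).
have k0 : lorentz (ell m) (k v w) = 0.
  by rewrite -(kP V W HV HW); exact: lorentz_ell_curvT.
suff -> : T (pr u) v w = Phi_inv u (k v w).
  by rewrite (Phi_invK _ k0) (kP V W HV HW).
apply: xget_unique.
  move=> V' W' HV' HW' EV EW u' /esym/fiber_act[g Hg ->].
  by rewrite curvT_act// kP// EV EW Phi_act// Phi_invK.
move=> t Ht; apply: (@Phi_inj _ _ _ _ u); rewrite Phi_invK//.
by rewrite -(Ht V W HV HW)// kP.
Qed.

Lemma T_omega_at u : exists k : TN -> TN -> L,
  [/\ forall v, linear (k v), forall v w, k v w = - k w v &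
    forall v w, Phi u (T (pr u) v w) = k v w].
Proof.
have [k [kl ka kP]] := curvT_xi_tensorial u; exists k; split=> // v w.
have [V HV EV] := global_field (pr u) v; have [W HW EW] := global_field (pr u) w.
by rewrite -[in LHS]EV -[in LHS]EW T_omegaP// kP// EV EW.
Qed.

Lemma T_omega_linear x v : linear (T x v).
Proof.
have [u <-] := fiber_exists C x; have [k [kl _ kP]] := T_omega_at u.
move=> a w w'; apply: (@Phi_inj _ _ _ _ u).
by rewrite (Phi_linear u) !kP kl.
Qed.

Lemma T_omegaN x v w : T x v w = - T x w v.
Proof.
have [u <-] := fiber_exists C x; have [k [_ ka kP]] := T_omega_at u.
by apply: (@Phi_inj _ _ _ _ u); rewrite (linearPN (Phi_linear u)) !kP.
Qed.

Lemma T_omega_linearl x w : linear (fun v => T x v w).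
Proof.
by move=> a v v'; rewrite T_omegaN T_omega_linear opprD -scalerN -!T_omegaN.
Qed.

Lemma T_omega_smooth_global V W x : smooth_vfield V -> smooth_vfield W ->
  vsmooth_at (fun y => T y (V y) (W y)) x.
Proof.
move=> HV HW; have [u <-] := fiber_exists C x.
have [U [s [ka Hs]]] := section_exists u; apply: (vsmooth_of_Phi Hs).
have [[Uo Ux] ss ks ps _] := Hs.
have h1 := nablaT_tractor (Phi_tractor C HW) HV.
have h2 := nablaT_tractor (Phi_tractor C HV) HW.
have HB : smooth_vfield (lie_bracket V W).
  apply/smooth_vfieldP => y; apply: vsmooth_at_bracket.
    exact: ((smooth_vfieldP V).1 HV).
  exact: ((smooth_vfieldP W).1 HW).
have h3 := Phi_tractor C HB.
have c := tractor_add (tractor_add h1 (tractor_opp h2)) (tractor_opp h3).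
have /tractor_sectionP[cs _] := c.
apply: (eq_msmooth_at _ (section_msmooth_at Hs (cs u))).
have nU : \forall y \near pr u, U y by exact: open_nbhs_nbhs.
apply: filterS nU => y Uy; refine (etrans (esym (T_omegaP (s y) HV HW)) _).
by rewrite (ps y Uy).
Qed.

(** Fields smooth only near [x] have to be related to global ones. The coordinate frame cut off by a
    bump function [b] is global, and near [x] every field is a combination of it with coefficients
    divided by [b]; bilinearity of the tensor does the rest. *)
Lemma T_omega_smooth X Y x : vsmooth_at X x -> vsmooth_at Y x ->
  vsmooth_at (fun y => T y (X y) (Y y)) x.
Proof.
move=> HX HY; have xx : cdom x x := cdom_center x.
have [b [b1 bs b0]] := bump_exists x.
pose E i : vfield N := fun y => b y *: cvec x y (delta_mx 0 i).
have Es i : smooth_vfield (E i).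
  apply/smooth_vfieldP => y; have [cy|cy] := pselect (cdom x y).
    exact: (vsmooth_atZ (bs y) (vsmooth_at_cvec cy (msmooth_at_cst _ y))).
  apply: (eq_vsmooth_at _ (vsmooth_at0 y)).
  by apply: filterS (b0 y cy) => z bz; rewrite /E bz scale0r.
have bn : \forall y \near x, b y != 0.
  have bc := msmooth_at_continuous (bs x).
  apply: (bc [set r | r != 0]); apply: open_nbhs_nbhs; split; first exact: open_neq.
  by rewrite /= b1 oner_neq0.
(* The reciprocal is treated as the inverse of a 1 x 1 matrix. *)
have bV : msmooth_at (fun y => (b y)^-1) x.
  have bu : ((b x)%:M : 'M[R]_1) \in unitmx by rewrite b1 unitmx1.
  have bM : msmooth_at (fun y => (b y)%:M : 'M[R]_1) x.
    apply/msmooth_mxP => i j; apply: eq_msmooth_at (bs x); near=> y.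
    by rewrite mxE !ord1.
  have := (msmooth_mxP _ _).1 (msmooth_at_invmx bu bM) 0 0; apply: eq_msmooth_at.
  by near=> y; rewrite invmx_scalar mxE.
pose f (X : vfield N) i y := (b y)^-1 * mder (chart x) y (X y) 0 i.
have fs X' i : vsmooth_at X' x -> msmooth_at (f X' i) x.
  by move=> HX'; exact: (msmooth_atM bV ((msmooth_mxP _ _).1 HX' 0 i)).
have XE (X' : vfield N) : \forall y \near x, X' y = \sum_i f X' i y *: E i y.
  apply: filterS2 bn (near_cdom xx) => y by0 cy.
  rewrite [LHS](cvec_frame (X' y) cy); apply: eq_bigr => i _.
  by rewrite /f /E scalerA mulrAC mulVf// mul1r.
apply: (@eq_vsmooth_at _ _ _ (fun y => \sum_i \sum_j
    (f X i y * f Y j y) *: T y (E i y) (E j y))).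
  apply: filterS2 (XE X) (XE Y) => y {1}-> {1}->.
  rewrite (linearP_sum (T_omega_linearl y _)); apply: eq_bigr => i _.
  rewrite (linearP_sum (@T_omega_linear y _)); apply: eq_bigr => j _.
  move: (E i y) (E j y) => e e'.
  rewrite (linearPZ (T_omega_linearl y _)) (linearPZ (@T_omega_linear y _)).
  by rewrite scalerA.
apply: vsmooth_at_sum => i; apply: vsmooth_at_sum => j.
apply: (vsmooth_atZ (msmooth_atM (fs X i HX) (fs Y j HY))).
exact: (T_omega_smooth_global x (Es i) (Es j)).
Unshelve. all: by end_near. Qed.

Lemma T_omega_two_form : tangent_valued_two_form T.
Proof.
split; [exact: T_omega_linear|exact: T_omegaN|].
move=> U X Y Uo /smooth_vfield_onP HX /smooth_vfield_onP HY.
by apply/smooth_vfield_onP => x Ux; exact: (T_omega_smooth (HX x Ux) (HY x Ux)).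
Qed.

End Curvature.

(** * Uniqueness of the Galilean connection *)

Section Uniqueness.
Context {R : realType} {m : nat} {N : manifold R m.+1}.
Variable C : lightlike_cartan_geometry N.
Local Notation TN := 'rV[R]_(m.+1).
Local Notation Z := (Z_omega C).
Local Notation h := (h_omega C).
Variables (tau : N -> TN -> R) (tauS : in_S C tau).
Variables (nab nab' : vfield N -> vfield N -> vfield N).
Hypotheses (gal : galilean_connection tau h nab)
  (gal' : galilean_connection tau h nab').
Hypotheses (tor : torsion_conditions C tau nab)
  (tor' : torsion_conditions C tau nab').
Implicit Types (V W X Y : vfield N).

(** Kept as an operation on global fields, the form in which connections are given; its values are
    shown to be sections of An(tau), hence are admissible test fields. *)
Let S V W : vfield N := fun x => nab V W x - nab' V W x.

Let hB x a b c : h x (a - b) c = h x a c - h x b c.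
Proof.
rewrite !(h_omegaC C x _ c).
exact: (linearPB (h_omega_linear C x c : linear (_ : _ -> R^o))).
Qed.

Let S_smooth V W : smooth_vfield V -> smooth_vfield W -> smooth_vfield (S V W).
Proof.
move=> HV HW; case: gal gal' => c _ _ [c' _ _]; apply/smooth_vfieldP => x.
exact: (vsmooth_atB ((smooth_vfieldP _).1 (conn_smooth c HV HW) x)
  ((smooth_vfieldP _).1 (conn_smooth c' HV HW) x)).
Qed.

Let S_sym V W : smooth_vfield V -> smooth_vfield W -> S V W = S W V.
Proof.
move=> HV HW; apply/funext => x; case: tor tor' => _ _ t [_ _ t'].
have := t V W HV HW x; rewrite -(t' V W HV HW x) /torsion /S.
move: (lie_bracket V W x) (nab V W x) (nab W V x) (nab' V W x) (nab' W V x).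
move=> b p q p' q' /(congr1 (fun z => z + (b + q - p'))) E.
have -> : p - p' = (p - q - b) + (b + q - p') by lmod_ring_over R.
by rewrite E; lmod_ring_over R.
Qed.

Let S_tau V W x : smooth_vfield V -> smooth_vfield W -> tau x (S V W x) = 0.
Proof.
move=> HV HW; case: gal gal' => _ c _ [_ c' _]; rewrite /S (tauB tauS).
have := c V W HV HW x; have := c' V W HV HW x.
move: (mder _ _ _) (tau x _) (tau x _) => d p p'; lra.
Qed.

Let S_An V W : smooth_vfield V -> smooth_vfield W -> An_section tau (S V W).
Proof. by move=> HV HW; split=> [|x]; [exact: S_smooth|exact: S_tau]. Qed.

Let S_metric V X Y x : smooth_vfield V -> An_section tau X -> An_section tau Y ->
  h x (S V X x) (Y x) = - h x (S V Y x) (X x).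
Proof.
move=> HV HX HY; case: gal gal' => _ _ c [_ _ c'].
have := c V X Y HV HX HY x; have := c' V X Y HV HX HY x; rewrite /S !hB.
rewrite !(h_omegaC C x (X x)).
move: (mder _ _ _) (h x _ _) (h x _ _) (h x _ _) (h x _ _) => d p q p' q'; lra.
Qed.

Let S_rot X Y x : An_section tau X -> An_section tau Y ->
  h x (S X Z x) (Y x) = h x (S Y Z x) (X x).
Proof.
move=> HX HY; case: tor tor' => _ c _ [_ c' _].
have := c X Y HX HY x; have := c' X Y HX HY x; rewrite /Defs.rot /S !hB.
rewrite !(h_omegaC C x (X x)).
move: (h x _ _) (h x _ _) (h x _ _) (h x _ _) => p q p' q'; lra.
Qed.

(** [h] is definite on An(tau): a null vector is a multiple of [Z], and tau reads off the factor. *)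
Let null_An X : An_section tau X -> (forall x, h x (X x) (X x) = 0) ->
  forall x, X x = 0.
Proof.
move=> [_ X0] H x; have [a E] := h_omega_eq0 (H x).
have := X0 x; rewrite E (tau_scale tauS) (tau_Z tauS) mulr1 => ->.
by rewrite scale0r.
Qed.

Let HZ : smooth_vfield Z. Proof. exact: Z_omega_smooth. Qed.

(** With Y = S(X, Z) as test field, rot gives h(S(X, Z), Y) = h(S(Y, Z), X), while metricity along
    [Z] and the symmetry of S give the same equality with the opposite sign. So Y has zero
    length. *)
Let S_Z X x : An_section tau X -> S X Z x = 0.
Proof.
move=> HX; have sX : smooth_vfield X by case: HX.
have HY := S_An sX HZ; apply: (null_An HY) => y.
have [sY _] := HY; have E1 := S_rot y HX HY; have E2 := S_metric y HZ HX HY.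
rewrite (S_sym HZ sX) (S_sym HZ sY) -E1 in E2.
by move: (h _ _ _) E2 => a; lra.
Qed.

Let S_ZZ x : S Z Z x = 0.
Proof. by case: tor tor' => c _ _ [c' _ _]; rewrite /S c c' subrr. Qed.

(* Koszul's sign argument: h(S(X, Y), W) is symmetric in X, Y and
   skew-symmetric in Y, W. *)
Let S_AnAn X Y x : An_section tau X -> An_section tau Y -> S X Y x = 0.
Proof.
move=> HX HY; have [sX _] := HX; have [sY _] := HY.
suff H W y : An_section tau W -> h y (S X Y y) (W y) = 0.
  by apply: (null_An (S_An sX sY)) => y; exact: (H _ y (S_An sX sY)).
move=> HW; have [sW _] := HW.
have E1 := S_metric y sX HY HW; have E2 := S_metric y sW HX HY.
have E3 := S_metric y sY HW HX.
rewrite (S_sym sW sX) (S_sym sW sY) in E2; rewrite (S_sym sY sX) in E3.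
by move: E1 E2 E3; move: (h y _ _) (h y _ _) (h y _ _) => a b c; lra.
Qed.

(** Both fields are split into a section of An(tau) and a multiple of [Z]. Linearity over functions
    in the first argument passes to the second by the symmetry of S, and the four resulting terms
    vanish. *)
Lemma galilean_unique V W x : smooth_vfield V -> smooth_vfield W ->
  nab V W x = nab' V W x.
Proof.
move=> HV HW; apply/eqP; rewrite -subr_eq0 -[_ - _]/(S V W x); apply/eqP.
have PS Y : smooth_vfield Y -> An_section tau (fun y => P_tau C tau y (Y y)).
  move=> HY; split; first apply/smooth_vfieldP => y.
    exact: (P_tau_smooth tauS ((smooth_vfieldP Y).1 HY y)).
  by move=> y; rewrite /P_tau (tauB tauS) (tau_scale tauS) (tau_Z tauS) mulr1 subrr.
have tS Y : smooth_vfield Y -> msmooth_on setT (fun y => tau y (Y y) : R).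
  by move=> HY y _; exact: (tau_smooth tauS ((smooth_vfieldP Y).1 HY y)).
have tZ Y : smooth_vfield Y -> smooth_vfield (fun y => tau y (Y y) *: Z y).
  move=> HY; apply/smooth_vfieldP => y.
  exact: (vsmooth_atZ (tS Y HY y I) ((smooth_vfieldP Z).1 HZ y)).
have dec Y : Y = fun y => P_tau C tau y (Y y) + tau y (Y y) *: Z y.
  by apply/funext => y; rewrite /P_tau subrK.
have S_decl Y Y' z : smooth_vfield Y -> smooth_vfield Y' ->
    S Y Y' z = S (fun y => P_tau C tau y (Y y)) Y' z + tau z (Y z) *: S Z Y' z.
  move=> HY HY'; have [sP _] := PS Y HY.
  have E n : linear_connection n -> n Y Y' z =
      n (fun y => P_tau C tau y (Y y)) Y' z + tau z (Y z) *: n Z Y' z.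
    move=> c; rewrite {1}(dec Y) (conn_addl c sP (tZ Y HY) HY').
    by rewrite (conn_scalel c (tS Y HY) HZ HY').
  case: gal gal' => c _ _ [c' _ _]; rewrite /S (E _ c) (E _ c').
  move: (nab _ _ _) (nab' _ _ _) (nab _ _ _) (nab' _ _ _) => p p' q q'.
  by lmod_ring_over R.
have [sPV _] := PS V HV; have [sPW _] := PS W HW.
have SW X y : smooth_vfield X -> S X W y =
    S (fun y => P_tau C tau y (W y)) X y + tau y (W y) *: S Z X y.
  by move=> HX; rewrite (S_sym HX HW) S_decl.
rewrite (S_decl V W x HV HW) (SW _ x sPV) (SW _ x HZ) S_ZZ.
rewrite (S_sym HZ sPV) (S_Z _ (PS V HV)) (S_Z _ (PS W HW)).
by rewrite (S_AnAn _ (PS W HW) (PS V HV)) !(scaler0, addr0).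
Qed.

End Uniqueness.

(** * Change of the one-form *)

Section ChangeOfForm.
Context {R : realType} {m : nat} {N : manifold R m.+1}.
Variable C : lightlike_cartan_geometry N.
Local Notation P := (tot C).
Local Notation TN := 'rV[R]_(m.+1).
Local Notation L := 'cV[R]_(1 + m + 1).
Local Notation pr := (@Defs.proj _ _ _ _ _ C).
Local Notation Z := (Z_omega C).
Local Notation h := (h_omega C).
Implicit Types (u : P) (x y : N) (v w : TN).

Section OneForm.
Variables (tau : N -> TN -> R) (tauS : in_S C tau).
Local Notation eta := (@Defs.eta _ _ _ C tau).
Local Notation D := (D_omega C tau).

Lemma Phi_D u w : Phi u (D (pr u) w) = nablaT u w eta + tau (pr u) w *: eta u.
Proof. by rewrite (nabla_etaE tauS) subrK. Qed.

Lemma D_omega_linear x : linear (D x).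
Proof.
have [u <-] := fiber_exists C x => a v w; apply: (@Phi_inj _ _ _ _ u).
have /tractor_sectionP[es ee] := eta_tractor tauS.
have Hv := Phi_D u v; have Hw := Phi_D u w.
have NL := nablaT_linear ee (es u) a v w; have Hvw := Phi_D u (a *: v + w).
rewrite NL (tauD tauS) (tau_scale tauS) in Hvw.
rewrite (Phi_linear u) Hv Hw Hvw; move: (nablaT _ _ _) (nablaT _ _ _) => t t'.
by lmod_ring_over R.
Qed.

Lemma D_omega_An x w : tau x (D x w) = 0.
Proof.
have [u <-] := fiber_exists C x; rewrite -(eta_Phi tauS) Phi_D.
have /tractor_sectionP[es ee] := eta_tractor tauS.
have He := eta_tractor tauS; have := nablaT_metric_cst u w He He (eta_null tauS).
move: (nablaT _ _ _) => t; rewrite lorentzDl lorentzZl (eta_null tauS).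
by rewrite (lorentzC (eta u)); lra.
Qed.

Lemma D_omega_smooth (W : vfield N) x : vsmooth_at W x ->
  vsmooth_at (fun y => D y (W y)) x.
Proof.
have [u <-] := fiber_exists C x => HW.
have [U [s [ka Hs]]] := section_exists u; apply: (vsmooth_of_Phi Hs).
have [[Uo Ux] ss ks ps _] := Hs; have He := eta_tractor tauS.
have /tractor_sectionP[es _] := He.
apply: (eq_msmooth_at _ (msmooth_atD (nablaT_section_smooth Hs He HW)
  (msmooth_atZ (tau_smooth tauS HW) (section_msmooth_at Hs (es u))))).
have nU : \forall y \near pr u, U y by exact: open_nbhs_nbhs.
apply: filterS nU => y Uy; have E := Phi_D (s y) (W y); rewrite (ps y Uy) in E.
exact: (esym E).
Qed.

Lemma D_omega_morphism : bundle_morphism D.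
Proof.
split; first exact: D_omega_linear.
move=> U X Uo /smooth_vfield_onP HX; apply/smooth_vfield_onP => x Ux.
exact: (D_omega_smooth (HX x Ux)).
Qed.

End OneForm.

Variables (tau taub : N -> TN -> R) (tauS : in_S C tau) (taubS : in_S C taub).
Local Notation eta := (@Defs.eta _ _ _ C tau).
Local Notation etab := (@Defs.eta _ _ _ C taub).
Local Notation Lt := (L_tau C tau taub).

(** [L_tau] is specified by a formula required for all orthonormal bases of An(taub); it takes one
    such basis to determine the value. *)
Lemma orthonormal_exists x : exists E : 'I_m -> TN,
  (forall i, taub x (E i) = 0) /\
  (forall i j, h x (E i) (E j) = (i == j)%:R).
Proof.
have [u <-] := fiber_exists C x.
have H i : exists v, taub (pr u) v = 0 /\ (phi u v).2 = delta_mx i 0.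
  have [w wE] := Phi_onto u 0 (delta_mx i 0); exists (P_tau C taub (pr u) w).
  split; first by rewrite /P_tau (tauB taubS) (tau_scale taubS) (tau_Z taubS) mulr1 subrr.
  have := PhiE u (P_tau C taub (pr u) w); rewrite /P_tau.
  rewrite (linearPB (Phi_linear u)) (linearPZ (Phi_linear u)) Phi_Z wE ellE.
  by rewrite lvecZ lvecN lvecD => /lvec_inj[_ <- _]; rewrite scaler0 subr0.
have [E HE] := choice H; exists E; split=> [i|i j]; first by case: (HE i).
rewrite h_omegaE !PhiE lorentz_lvec mulr0 mul0r addr0 add0r.
have [_ ->] := HE i; have [_ ->] := HE j.
by rewrite trmx_delta mul_delta_mx_cond; case: (i == j); rewrite !mxE.
Qed.

(** The R^m-parts of [m] orthonormal vectors are the rows of a square matrix [M] with M M^T = 1,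
    hence invertible; a vector orthogonal to them has zero R^m-part and is a multiple of [Z]. *)
Lemma orthonormal_complete x (E : 'I_m -> TN) v :
  (forall i j, h x (E i) (E j) = (i == j)%:R) ->
  taub x v = 0 -> (forall i, h x v (E i) = 0) -> v = 0.
Proof.
have [u <-] := fiber_exists C x => Eo tv vE.
have hE w w' : h (pr u) w w' = ((phi u w).2^T *m (phi u w').2) 0 0.
  by rewrite h_omegaE !PhiE lorentz_lvec mulr0 mul0r addr0 add0r.
pose M : 'M[R]_m := \matrix_i (phi u (E i)).2^T.
have MM : M *m M^T = 1%:M.
  apply/matrixP => i j; rewrite [RHS]mxE -Eo hE !mxE.
  by apply: eq_bigr => k _; rewrite !mxE.
have Mv : M *m (phi u v).2 = 0.
  apply/colP => i; rewrite [RHS]mxE -(vE i) h_omegaC hE !mxE.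
  by apply: eq_bigr => k _; rewrite !mxE.
have v0 : (phi u v).2 = 0.
  by rewrite -[LHS]mul1mx -(mulmx1C MM) -mulmxA Mv mulmx0.
have hv : h (pr u) v v = 0 by rewrite hE v0 mulmx0 mxE.
have [a aE] := h_omega_eq0 hv.
by move: tv; rewrite aE (tau_scale taubS) (tau_Z taubS) mulr1 => ->; rewrite scale0r.
Qed.

(** The right-hand side is orthogonal to [ell], so it is [Phi u v] for some [v]. Pairing with [etab]
    puts [v] in An(taub), and pairing with Phi(w) shows that h(v, w) = tau(w) there; expanding [v]
    in an orthonormal basis gives the defining sum of L. *)
Lemma Phi_L u :
  Phi u (Lt (pr u)) = eta u - etab u - lorentz (eta u) (etab u) *: ell m.
Proof.
set c := (X in _ = X).
have c0 : lorentz (ell m) c = 0.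
  rewrite /c !lorentzBr lorentzZr lorentz_ell_ell (eta_ell tauS) (eta_ell taubS).
  by rewrite mulr0 subrr subr0.
suff -> : Lt (pr u) = Phi_inv u c by rewrite Phi_invK.
set v := Phi_inv u c; have vE : Phi u v = c by rewrite Phi_invK.
have tv : taub (pr u) v = 0.
  rewrite -(eta_Phi taubS) vE /c !lorentzBl lorentzZl (eta_null taubS).
  by rewrite (eta_ell taubS) mulr1 subr0 subrr.
have hv w : taub (pr u) w = 0 -> h (pr u) v w = tau (pr u) w.
  move=> tw; rewrite h_omegaE vE /c !lorentzBl lorentzZl lorentz_ell_Phi.
  rewrite mulr0 subr0 !(lorentzC _ (Phi u w)) (eta_Phi tauS) (eta_Phi taubS) tw.
  by rewrite subr0.
have H (E : 'I_m -> TN) : (forall i, taub (pr u) (E i) = 0) ->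
    (forall i j, h (pr u) (E i) (E j) = (i == j)%:R) ->
    v = \sum_(i < m) tau (pr u) (E i) *: E i.
  move=> Et Eo; apply/eqP; rewrite -subr_eq0; apply/eqP.
  have tl : linear (taub (pr u) : _ -> R^o) := tau_linear taubS (pr u).
  apply: (orthonormal_complete Eo) => [|j].
    rewrite (tauB taubS) tv sub0r (linearP_sum tl) big1 ?oppr0// => i _.
    by rewrite (linearPZ tl) Et scaler0.
  rewrite h_omegaC.
  have hl : linear (h (pr u) (E j) : _ -> R^o) := h_omega_linear C (pr u) (E j).
  rewrite (linearPB hl) (linearP_sum hl) h_omegaC (hv _ (Et j)).
  rewrite (bigD1 j)//= (linearPZ hl) Eo eqxx big1 => [|i ij].
    by rewrite addr0 -[_ *: _]/(_ * _) mulr1 subrr.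
  by rewrite (linearPZ hl) Eo eq_sym (negbTE ij) scaler0.
have [E [Et Eo]] := orthonormal_exists (pr u).
apply: xget_unique; first by move=> E' Et' Eo'; exact: H.
by move=> v' /(_ E Et Eo) ->; rewrite -H.
Qed.

Lemma taub_L x : taub x (Lt x) = 0.
Proof.
have [u <-] := fiber_exists C x.
rewrite -(eta_Phi taubS) Phi_L !lorentzBl lorentzZl (eta_null taubS).
by rewrite (eta_ell taubS) mulr1 subr0 subrr.
Qed.

(** Nullity of both sections leaves the mixed product; this turns the coefficient of [ell] in
    [Phi_L] into half the squared length of L. *)
Lemma h_L u : h (pr u) (Lt (pr u)) (Lt (pr u)) = - 2 * lorentz (eta u) (etab u).
Proof.
rewrite h_omegaE Phi_L !lorentzBl !lorentzBr !lorentzZl !lorentzZr.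
rewrite lorentz_ell_ell (eta_null taubS) (eta_null tauS) !(lorentzC _ (ell m)).
rewrite (eta_ell tauS) (eta_ell taubS) (lorentzC (etab u)).
by move: (lorentz _ _) => a; ring.
Qed.

Lemma L_smooth : smooth_vfield Lt.
Proof.
apply/smooth_vfieldP => x; have [u <-] := fiber_exists C x.
have [U [s [ka Hs]]] := section_exists u; apply: (vsmooth_of_Phi Hs).
have [[Uo Ux] ss ks ps _] := Hs.
have /tractor_sectionP[es _] := eta_tractor tauS.
have /tractor_sectionP[ebs _] := eta_tractor taubS.
have h1 := msmooth_atB (es u) (ebs u).
have h2 := msmooth_atZ (msmooth_at_lorentz (es u) (ebs u)) (msmooth_at_cst (ell m) u).
apply: (eq_msmooth_at _ (section_msmooth_at Hs (msmooth_atB h1 h2))).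
have nU : \forall y \near pr u, U y by exact: open_nbhs_nbhs.
apply: filterS nU => y Uy; have E := Phi_L (s y); rewrite (ps y Uy) in E.
exact: (esym E).
Qed.

Lemma D_omega_change (W : vfield N) x : smooth_vfield W ->
  D_omega C taub x (W x) =
    P_tau C taub x (D_omega C tau x (W x) + (2^-1 * h x (Lt x) (Lt x)) *: W x)
    - tau x (W x) *: Lt x - tnabla C taub W Lt x.
Proof.
have [u <-] := fiber_exists C x => HW; set w := W (pr u).
pose f y := 2^-1 * h y (Lt y) (Lt y).
have HL := L_smooth; have HLx := (smooth_vfieldP Lt).1 HL.
have fs y : msmooth_at f y.
  have hs := h_omega_smooth C (HLx y) (HLx y).
  exact: (msmooth_atM (msmooth_at_cst (2^-1 : R) y) hs).
have etabE u' : etab u' = eta u' - Phi u' (Lt (pr u')) + f (pr u') *: @xi _ _ _ C u'.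
  rewrite Phi_L /f h_L /xi; move: (lorentz _ _) => a.
  have -> : 2^-1 * (- 2 * a) = - a by field.
  by lmod_ring_over R.
have /tractor_sectionP[es _] := eta_tractor tauS.
have /tractor_sectionP[Ls _] := Phi_tractor C HL.
have /tractor_sectionP[xs _] := tractor_scale fs (xi_tractor C).
(* The derivative of [f] enters as a multiple of [ell], which the projection [an] kills; the product
   of [f] and Phi(W) is the source of the term with h(L, L)/2. *)
have E : nablaT u w etab = nablaT u w eta - nablaT u w (fun u' => Phi u' (Lt (pr u')))
    + (mder f (pr u) w *: ell m + f (pr u) *: Phi u w).
  rewrite (funext etabE).
  refine (etrans (nablaT_add w (msmooth_atB (es u) (Ls u)) (xs u)) _).
  refine (congr2 +%R _ (nablaT_scale w (fs (pr u)) (xi_smooth u))).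
  refine (etrans (nablaT_add w (es u) (msmooth_atN (Ls u))) _).
  exact: (congr1 _ (nablaT_opp w (Ls u))).
have Eb := Phi_D taubS u w; have Et := Phi_D tauS u w.
have EL := tnablaE taubS u HW HL.
have tL0 : (fun y => taub y (Lt y) : R) = fun=> 0.
  by apply/funext => y; exact: taub_L.
rewrite tL0 mder_cst scale0r add0r -/w in EL.
have ew := an_Phi taubS u w; have eL := an_Phi taubS u (Lt (pr u)).
have eD := an_Phi taubS u (D_omega C tau (pr u) w).
have eDb := an_Phi taubS u (D_omega C taub (pr u) w).
have Hb := etabE u.
have PL : P_tau C taub (pr u) (Lt (pr u)) = Lt (pr u).
  by rewrite /P_tau taub_L scale0r subr0.
have PD : P_tau C taub (pr u) (D_omega C taub (pr u) w) = D_omega C taub (pr u) w.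
  by rewrite /P_tau (D_omega_An taubS) scale0r subr0.
have Pl k d : P_tau C taub (pr u) (d + k *: w) =
    P_tau C taub (pr u) d + k *: P_tau C taub (pr u) w.
  by rewrite /P_tau (tauD taubS) (tau_scale taubS); lmod_ring_over R.
rewrite PL in eL; rewrite PD in eDb; apply: (@Phi_inj _ _ _ _ u).
rewrite Pl -/(f (pr u)).
(* Abstracting every tractor leaves a linear identity in L^(m+2) at the single point [u]. *)
move: (tnabla C taub W Lt (pr u)) EL => t EL.
move: (D_omega C taub (pr u) w) {PD} eDb Eb => db eDb Eb.
move: (D_omega C tau (pr u) w) eD Et => d eD Et.
move: (P_tau C taub (pr u) d) eD => pd eD; move: (P_tau C taub (pr u) w) ew => pw ew.
move: (Lt (pr u)) {PL} eL Hb => l eL Hb.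
rewrite !(linearPB (Phi_linear u)) (linearPD (Phi_linear u)).
rewrite !(linearPZ (Phi_linear u)) -eD -ew EL.
move: (nablaT u w etab) (nablaT u w eta)
  (nablaT u w (fun u' => Phi u' (Lt (pr u')))) E Eb Et => tb t0 tl E Eb Et.
move: (Phi u db) (Phi u d) (Phi u l) (Phi u w) E eDb Eb Et eL Hb.
move=> pdb p_d p_l p_w E eDb Eb Et eL Hb.
have al := an_linear taub u; have ael := an_ell taubS u.
(* Seen from [taub], the section [eta] has An-component Phi(L). As the derivative of [eta] contains
   -tau(W) eta, this produces the term -tau(W) L. *)
have ae : an taub u (eta u) = p_l.
  have -> : eta u = etab u + p_l - f (pr u) *: ell m.
    by rewrite Hb /xi; lmod_ring_over R.
  rewrite (linearPB al) (linearPD al) (linearPZ al) (an_eta taubS) eL ael.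
  by rewrite scaler0 add0r subr0.
rewrite -eDb Eb E Et !(linearPD al) !(linearPZ al) (linearPN al) (an_eta taubS) ae ael.
by lmod_ring_over R.
Qed.

End ChangeOfForm.

(** * The torsion conditions and the final assembly *)

Section TorsionConditions.
Context {R : realType} {m : nat} {N : manifold R m.+1}.
Variable C : lightlike_cartan_geometry N.

Lemma tnabla_torsion_conditions tau : in_S C tau ->
  torsion_conditions C tau (tnabla C tau).
Proof.
move=> tauS; split; first exact: tnabla_Z_Z.
  by move=> X Y HX HY x; exact: rot_tnabla.
move=> V W HV HW x; have [u <-] := fiber_exists C x.
apply: (@Phi_inj _ _ _ _ u); refine (etrans (Phi_torsion tauS u HV HW) _).
have := an_Phi tauS u (T_omega C (Defs.proj u) (V (Defs.proj u)) (W (Defs.proj u))).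
rewrite (T_omegaP u HV HW) => ->; move: (P_tau _ _ _ _) => p.
by rewrite (linearPD (Phi_linear u)) (linearPZ (Phi_linear u)) Phi_Z addrC.
Qed.

End TorsionConditions.

Theorem theorem6p15 (R : realType) (m : nat) (m_ge2 : (2 <= m)%N)
    (N : manifold R m.+1) (N_connected : connected [set: N])
    (C : lightlike_cartan_geometry N) :
  (* (1) *)
  [/\ lightlike_metric (h_omega C),
      smooth_vfield (Z_omega C) &
      forall x, Z_omega C x != 0 /\
        radical (h_omega C) x = line (Z_omega C x)] /\
  (* (2) *)
  (tangent_valued_two_form (T_omega C) /\
   forall tau : N -> 'rV[R]_(m.+1) -> R, in_S C tau ->
     [/\ galilean_connection tau (h_omega C) (tnabla C tau),
         torsion_conditions C tau (tnabla C tau) &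
         forall nab : vfield N -> vfield N -> vfield N,
           galilean_connection tau (h_omega C) nab ->
           torsion_conditions C tau nab ->
           forall V W, smooth_vfield V -> smooth_vfield W ->
             forall x, nab V W x = tnabla C tau V W x]) /\
  (* (3) *)
  ((forall tau : N -> 'rV[R]_(m.+1) -> R, in_S C tau ->
      bundle_morphism (D_omega C tau) /\
      (forall x w, tau x (D_omega C tau x w) = 0)) /\
   forall tau taub : N -> 'rV[R]_(m.+1) -> R, in_S C tau -> in_S C taub ->
     forall W : vfield N, smooth_vfield W -> forall x,
       let Lt := L_tau C tau taub in
       D_omega C taub x (W x) =
         P_tau C taub x (D_omega C tau x (W x)
                         + (2^-1 * h_omega C x (Lt x) (Lt x)) *: W x)
         - tau x (W x) *: Lt x
         - tnabla C taub W Lt x).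
Proof.
split; [|split; split].
- split; [exact: h_omega_lightlike|exact: Z_omega_smooth|].
  by move=> x; split; [exact: Z_omega_neq0|exact: radical_h_omega].
- exact: T_omega_two_form.
- move=> tau tauS.
  have gal := tnabla_galilean tauS; have tor := tnabla_torsion_conditions tauS.
  split; [exact: gal|exact: tor|].
  move=> nab galn torn V W HV HW x.
  exact: (galilean_unique tauS galn gal torn tor x HV HW).
- move=> tau tauS; split; first exact: (D_omega_morphism tauS).
  by move=> x w; exact: (D_omega_An tauS).
- move=> tau taub tauS taubS W HW x Lt.
  exact: (D_omega_change tauS taubS x HW).
Qed.
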